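(* Let $m\ge 2$ be an integer, let $a\in[1,2)$, and let $H_2,\ldots,H_m\in\mathbb{C}$ be known and pairwise distinct. Then the specification of the two spectra $\{\lambda_{n,0}\}_{n\in\mathbb{N}}$ and $\{\lambda_{n,1}\}_{n\in\mathbb{N}}$ of the problems $\mathcal{B}_0(q,H)$ and $\mathcal{B}_1(q,H)$, together with $a$, uniquely determines $q_j$ for all $j=2,\ldots,m$. That is: if $q=[q_2,\ldots,q_m]$ and $\tilde q=[\tilde q_2,\ldots,\tilde q_m]$ are two collections of complex-valued functions in $L_2(0,1)$ with $q_j(x)=\tilde q_j(x)=0$ for a.e. $x\in(0,a-1)$, $j=2,\ldots,m$, and if for each $\nu\in\{0,1\}$ the spectra of $\mathcal{B}_\nu(q,H)$ and $\mathcal{B}_\nu(\tilde q,H)$ (with the same $m$, $a$ and $H=[H_2,\ldots,H_m]$) coincide, counted with multiplicity, then $q_j=\tilde q_j$ a.e. on $(0,1)$ for all $j=2,\ldots,m$.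
   Context: Let $m\ge2$, $a\in[1,2)$, $H=[H_2,\ldots,H_m]\in\mathbb{C}^{m-1}$, and let $q=[q_2,\ldots,q_m]$, where each $q_j\in L_2(0,1)$ is complex-valued and $q_j(x)=0$ for a.e. $x\in(0,a-1)$. For $\nu\in\{0,1\}$, the eigenvalue problem $\mathcal{B}_\nu=\mathcal{B}_\nu(q,H)$ for functions $y_1,\ldots,y_m\in W_2^2[0,1]$ (one on each of the $m$ unit-length edges of a star-shaped graph) consists of: (1) the equations $-y_1''(x)=\lambda y_1(x)$, $0<x<1$, and $-y_j''(x)+q_j(x)y_j(x-a)=\lambda y_j(x)$, $0<x<1$, $j=2,\ldots,m$, where $y_j(x-a):=y_1(x-a+1)$ for $a-1<x<1$, and the term $q_j(x)y_j(x-a)$ is zero for $x\in(0,a-1)$ because $q_j$ vanishes there; (2) the matching conditions $y_1(1)=y_j(0)$, $j=2,\ldots,m$, and $y_1'(1)=\sum_{j=2}^m y_j'(0)$; (3) the boundary conditions $y_1^{(\nu)}(0)=0$ and $V_j(y_j):=y_j'(1)+H_jy_j(1)=0$, $j=2,\ldots,m$. An eigenvalue is a $\lambda\in\mathbb{C}$ for which there is a nontrivial solution $(y_1,\ldots,y_m)$. Multiplicity: with $\rho^2=\lambda$, put $S_0(x,\lambda)=\frac{\sin\rho x}{\rho}$, $S_1(x,\lambda)=\cos\rho x$, $v_{\nu,j}(\lambda)=V_j(S_\nu(\cdot,\lambda))$, $Q_{\nu,j}(x,\lambda)=\int_{a-1}^x\frac{\sin\rho(x-t)}{\rho}q_j(t)S_\nu(t-a+1,\lambda)\,dt$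 (values at $\rho=0$ are understood by continuity; the prime denotes differentiation in the first argument $x$), and $$\Delta_\nu(\lambda)=S_\nu'(1,\lambda)\prod_{j=2}^m v_{0,j}(\lambda)+\sum_{j=2}^m\Big(S_\nu(1,\lambda)v_{1,j}(\lambda)+V_j(Q_{\nu,j}(\cdot,\lambda))\Big)\prod_{l=2,\,l\ne j}^m v_{0,l}(\lambda).$$ This is an entire function of $\lambda$, the characteristic function of $\mathcal{B}_\nu$, whose zeros are the eigenvalues of $\mathcal{B}_\nu$. The spectrum $\{\lambda_{n,\nu}\}_{n\in\mathbb{N}}$ of $\mathcal{B}_\nu$ is the sequence of its eigenvalues, each repeated according to its order as a zero of $\Delta_\nu$. *)

(* Defs.v *)
From HB Require Import structures.
From mathcomp Require Import all_boot all_order all_algebra.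
From mathcomp Require Import complex.
From mathcomp Require Import all_classical all_reals all_analysis.

Set Implicit Arguments.
Unset Strict Implicit.
Unset Printing Implicit Defensive.

Import Order.TTheory GRing.Theory Num.Theory.
Import numFieldNormedType.Exports.

Local Open Scope classical_set_scope.
Local Open Scope complex_scope.
Local Open Scope ring_scope.

(* Conventions used throughout:
   - functions on [0, 1] are represented by total functions on R, of which only
     the values on [0, 1] (up to null sets for L_2 functions) matter;
   - the m - 1 edges carrying a potential are indexed by j : 'I_m.-1, so that
     j = 0, ..., m - 2 stands for the edge number j + 2;
   - nu : bool stands for the index 0 (false) or 1 (true). *)

(* Differentiability over K near z makes g holomorphic when K = R[i]; k = 0 means
   that f is holomorphic near z and f z != 0. *)
Definition zero_of_order (K : numFieldType) (f : K -> K) (z : K) (k : nat) :=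
  exists2 g : K -> K, g z != 0 &
    \forall w \near z, derivable g w 1 /\ f w = (w - z) ^+ k * g w.

Section Defs.
Variable R : realType.
Local Notation C := R[i].
Local Notation mu := (@lebesgue_measure R).

Definition cexp (z : C) : C :=
  (expR (complex.Re z))%:C * (cos (complex.Im z) +i* sin (complex.Im z)).
Definition ccos (z : C) : C := (cexp ('i%C * z) + cexp (- 'i%C * z)) / 2%:R.
Definition csin (z : C) : C := (cexp ('i%C * z) - cexp (- 'i%C * z)) / (2%:R * 'i%C).

Definition cderive (f : R -> C) (x : R) : C :=
  derive1 (fun t => complex.Re (f t)) x +i*
  derive1 (fun t => complex.Im (f t)) x.

Definition cintegral (D : set R) (f : R -> C) : C :=
  (\int[mu]_(x in D) complex.Re (f x)) +i* (\int[mu]_(x in D) complex.Im (f x)).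

Definition L2_01 (f : R -> C) : Prop :=
  [/\ measurable_fun (`]0, 1[ : set R) (fun x => complex.Re (f x)),
      measurable_fun (`]0, 1[ : set R) (fun x => complex.Im (f x)) &
      mu.-integrable (`]0, 1[ : set R)
        (fun x => (complex.Re (f x) ^+ 2 + complex.Im (f x) ^+ 2)%:E)].

(* y belongs to W_2^2[0, 1], with derivative y' and second derivative y'':
   y and y' are absolutely continuous on [0, 1] and y'' is in L_2(0, 1). *)
Definition W22 (y y' y'' : R -> C) : Prop :=
  L2_01 y'' /\
  forall x, 0 <= x <= 1 ->
    y x = y 0 + cintegral `[0, x] y' /\ y' x = y' 0 + cintegral `[0, x] y''.

Section Problem.
Variables (m : nat) (a : R).
Variables (q : 'I_m.-1 -> R -> C) (H : 'I_m.-1 -> C).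
Variable nu : bool.

Definition eigenvalue_B (lambda : C) : Prop :=
  exists (y1 y1' y1'' : R -> C) (y y' y'' : 'I_m.-1 -> R -> C),
    [/\ W22 y1 y1' y1'' /\ (forall j, W22 (y j) (y' j) (y'' j)),
        {ae mu, forall x, 0 < x < 1 -> - y1'' x = lambda * y1 x} /\
        (forall j, {ae mu, forall x, 0 < x < 1 ->
           - y'' j x + (if a - 1 < x then q j x * y1 (x - a + 1) else 0)
             = lambda * y j x}),
        (forall j, y1 1 = y j 0) /\ y1' 1 = \sum_j y' j 0,
        (if nu then y1' else y1) 0 = 0 /\
        (forall j, y' j 1 + H j * y j 1 = 0) &
        exists2 x, 0 <= x <= 1 & y1 x != 0 \/ exists j, y j x != 0].

(* In S0, S1 the choice of the square root rho of lambda is immaterial, both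
   functions being even in rho. *)
Definition S0 (x : R) (lambda : C) : C :=
  let rho := sqrtC lambda in
  if rho == 0 then x%:C else csin (rho * x%:C) / rho.

Definition S1 (x : R) (lambda : C) : C := ccos (sqrtC lambda * x%:C).

Definition Snu (b : bool) : R -> C -> C := if b then S1 else S0.

Definition V (j : 'I_m.-1) (f : R -> C) : C := cderive f 1 + H j * f 1.

Definition v (b : bool) (j : 'I_m.-1) (lambda : C) : C := V j (Snu b ^~ lambda).

(* The potential q_j is extended by 0 outside (0, 1), so that Q is defined near
   x = 1 and its (two-sided) derivative there is the left derivative of the
   function defined on [a - 1, 1]. *)
Definition Q (j : 'I_m.-1) (x : R) (lambda : C) : C :=
  cintegral (`[a - 1, x] `&` `]0, 1[)
    (fun t => S0 (x - t) lambda * q j t * Snu nu (t - a + 1) lambda).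

Definition Delta (lambda : C) : C :=
  cderive (Snu nu ^~ lambda) 1 * \prod_j v false j lambda
  + \sum_j (Snu nu 1 lambda * v true j lambda + V j (Q j ^~ lambda))
           * \prod_(l | l != j) v false l lambda.

(* An eigenvalue is a solvability property of the boundary value problem, while
   its multiplicity is its order as a zero of Delta. *)
Definition is_spectrum (lam : nat -> C) : Prop :=
  (forall n, eigenvalue_B (lam n)) /\
  (forall z, eigenvalue_B z ->
     exists2 k, zero_of_order Delta z k & ([set n | lam n = z] #= `I_k)%card).

End Problem.
End Defs.

(* Main.v *)
Require Import Defs.
From HB Require Import structures.
From mathcomp Require Import all_boot all_order all_algebra.
From mathcomp Require Import complex.
From mathcomp Require Import all_classical all_reals all_analysis.
From mathcomp Require Import measurable_realfun ring lra.

(** Put lambda = rho^2; then S_nu, v_{nu,j} and Delta_nu become even functions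
of rho. Let W_{nu,j} = V_j (Q_{nu,j}), the contribution of the potential of one
edge (edge_form); it is linear in this potential, so Delta_nu is affine in the
potentials, W_{nu,j} occurring with the factor prod_{l != j} v_{0,l}. Write
Delta'_nu for the characteristic function of the second problem, and p_j for
the difference of the two potentials of an edge.

The characteristic functions agree. A zero of Delta_nu is an eigenvalue: on the
first edge take S_nu; the coefficients of S_0 on the others solve a linear
system with determinant Delta_nu, even where some v_{0,j} vanishes, as the
others do not (eigenvalue_of_Delta_eq0). Hence a zero of Delta_nu belongs to
the common spectrum and is a zero of Delta'_nu of the same order, so that
Delta'_nu / Delta_nu has no poles (Delta_dominated). On large squares that
avoid the zeros this quotient is 1 + O(1 / rho), because W_{nu,j} is by a factor
rho smaller than the leading terms (Delta_difference_small). By the theorem of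
Liouville, Delta'_nu = Delta_nu (Delta_agree).

The edges separate. It follows that sum_j W_{nu,j} prod_{l != j} v_{0,l} = 0,
where W_{nu,j} is now taken for p_j. Where v_{0,j} vanishes the other v_{0,l} do
not, since the H_l are distinct; therefore W_{nu,j} / v_{0,j} is entire
(edge_form_dominated). On large squares it is O(1 / rho) for nu = 0 and bounded
for nu = 1: W_{0,j} = 0 and W_{1,j} = c v_{0,j} with a constant c
(edge_form_false_eq0, edge_form_true_multiple).

The potential vanishes. The function W_{1,j} + i rho W_{0,j} = c v_{0,j} is the
integral of p_j against phi (t) e^{i rho (t - a + 1)}, where
phi (t) = cos rho (1 - t) + H_j sin rho (1 - t) / rho; apart from elementary
factors it consists of the mass of p_j and of the integral of
e^{i rho (2 t - a)} p_j (edge_plus). For rho = i tau, tau to + infinity, it is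
o (e^tau), whereas v_{0,j} grows like e^tau: c = 0. For rho = - i tau the mass
carries the largest exponential, so it is 0; then the integrals of
e^{2 tau t} p_j vanish for all large tau. Taking tau = n / 2, p_j is orthogonal
to exp (- e^{n (t - x)}) - 1, an exponential series in e^{n t}, which for n to
infinity tends to minus the indicator function of t > x. Thus the integral of
p_j over each ]x, 1] is 0, and p_j = 0 almost everywhere (moments_eq0_ae).

The function theory behind this is kept at the level of second-order expansions
(expands2), which pass through integrals by plain estimates. The maximum
principle for a quotient f / g without poles is obtained from averages of
|F|^2 over four points, applied to F = f^(n+2) / g^(n+1), which extends
continuously by 0 to the zeros of g (max_principle). *)

Set Implicit Arguments.
Unset Strict Implicit.
Unset Printing Implicit Defensive.

Import Order.TTheory GRing.Theory Num.Theory.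
Import numFieldNormedType.Exports.
Import Normc.

Local Open Scope classical_set_scope.
Local Open Scope complex_scope.
Local Open Scope ring_scope.

(** * Modulus and exponential of complex numbers *)

Section ComplexModulus.
Variable R : realType.
Local Notation C := R[i].
Implicit Types (z w : C) (x y : R).

Lemma le_of_eq x y : x = y -> x <= y.
Proof. by move=> ->. Qed.

Lemma normc_normr z : `|z| = (normc z)%:C.
Proof. by []. Qed.

Lemma normc_ge0 z : 0 <= normc z.
Proof. by case: z => a b; rewrite sqrtr_ge0. Qed.

Lemma sqr_normcE z : normc z ^+ 2 = complex.Re z ^+ 2 + complex.Im z ^+ 2.
Proof. by case: z => a b; rewrite sqr_sqrtr// addr_ge0// sqr_ge0. Qed.

Lemma ler_sqr_normc x z : x ^+ 2 <= normc z ^+ 2 -> `|x| <= normc z.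
Proof.
move=> h; rewrite -(@ler_pXn2r _ 2) ?nnegrE ?normc_ge0//.
by rewrite real_normK ?num_real.
Qed.

Lemma Re_le_normc z : `|complex.Re z| <= normc z.
Proof. by apply: ler_sqr_normc; rewrite sqr_normcE lerDl sqr_ge0. Qed.

Lemma Im_le_normc z : `|complex.Im z| <= normc z.
Proof. by apply: ler_sqr_normc; rewrite sqr_normcE lerDr sqr_ge0. Qed.

Lemma le_normcD z w : normc (z + w) <= normc z + normc w.
Proof. exact: complex.le_normcD. Qed.

Lemma normcN z : normc (- z) = normc z.
Proof. exact: complex.normcN. Qed.

Lemma normc_real x : normc x%:C = `|x|.
Proof. by rewrite /normc /= expr0n/= addr0 sqrtr_sqr. Qed.

Lemma normc_nat n : normc (n%:R : C) = n%:R.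
Proof. by rewrite -[n%:R]/(1 *+ n) normcMn normc1. Qed.

Lemma normci : normc ('i : C) = 1.
Proof. by rewrite /normc /= expr0n expr1n add0r sqrtr1. Qed.

Lemma normc_le_ReIm z : normc z <= `|complex.Re z| + `|complex.Im z|.
Proof.
rewrite -(@ler_pXn2r _ 2) ?nnegrE ?normc_ge0 ?addr_ge0 ?normr_ge0//.
rewrite sqr_normcE sqrrD !real_normK ?num_real// addrAC lerDl.
by rewrite mulrn_wge0// mulr_ge0.
Qed.

Lemma normc_eq0 z : (normc z == 0) = (z == 0).
Proof. by apply/eqP/eqP => [/eq0_normc//|->]; rewrite normc0. Qed.

Lemma normc_gt0 z : (0 < normc z) = (z != 0).
Proof. by rewrite lt_neqAle normc_ge0 andbT eq_sym normc_eq0. Qed.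

Lemma normcX z n : normc (z ^+ n) = normc z ^+ n.
Proof. by elim: n => [|n IH]; rewrite ?expr0 ?normc1// !exprS normcM IH. Qed.

Lemma normcf z w : normc (z / w) = normc z / normc w.
Proof. by rewrite normcM normcV. Qed.

Lemma le_normcB z w : normc (z - w) <= normc z + normc w.
Proof. by rewrite -[normc w]normcN le_normcD. Qed.

Lemma normc_distC z w : normc (z - w) = normc (w - z).
Proof. by rewrite -normcN opprB. Qed.

Lemma le_normc_subr z w : normc z - normc w <= normc (z - w).
Proof. by rewrite lerBlDr -{1}(subrK w z) le_normcD. Qed.

Lemma le_normc_addr z w : normc z - normc w <= normc (z + w).
Proof. by rewrite -[w in X in _ <= X]opprK -(normcN w) le_normc_subr. Qed.

Lemma normc_sum (I : Type) (r : seq I) (P : pred I) (F : I -> C) :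
  normc (\sum_(i <- r | P i) F i) <= \sum_(i <- r | P i) normc (F i).
Proof.
elim/big_ind2: _ => //; first by rewrite normc0.
by move=> a b c d ab cd; apply: le_trans (le_normcD _ _) _; apply: lerD.
Qed.

End ComplexModulus.

Section Cexp.
Variable R : realType.
Local Notation C := R[i].
Implicit Types (z w : C) (x y : R).

Lemma cexpD z w : cexp (z + w) = cexp z * cexp w.
Proof.
case: z w => [a b] [c d]; rewrite /cexp /= expRD cosD sinD.
by apply/eqP; rewrite eq_complex /=; apply/andP; split; apply/eqP; ring.
Qed.

Lemma cexp0 : cexp (0 : C) = 1.
Proof. by rewrite /cexp /= expR0 cos0 sin0 mul1r. Qed.

Lemma normc_cexp z : normc (cexp z) = expR (complex.Re z).
Proof.
rewrite /cexp normcM normc_real ger0_norm ?expR_ge0// /normc.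
by rewrite cos2Dsin2 sqrtr1 mulr1.
Qed.

Lemma cexp_neq0 z : cexp z != 0.
Proof. by rewrite -normc_gt0 normc_cexp expR_gt0. Qed.

Lemma cexpN z : cexp (- z) = (cexp z)^-1.
Proof.
apply: (mulIf (cexp_neq0 z)).
by rewrite -cexpD addNr cexp0 mulVf ?cexp_neq0.
Qed.

End Cexp.

(** * Second-order expansions *)

Section Expansion.
Variable R : realType.
Local Notation C := R[i].
Implicit Types (z w h : C) (f g : C -> C).

(** Local expansion to second order with a cubic error: all of complex
differentiability that the four-point argument of no_interior_max uses.
Unlike holomorphy, it passes through integrals by a mere estimate. *)
Definition expands2 f z := exists (f1 f2 : C) (K r : R), [/\ 0 < r, 0 <= K &
  forall h, normc h <= r ->
    normc (f (z + h) - (f z + f1 * h + f2 * h ^+ 2)) <= K * normc h ^+ 3].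

Lemma expands2_cst (c : C) z : expands2 (fun=> c) z.
Proof.
exists 0, 0, 0, 1; split => // h _.
by rewrite !mul0r !addr0 subrr normc0.
Qed.

Lemma expands2_id z : expands2 id z.
Proof.
exists 1, 0, 0, 1; split => // h _.
by rewrite mul1r mul0r addr0 subrr normc0 mul0r.
Qed.

Lemma expands2D f g z : expands2 f z -> expands2 g z ->
  expands2 (fun w => f w + g w) z.
Proof.
move=> [f1 [f2 [K [r [r0 K0 hf]]]]] [g1 [g2 [L [s [s0 L0 hg]]]]].
exists (f1 + g1), (f2 + g2), (K + L), (Num.min r s).
split; [by rewrite lt_min r0 | by rewrite addr_ge0 |] => h.
rewrite le_min => /andP[hr hs].
rewrite (_ : _ - _ = (f (z + h) - (f z + f1 * h + f2 * h ^+ 2)) +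
  (g (z + h) - (g z + g1 * h + g2 * h ^+ 2))); last by ring.
by rewrite [X in _ <= X]mulrDl (le_trans (le_normcD _ _))// lerD ?hf ?hg.
Qed.

(** Lipschitz at one point: continuity in a form stable under integration. *)
Definition lipschitz_at f z := exists (K r : R), [/\ 0 < r, 0 <= K &
  forall h, normc h <= r -> normc (f (z + h) - f z) <= K * normc h].

Lemma expands2_lipschitz f z : expands2 f z -> lipschitz_at f z.
Proof.
move=> [f1 [f2 [K [r [r0 K0 hf]]]]].
exists (normc f1 + normc f2 + K), (Num.min r 1).
split; first by rewrite lt_min r0 ltr01.
  by rewrite !addr_ge0// normc_ge0.
move=> h; rewrite le_min => /andP[hr h1]; have n0 := normc_ge0 h.
rewrite (_ : _ - _ = (f1 * h + f2 * h ^+ 2) +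
  (f (z + h) - (f z + f1 * h + f2 * h ^+ 2))); last by ring.
rewrite (le_trans (le_normcD _ _))// [X in _ <= X]mulrDl; apply: lerD.
  rewrite (le_trans (le_normcD _ _))// [X in _ <= X]mulrDl; apply: lerD; first by rewrite normcM.
  by rewrite normcM normcX expr2 ler_wpM2l ?normc_ge0// ler_piMl.
apply: le_trans (hf _ hr) _; rewrite ler_wpM2l// exprS ler_piMr//.
by rewrite exprn_ile1.
Qed.

Lemma lipschitz_at_bounded f z : lipschitz_at f z ->
  exists B r : R, [/\ 0 < r, 0 <= B & forall h, normc h <= r -> normc (f (z + h)) <= B].
Proof.
move=> [K [r [r0 K0 hf]]]; exists (normc (f z) + K * r), r; split => //.
  by rewrite addr_ge0 ?normc_ge0// mulr_ge0// ltW.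
move=> h hr; rewrite -(subrK (f z) (f (z + h))) addrC (le_trans (le_normcD _ _))//.
by rewrite lerD2l (le_trans (hf _ hr))// ler_wpM2l.
Qed.

Lemma expands2M f g z : expands2 f z -> expands2 g z ->
  expands2 (fun w => f w * g w) z.
Proof.
move=> Hf Hg; have [B [t [t0 B0 hB]]] := lipschitz_at_bounded (expands2_lipschitz Hg).
move: Hf Hg => [f1 [f2 [K [r [r0 K0 hf]]]]] [g1 [g2 [L [s [s0 L0 hg]]]]].
exists (f z * g1 + f1 * g z), (f z * g2 + f1 * g1 + f2 * g z).
set A := normc (f z) + normc f1 + normc f2.
exists (K * B + A * L + (normc f1 * normc g2 + normc f2 * normc g1 + normc f2 * normc g2)).
exists (Num.min 1 (Num.min r (Num.min s t))).
have A0 : 0 <= A by rewrite !addr_ge0// normc_ge0.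
split; first by rewrite !lt_min r0 s0 t0 ltr01.
  by rewrite !addr_ge0 ?mulr_ge0// normc_ge0.
move=> h; rewrite !le_min => /and4P[h1 hr hs ht].
set P := f z + f1 * h + f2 * h ^+ 2; set Q := g z + g1 * h + g2 * h ^+ 2.
rewrite (_ : _ - _ = (f (z + h) - P) * g (z + h) + P * (g (z + h) - Q) +
  (f1 * g2 + f2 * g1 + f2 * g2 * h) * h ^+ 3); last by rewrite /P /Q; ring.
have n0 := normc_ge0 h.
rewrite [X in _ <= X]mulrDl (le_trans (le_normcD _ _))// lerD//; last first.
  rewrite normcM normcX ler_wpM2r ?exprn_ge0//.
  rewrite (le_trans (le_normcD _ _))// lerD//.
    by rewrite (le_trans (le_normcD _ _))// lerD// normcM.
  by rewrite !normcM ler_piMr// mulr_ge0 ?normc_ge0.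
rewrite [X in _ <= X]mulrDl (le_trans (le_normcD _ _))// lerD//.
  by rewrite normcM mulrAC ler_pM ?normc_ge0 ?hf ?hB.
rewrite normcM -mulrA ler_pM ?normc_ge0 ?hg//.
rewrite /P (le_trans (le_normcD _ _))// lerD//.
  rewrite (le_trans (le_normcD _ _))// lerD//.
  by rewrite normcM ler_piMr ?normc_ge0.
by rewrite normcM normcX ler_piMr ?normc_ge0// exprn_ile1 ?normc_ge0.
Qed.

Lemma expands2X f z n : expands2 f z -> expands2 (fun w => f w ^+ n) z.
Proof.
move=> hf; elim: n => [|n IH].
  by under eq_fun do rewrite expr0; exact: expands2_cst.
by under eq_fun do rewrite exprS; exact: expands2M.
Qed.

Lemma lipschitz_at_neq0 f z : lipschitz_at f z -> f z != 0 ->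
  exists2 r, 0 < r & forall h, normc h <= r -> normc (f z) / 2 <= normc (f (z + h)).
Proof.
move=> [K [r [r0 K0 hf]]] fz; have fz0 : 0 < normc (f z) by rewrite normc_gt0.
have K1 : 0 < K + 1 by rewrite ltr_wpDl.
exists (Num.min r (normc (f z) / (2 * (K + 1)))).
  by rewrite lt_min r0 divr_gt0// mulr_gt0.
move=> h; rewrite le_min => /andP[hr hs].
have := hf _ hr; have := le_normc_subr (f z) (f z - f (z + h)).
rewrite subKr normc_distC => h1 h2.
have : K * normc h <= normc (f z) / 2.
  apply: (@le_trans _ _ ((K + 1) * normc h)).
    by rewrite ler_wpM2r ?normc_ge0// lerDl.
  move: hs; rewrite ler_pdivlMr ?mulr_gt0// => hs.
  by rewrite ler_pdivlMr// mulrC mulrA mulrC.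
by move=> h3; lra.
Qed.

Lemma expands2V f z : expands2 f z -> f z != 0 -> expands2 (fun w => (f w)^-1) z.
Proof.
move=> Hf fz0; have [s s0 hs] := lipschitz_at_neq0 (expands2_lipschitz Hf) fz0.
move: Hf => [f1 [f2 [K [r [r0 K0 hf]]]]].
pose i1 := - f1 / f z ^+ 2; pose i2 := f1 ^+ 2 / f z ^+ 3 - f2 / f z ^+ 2.
pose e1 := f1 * i2 + f2 * i1; pose e2 := f2 * i2.
set a := normc (f z); have a0 : 0 < a by rewrite normc_gt0.
pose I := normc (f z)^-1 + normc i1 + normc i2.
exists i1, i2, ((normc e1 + normc e2 + K * I) / (a / 2)).
exists (Num.min 1 (Num.min r s)).
have I0 : 0 <= I by rewrite !addr_ge0// normc_ge0.
have n1 := normc_ge0 e1; have n2 := normc_ge0 e2.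
split; first by rewrite !lt_min r0 s0 ltr01.
  by rewrite divr_ge0 ?addr_ge0 ?mulr_ge0 ?divr_ge0// ltW.
move=> h; rewrite !le_min => /and3P[h1 hr hsh]; have n0 := normc_ge0 h.
have fh := hs _ hsh; have fh0 : 0 < normc (f (z + h)).
  by apply: lt_le_trans fh; rewrite divr_gt0.
have fhn : f (z + h) != 0 by rewrite -normc_gt0.
set J := (f z)^-1 + i1 * h + i2 * h ^+ 2.
set P := f z + f1 * h + f2 * h ^+ 2.
rewrite (_ : _ - _ = - ((e1 + e2 * h) * h ^+ 3 + (f (z + h) - P) * J) / f (z + h)); last first.
  have JP : P * J = 1 + (e1 + e2 * h) * h ^+ 3.
    by rewrite /P /J /e1 /e2 /i1 /i2; field.
  rewrite mulrBl JP; field; exact: fhn.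
rewrite normcf normcN ler_pdivrMr//.
apply: (@le_trans _ _ ((normc e1 + normc e2 + K * I) * normc h ^+ 3)).
  rewrite (le_trans (le_normcD _ _))// [X in _ <= X]mulrDl lerD//.
    rewrite normcM normcX ler_wpM2r ?exprn_ge0//.
    rewrite (le_trans (le_normcD _ _))// lerD//.
    by rewrite normcM ler_piMr ?normc_ge0.
  rewrite normcM mulrAC ler_pM ?normc_ge0 ?hf//.
  rewrite /J (le_trans (le_normcD _ _))// lerD//.
    rewrite (le_trans (le_normcD _ _))// lerD//.
    by rewrite normcM ler_piMr ?normc_ge0.
  by rewrite normcM normcX ler_piMr ?normc_ge0// exprn_ile1 ?normc_ge0.
rewrite (_ : _ / _ * _ * _ = (normc e1 + normc e2 + K * I) * normc h ^+ 3 *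
  (normc (f (z + h)) / (a / 2))); last by ring.
rewrite ler_peMr//.
  by rewrite mulr_ge0 ?exprn_ge0// addr_ge0 ?addr_ge0 ?mulr_ge0.
by rewrite ler_pdivlMr ?divr_gt0// mul1r.
Qed.

End Expansion.

(** * The maximum principle and the theorem of Liouville for quotients *)

Section MaximumPrinciple.
Variable R : realType.
Local Notation C := R[i].
Implicit Types (z w h : C) (f g F : C -> C).

(** Averaging |F|^2 over the four points z + t i^k cancels all terms in which
t i^k and its conjugate do not pair up; up to a cubic error the mean is |F z|^2
plus nonnegative terms, while that of eps |w|^2 exceeds eps |z|^2 by eps t^2. *)
Lemma no_interior_max F z (eps r : R) : expands2 F z -> 0 < eps -> 0 < r ->
  ~ (forall h, normc h <= r ->
       normc (F (z + h)) ^+ 2 + eps * normc (z + h) ^+ 2 <=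
       normc (F z) ^+ 2 + eps * normc z ^+ 2).
Proof.
move=> [F1 [F2 [K [s [s0 K0 hF]]]]] eps0 r0 hmax.
pose B := normc (F z) + normc F1 + normc F2.
have B0 : 0 <= B by rewrite !addr_ge0// normc_ge0.
have BK : 0 < 2 * B * K + 1 by rewrite ltr_wpDl// !mulr_ge0.
pose t := Num.min (Num.min 1 (eps / (2 * (2 * B * K + 1)))) (Num.min r s).
have t0 : 0 < t by rewrite !lt_min ltr01 r0 s0 divr_gt0// mulr_gt0.
have [t1 te tr ts] : [/\ t <= 1, t <= eps / (2 * (2 * B * K + 1)), t <= r & t <= s].
  by split; rewrite /t !ge_min lexx ?orbT.
(* On the circle of radius t, the error of the expansion of F costs at most
2 B K t^3 in |F|^2. *)
have key h : normc h = t ->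
  normc (F z + F1 * h + F2 * h ^+ 2) ^+ 2 - 2 * B * (K * t ^+ 3) +
  eps * normc (z + h) ^+ 2 <= normc (F z) ^+ 2 + eps * normc z ^+ 2.
  move=> ht; apply: le_trans (hmax h _); last by rewrite ht.
  rewrite lerD2r; set P := _ + F2 * _.
  have e := hF h; rewrite -/P ht in e; have {}e := e ts.
  have PF : normc P - normc (F (z + h) - P) <= normc (F (z + h)).
    by rewrite lerBlDr -{1}(subKr (F (z + h)) P) le_normcB.
  have PB : normc P <= B.
    rewrite /P (le_trans (le_normcD _ _))// lerD//.
      by rewrite (le_trans (le_normcD _ _))// lerD// normcM ht ler_piMr ?normc_ge0.
    by rewrite normcM normcX ht ler_piMr ?normc_ge0// exprn_ile1// ltW.
  have : normc P * normc (F (z + h) - P) <= B * (K * t ^+ 3).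
    by rewrite ler_pM ?normc_ge0.
  rewrite -(mulrA 2 B).
  move: (normc_ge0 P) (normc_ge0 (F (z + h) - P)) (normc_ge0 (F (z + h))) PF.
  move: (normc P) (normc (F (z + h) - P)) (normc (F (z + h))) (B * (K * t ^+ 3)).
  by move=> p d q b p0 d0 q0 pq pd; case: (leP d p) => dp; [have : (p - d) ^+ 2 <= q ^+ 2 by rewrite lerXn2r// nnegrE subr_ge0 |]; nra.
have sum4 : normc (F z + F1 * t%:C + F2 * t%:C ^+ 2) ^+ 2 +
   normc (F z + F1 * (- t%:C) + F2 * (- t%:C) ^+ 2) ^+ 2 +
   normc (F z + F1 * ('i * t%:C) + F2 * ('i * t%:C) ^+ 2) ^+ 2 +
   normc (F z + F1 * (- 'i * t%:C) + F2 * (- 'i * t%:C) ^+ 2) ^+ 2 =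
   4 * (normc (F z) ^+ 2 + normc F1 ^+ 2 * t ^+ 2 + normc F2 ^+ 2 * t ^+ 4).
  by rewrite !sqr_normcE; move: (F z) (F1) (F2) => [a b] [c d] [e' f'] /=; ring.
have sumz : normc (z + t%:C) ^+ 2 + normc (z - t%:C) ^+ 2 +
   normc (z + 'i * t%:C) ^+ 2 + normc (z + - 'i * t%:C) ^+ 2 = 4 * (normc z ^+ 2 + t ^+ 2).
  by rewrite !sqr_normcE; move: (z) => [a b] /=; ring.
have nt : normc t%:C = t by rewrite normc_real ger0_norm// ltW.
have k1 := key t%:C nt.
have k2 := key (- t%:C) (etrans (normcN _) nt).
have k3 := key ('i * t%:C); rewrite normcM normci mul1r in k3; have {}k3 := k3 nt.
have k4 := key (- 'i * t%:C); rewrite normcM normcN normci mul1r in k4; have {}k4 := k4 nt.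
have f1 : 0 <= normc F1 ^+ 2 * t ^+ 2 by rewrite mulr_ge0 ?sqr_ge0.
have f2 : 0 <= normc F2 ^+ 2 * t ^+ 4 by rewrite mulr_ge0 ?sqr_ge0// exprn_ge0 ?ltW.
have sz := congr1 (fun x => eps * x) sumz; rewrite /= !mulrDr in sz.
have : eps * t ^+ 2 <= 2 * B * (K * t ^+ 3) by lra.
rewrite (_ : 2 * B * _ = (2 * B * K * t) * t ^+ 2); last by ring.
rewrite ler_pM2r ?exprn_gt0// => h1.
move: te; rewrite ler_pdivlMr ?mulr_gt0// => te.
have BKt : 0 <= B * K * t by rewrite !mulr_ge0// ltW.
by lra.
Qed.

Lemma ler_dist_normc z w : `|normc z - normc w| <= normc (z - w).
Proof.
rewrite ler_norml le_normc_subr andbT lerNl opprB.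
by rewrite normc_distC le_normc_subr.
Qed.

Definition in_square (L : R) z := `|complex.Re z| <= L /\ `|complex.Im z| <= L.

Definition on_square_boundary (L : R) z :=
  in_square L z /\ (`|complex.Re z| = L \/ `|complex.Im z| = L).

Lemma lipschitz_at_cvg f z : lipschitz_at f z -> forall e : R, 0 < e ->
  exists2 d : R, 0 < d & forall h, normc h <= d -> normc (f (z + h) - f z) <= e.
Proof.
move=> [K [r [r0 K0 hf]]] e e0; have K1 : 0 < K + 1 by rewrite ltr_wpDl.
exists (Num.min r (e / (K + 1))); first by rewrite lt_min r0 divr_gt0.
move=> h; rewrite le_min => /andP[hr]; rewrite ler_pdivlMr// mulrC => he.
apply: le_trans (hf _ hr) (le_trans _ he).
by rewrite ler_wpM2r ?normc_ge0// lerDl.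
Qed.

Lemma square_max (f : C -> C) (eps L : R) : 0 <= L ->
  (forall z, lipschitz_at f z) ->
  exists2 z, in_square L z & forall w, in_square L w ->
    normc (f w) ^+ 2 + eps * normc w ^+ 2 <= normc (f z) ^+ 2 + eps * normc z ^+ 2.
Proof.
move=> L0 lf.
pose cx (p : R * R) : C := p.1 +i* p.2.
have normc_cont F (p : R * R) : lipschitz_at F (cx p) -> {for p, continuous (fun p => normc (F (cx p)))}.
  move=> /lipschitz_at_cvg lF; apply/cvgrPdist_le => /= e e0.
  have [d d0 hd] := lF e e0.
  have d2 : 0 < d / 2 by rewrite divr_gt0.
  exists (ball p.1 (d / 2), ball p.2 (d / 2)) => /=.
    by split; exact: nbhsx_ballx.
  move=> q [/= q1 q2].
  have -> : cx q = cx p + (cx q - cx p) by rewrite addrC subrK.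
  apply: le_trans (hd (cx q - cx p) _).
    by rewrite normc_distC; exact: ler_dist_normc.
  apply: le_trans (normc_le_ReIm _) _.
  rewrite /cx /= [d](splitr d) lerD// distrC ltW//.
have ct : continuous (fun p => normc (f (cx p)) ^+ 2 + eps * normc (cx p) ^+ 2).
  move=> p; apply: cvgD; first by apply: cvgM; apply: normc_cont.
  have cn : {for p, continuous (fun p => normc (cx p))}.
    by apply: (normc_cont id); apply: expands2_lipschitz; exact: expands2_id.
  by apply: cvgM; [exact: cvg_cst | apply: cvgM; exact: cn].
have cA : compact (`[- L, L] `*` `[- L, L] : set (R * R)).
  by apply: compact_setX; exact: segment_compact.
have A0 : (`[- L, L] `*` `[- L, L] : set (R * R)) !=set0.
  by exists (0, 0); split => /=; rewrite in_itv /= lerNl oppr0 L0.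
have [c cin cmax] := compact_EVT_max A0 cA (continuous_subspaceT ct).
exists (cx c).
  by move: cin; rewrite inE => -[/=]; rewrite !in_itv /= -!ler_norml.
move=> w [w1 w2]; have := cmax (complex.Re w, complex.Im w).
have -> : cx (complex.Re w, complex.Im w) = w by case: (w).
by move=> /= H; apply: H; rewrite inE; split; rewrite /= in_itv /= -ler_norml.
Qed.

(** The quotient f / g is not defined at the zeros of g, but f^(n+2) / g^(n+1)
extends there continuously by 0. Its modulus, perturbed by eps |w|^2, has no
interior maximum off these zeros, so that it is at most M^(n+2) max |g|; the
claim follows on taking roots and letting n tend to infinity. *)
Lemma max_principle (f g : C -> C) (L M : R) : 0 <= L -> 0 <= M ->
  (forall z, g z != 0 -> expands2 f z /\ expands2 g z) ->
  (forall z, g z = 0 -> lipschitz_at g z /\ exists K r : R, [/\ 0 < r, 0 <= K &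
     forall h, normc h <= r -> normc (f (z + h)) <= K * normc (g (z + h))]) ->
  (forall z, on_square_boundary L z -> normc (f z) <= M * normc (g z)) ->
  forall z, in_square L z -> normc (f z) <= M * normc (g z).
Proof.
move=> L0 M0 hE hZ hB z zL.
have [gz0|gz0] := eqVneq (g z) 0.
  have [_ [K [r [r0 K0 hf]]]] := hZ _ gz0.
  have := hf 0; rewrite addr0 gz0 normc0 !mulr0; apply; exact: ltW.
have lg w : lipschitz_at g w.
  have [/hZ[]//|/hE[_]] := eqVneq (g w) 0; exact: expands2_lipschitz.
have [w0 _ hG] := square_max 0 L0 lg.
set G := normc (g w0).
have GG w : in_square L w -> normc (g w) <= G.
  move=> /hG; rewrite !mul0r !addr0 ler_pXn2r// nnegrE normc_ge0//.
have G0 : 0 <= G by exact: normc_ge0.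
pose F n w := f w ^+ n.+2 / g w ^+ n.+1.
have lF n w : lipschitz_at (F n) w.
  have [gw0|gw0] := eqVneq (g w) 0; last first.
    have [ef eg] := hE _ gw0; apply: expands2_lipschitz.
    apply: expands2M; first exact: expands2X.
    by apply: expands2V; [exact: expands2X | rewrite expf_neq0].
  have [[L1 [s [s0 L10 hg]]] [K [r [r0 K0 hf]]]] := hZ _ gw0.
  exists (K ^+ n.+2 * L1), (Num.min r s); split.
  - by rewrite lt_min r0.
  - by rewrite mulr_ge0 ?exprn_ge0.
  move=> h; rewrite le_min => /andP[hr hs].
  rewrite /F gw0 expr0n invr0 mulr0 subr0 normcf !normcX.
  have := hg _ hs; rewrite gw0 subr0 => hgs; rewrite -mulrA.
  apply: le_trans (ler_wpM2l (exprn_ge0 _ K0) hgs).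
  have [->|gwh] := eqVneq (normc (g (w + h))) 0.
    by rewrite expr0n invr0 !mulr0.
  rewrite ler_pdivrMr ?exprn_gt0 ?lt_neqAle 1?eq_sym ?gwh ?normc_ge0//.
  rewrite -mulrA -exprS -exprMn lerXn2r// ?nnegrE ?mulr_ge0 ?normc_ge0//.
  exact: hf.
have bF n w : in_square L w -> normc (F n w) <= M ^+ n.+2 * G.
  move=> wL; have MG : 0 <= M ^+ n.+2 * G by rewrite mulr_ge0 ?exprn_ge0.
  rewrite -(@ler_pXn2r _ 2) ?nnegrE ?normc_ge0//.
  apply/ler_addgt0Pr => e e0.
  pose eps := e / (2 * L ^+ 2 + 1).
  have d0 : 0 < 2 * L ^+ 2 + 1 by rewrite ltr_wpDl// mulr_ge0 ?sqr_ge0.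
  have eps0 : 0 < eps by rewrite divr_gt0.
  have [c cL hc] := square_max eps L0 (lF n).
  have cn : normc c ^+ 2 <= 2 * L ^+ 2.
    have sq (a : R) : `|a| <= L -> a ^+ 2 <= L ^+ 2.
      by move=> aL; rewrite -real_normK ?num_real// lerXn2r ?nnegrE.
    by case: cL => /sq ? /sq ?; rewrite sqr_normcE mulr_natl mulr2n lerD.
  have cle : normc (F n c) ^+ 2 <= (M ^+ n.+2 * G) ^+ 2.
    have [gc0|gc0] := eqVneq (g c) 0.
      by rewrite /F gc0 expr0n invr0 mulr0 normc0 expr0n sqr_ge0.
    have ng0 : 0 < normc (g c) by rewrite normc_gt0.
    have [cb|cb] := pselect (on_square_boundary L c).
      rewrite lerXn2r ?nnegrE ?normc_ge0// /F normcf !normcX.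
      rewrite ler_pdivrMr ?exprn_gt0//.
      apply: (@le_trans _ _ ((M * normc (g c)) ^+ n.+2)).
        by rewrite lerXn2r ?nnegrE ?mulr_ge0 ?normc_ge0// hB.
      rewrite exprMn [normc (g c) ^+ n.+2]exprS mulrA.
      by rewrite ler_wpM2r ?exprn_ge0 ?normc_ge0// ler_wpM2l ?exprn_ge0// GG.
    exfalso.
    have [ef eg] := hE _ gc0.
    have eF : expands2 (F n) c.
      apply: expands2M; first exact: expands2X.
      by apply: expands2V; [exact: expands2X | rewrite expf_neq0].
    have [[a1 a2] [b1 b2]] : (`|complex.Re c| < L /\ `|complex.Re c| <= L) /\ (`|complex.Im c| < L /\ `|complex.Im c| <= L).
      case: (cL) => c1 c2; split; split => //.
        by rewrite lt_neqAle c1 andbT; apply/eqP => e1; apply: cb; split => //; left.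
      by rewrite lt_neqAle c2 andbT; apply/eqP => e1; apply: cb; split => //; right.
    pose r := Num.min (L - `|complex.Re c|) (L - `|complex.Im c|).
    have r0 : 0 < r by rewrite lt_min !subr_gt0 a1 b1.
    apply: (no_interior_max eF eps0 r0) => h; rewrite le_min => /andP[h1 h2].
    apply: hc; split; rewrite raddfD; apply: le_trans (ler_normD _ _) _.
      by rewrite addrC -lerBrDr (le_trans (Re_le_normc _)).
    by rewrite addrC -lerBrDr (le_trans (Im_le_normc _)).
  apply: le_trans (_ : normc (F n w) ^+ 2 + eps * normc w ^+ 2 <= _).
    by rewrite lerDl mulr_ge0 ?sqr_ge0 ?ltW.
  apply: le_trans (hc _ wL) _; rewrite lerD//.
  apply: (@le_trans _ _ (eps * (2 * L ^+ 2))); first by rewrite ler_wpM2l// ltW.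
  by rewrite /eps mulrAC ler_pdivrMr// ler_wpM2l ?lerDl// ltW.
rewrite leNgt; apply/negP => Mf.
have ng0 : 0 < normc (g z) by rewrite normc_gt0.
pose x := normc (f z) / normc (g z).
have Mx : M < x by rewrite /x ltr_pdivlMr.
pose y := (M + x) / 2.
have y0 : 0 < y by rewrite /y; lra.
have yx : 1 < x / y by rewrite ltr_pdivlMr// /y; lra.
have My : M <= y by rewrite /y; lra.
have pow n : (x / y) ^+ n.+2 <= G / normc (g z).
  have := bF n z zL; rewrite /F normcf !normcX => h.
  rewrite expr_div_n ler_pdivrMr ?exprn_gt0// /x expr_div_n ler_pdivrMr ?exprn_gt0//.
  move: h; rewrite ler_pdivrMr ?exprn_gt0// => h; apply: le_trans h _.
  rewrite [normc (g z) ^+ n.+2]exprS.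
  rewrite (_ : G / _ * _ * _ = y ^+ n.+2 * G * normc (g z) ^+ n.+1); last first.
    by field; rewrite gt_eqF.
  rewrite ler_wpM2r ?exprn_ge0 ?normc_ge0// ler_wpM2r// lerXn2r ?nnegrE//.
  exact: ltW.
(* Otherwise (x / y)^n is bounded for some y < x = |f z| / |g z|, against the
inequality of Bernoulli. *)
have bern (d : R) n : 0 <= d -> 1 + n%:R * d <= (1 + d) ^+ n.
  move=> d0; elim: n => [|n IH]; first by rewrite mul0r addr0 expr0.
  rewrite exprS -natr1 [X in _ + X <= _]mulrDl mul1r; have kd : 0 <= n%:R * d by rewrite mulr_ge0.
  move: ((1 + d) ^+ n) (n%:R * d) IH kd => p k IH kd.
  have : 0 <= d * (p - 1) by rewrite mulr_ge0//; lra.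
  lra.
pose d := x / y - 1.
have d0 : 0 < d by rewrite subr_gt0.
have := pow (Num.bound (G / normc (g z) / d)).
set k := Num.bound _.
have kd : G / normc (g z) < k%:R * d.
  by rewrite -ltr_pdivrMr//; apply: archi_boundP; rewrite !divr_ge0// ltW.
rewrite leNgt => /negP; apply.
rewrite (_ : x / y = 1 + d); last by rewrite /d addrC subrK.
apply: lt_le_trans (bern d k.+2 (ltW d0)).
apply: lt_le_trans kd _; rewrite -2!natr1 !mulrDl mul1r -!addrA.
have := ltW d0; lra.
Qed.

(** The hypotheses under which f / g is an entire function: no zero of g is a
pole of the quotient. *)
Definition entire_ratio f g :=
  (forall z, g z != 0 -> expands2 f z /\ expands2 g z) /\
  (forall z, g z = 0 -> lipschitz_at g z /\ exists K r : R, [/\ 0 < r, 0 <= K &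
     forall h, normc h <= r -> normc (f (z + h)) <= K * normc (g (z + h))]).

Lemma liouville0 f g : entire_ratio f g ->
  (forall e B : R, 0 < e -> exists2 L, B <= L & forall z,
     on_square_boundary L z -> normc (f z) <= e * normc (g z)) ->
  forall z, f z = 0.
Proof.
move=> [hE hZ] hB z; apply: eq0_normc; apply/eqP; rewrite eq_le normc_ge0 andbT.
apply/ler_addgt0Pr => e e0; rewrite add0r.
have n1 : 0 < normc (g z) + 1 by rewrite ltr_wpDl ?normc_ge0.
have [L BL hL] := hB (e / (normc (g z) + 1)) (normc z) (divr_gt0 e0 n1).
apply: le_trans (_ : e / (normc (g z) + 1) * normc (g z) <= _).
  apply: (max_principle (le_trans (normc_ge0 z) BL) _ hE hZ hL).
    by rewrite divr_ge0 ?ltW.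
  by split; apply: le_trans BL; rewrite ?Re_le_normc ?Im_le_normc.
by rewrite mulrAC ler_pdivrMr// ler_wpM2l ?lerDl// ltW.
Qed.

Lemma on_square_boundary_normc L z : on_square_boundary L z -> L <= normc z.
Proof. by move=> [_ [<-|<-]]; rewrite ?Re_le_normc ?Im_le_normc. Qed.

(** Dividing f - (f z0 / g z0) g by (z - z0) g instead of g turns a bounded
quotient into one that tends to 0 on the large squares. *)
Lemma liouville f g (M : R) z0 : entire_ratio f g -> g z0 != 0 -> 0 <= M ->
  (forall B : R, exists2 L, B <= L & forall z,
     on_square_boundary L z -> normc (f z) <= M * normc (g z)) ->
  forall z, f z * g z0 = f z0 * g z.
Proof.
move=> [hE hZ] gz0 M0 hB z.
pose F w := f w * g z0 + - f z0 * g w.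
pose G w := (w + - z0) * g w.
have eF w : g w != 0 -> expands2 F w.
  by move=> /hE[ef eg]; apply: expands2D; apply: expands2M => //; exact: expands2_cst.
have eG w : g w != 0 -> expands2 G w.
  move=> /hE[ef eg]; apply: expands2M => //.
  by apply: expands2D; [exact: expands2_id | exact: expands2_cst].
pose A := normc (g z0) * M + normc (f z0).
have FA (K : R) w : normc (f w) <= K * normc (g w) ->
    normc (F w) <= (normc (g z0) * K + normc (f z0)) * normc (g w).
  move=> h; rewrite /F (le_trans (le_normcD _ _))// mulrDl lerD//.
    by rewrite normcM mulrC -mulrA ler_wpM2l ?normc_ge0.
  by rewrite normcM normcN.
have A0 : 0 <= A by rewrite addr_ge0 ?mulr_ge0 ?normc_ge0.
suff : F z = 0 by rewrite /F mulNr => /eqP; rewrite subr_eq0 => /eqP.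
apply: (@liouville0 F G); first split.
- move=> w; rewrite mulf_eq0 negb_or => /andP[_ gw]; split; [exact: eF | exact: eG].
- move=> w /eqP; rewrite mulf_eq0 subr_eq0.
  have [wz _|wz /= /eqP gw] := eqVneq w z0.
    rewrite wz; split; first by apply: expands2_lipschitz; apply: eG.
    have [r r0 hr] := lipschitz_at_neq0 (expands2_lipschitz (hE _ gz0).2) gz0.
    have [K [s [s0 K0 hs]]] := expands2_lipschitz (eF _ gz0).
    have n2 : 0 < normc (g z0) / 2 by rewrite divr_gt0// normc_gt0.
    exists (K / (normc (g z0) / 2)), (Num.min r s); split.
    + by rewrite lt_min r0.
    + by rewrite divr_ge0// ltW.
    move=> h; rewrite le_min => /andP[h1 h2].
    have := hs _ h2; have -> : F z0 = 0 by rewrite /F mulNr subrr.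
    rewrite subr0 => h3; apply: le_trans h3 _.
    rewrite /G (_ : z0 + h + - z0 = h); last by ring.
    rewrite normcM mulrAC ler_pdivlMr// -mulrA ler_wpM2l//.
    by rewrite ler_wpM2l ?normc_ge0// hr.
  have [[L1 [s [s0 L10 hg]]] [K [r [r0 K0 hf]]]] := hZ _ gw.
  have wz0 : 0 < normc (w - z0) by rewrite normc_gt0 subr_eq0.
  split.
    exists ((normc (w - z0) + 1) * L1), (Num.min s 1); split.
    + by rewrite lt_min s0 ltr01.
    + by rewrite mulr_ge0// addr_ge0 ?normc_ge0.
    move=> h; rewrite le_min => /andP[h1 h2].
    have := hg _ h1; rewrite /G gw mulr0 !subr0 => h3.
    rewrite normcM -mulrA ler_pM ?normc_ge0//.
    by rewrite addrAC (le_trans (le_normcD _ _))// lerD.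
  exists ((normc (g z0) * K + normc (f z0)) / (normc (w - z0) / 2)).
  exists (Num.min r (normc (w - z0) / 2)); split.
  + by rewrite lt_min r0 divr_gt0.
  + by rewrite divr_ge0 ?addr_ge0 ?mulr_ge0 ?divr_ge0 ?normc_ge0.
  move=> h; rewrite le_min => /andP[h1 h2].
  apply: le_trans (FA _ _ (hf _ h1)) _.
  rewrite /G normcM mulrA ler_wpM2r ?normc_ge0//.
  rewrite -mulrA ler_peMr ?addr_ge0 ?mulr_ge0 ?normc_ge0//.
  rewrite mulrC ler_pdivlMr ?divr_gt0// mul1r addrAC.
  apply: le_trans (le_normc_addr _ _); lra.
move=> e B e0.
have [L BL hL] := hB (Num.max B (A / e + normc z0)).
move: BL; rewrite ge_max => /andP[BL AL]; exists L => // w wL.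
apply: le_trans (FA _ _ (hL _ wL)) _; rewrite -/A /G normcM mulrA.
rewrite ler_wpM2r ?normc_ge0// mulrC -ler_pdivrMr//.
apply: le_trans (le_normc_subr _ _); rewrite lerBrDr.
by apply: le_trans AL (on_square_boundary_normc wL).
Qed.

End MaximumPrinciple.

(** * Differentiation of complex-valued functions of a real variable *)

Section ComplexFunctions.
Variable R : realType.
Local Notation C := R[i].
Implicit Types (u v : R -> C) (c : C).

Lemma Re_mul (z w : C) : complex.Re (z * w) =
  complex.Re z * complex.Re w - complex.Im z * complex.Im w.
Proof. by case: z w => [a b] [d e]. Qed.

Lemma Im_mul (z w : C) : complex.Im (z * w) =
  complex.Re z * complex.Im w + complex.Im z * complex.Re w.
Proof. by case: z w => [a b] [d e]. Qed.

Lemma Re_add (z w : C) : complex.Re (z + w) = complex.Re z + complex.Re w.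
Proof. by case: z w => [a b] [d e]. Qed.

Lemma Im_add (z w : C) : complex.Im (z + w) = complex.Im z + complex.Im w.
Proof. by case: z w => [a b] [d e]. Qed.

Lemma complex_eqP (z w : C) : complex.Re z = complex.Re w ->
  complex.Im z = complex.Im w -> z = w.
Proof. by case: z w => [a b] [d e] /= -> ->. Qed.

Definition ccontinuous u :=
  continuous (fun x => complex.Re (u x)) /\ continuous (fun x => complex.Im (u x)).

Definition is_cderive u u' := forall x : R,
  is_derive x 1 (fun t => complex.Re (u t)) (complex.Re (u' x)) /\
  is_derive x 1 (fun t => complex.Im (u t)) (complex.Im (u' x)).

Lemma is_cderive_continuous u u' : is_cderive u u' -> ccontinuous u.
Proof.
move=> h; split => x; apply: differentiable_continuous; apply/derivable1_diffP.
  by case: (h x) => -[].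
by case: (h x) => _ [].
Qed.

Lemma is_cderiveE u u' x : is_cderive u u' -> cderive u x = u' x.
Proof.
move=> h; have [h1 h2] := h x; apply: complex_eqP; rewrite /cderive /= derive1E.
  by rewrite derive_val.
by rewrite derive_val.
Qed.

Lemma is_cderive_cst c : is_cderive (fun=> c) (fun=> 0).
Proof. by move=> x; split; apply: is_derive_cst. Qed.

Lemma is_cderiveD u u' v v' : is_cderive u u' -> is_cderive v v' ->
  is_cderive (fun x => u x + v x) (fun x => u' x + v' x).
Proof.
move=> hu hv x; have [u1 u2] := hu x; have [v1 v2] := hv x.
split; rewrite ?Re_add ?Im_add.
  by under eq_fun do rewrite ?Re_add ?Im_add; exact: is_deriveD.
by under eq_fun do rewrite ?Re_add ?Im_add; exact: is_deriveD.
Qed.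

Lemma is_cderiveM u u' v v' : is_cderive u u' -> is_cderive v v' ->
  is_cderive (fun x => u x * v x) (fun x => u' x * v x + u x * v' x).
Proof.
move=> hu hv x; have [u1 u2] := hu x; have [v1 v2] := hv x.
split.
  under eq_fun do rewrite Re_mul.
  by apply: is_derive_eq; rewrite Re_add !Re_mul /GRing.scale /=; ring.
under eq_fun do rewrite Im_mul.
by apply: is_derive_eq; rewrite Im_add !Im_mul /GRing.scale /=; ring.
Qed.

Lemma is_cderiveZ c u u' : is_cderive u u' ->
  is_cderive (fun x => c * u x) (fun x => c * u' x).
Proof.
move=> hu; have := is_cderiveM (is_cderive_cst c) hu.
by under [X in is_cderive _ X -> _]eq_fun do rewrite mul0r add0r.
Qed.

Lemma is_cderive_cexp c d :
  is_cderive (fun x => cexp (c * x%:C + d)) (fun x => c * cexp (c * x%:C + d)).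
Proof.
case: c d => [a b] [d e] x.
have ReE y : complex.Re ((a +i* b) * y%:C + (d +i* e)) = a * y + d by rewrite /=; ring.
have ImE y : complex.Im ((a +i* b) * y%:C + (d +i* e)) = b * y + e by rewrite /=; ring.
have E y : cexp ((a +i* b) * y%:C + (d +i* e)) =
  expR (a * y + d) * cos (b * y + e) +i* (expR (a * y + d) * sin (b * y + e)).
  by rewrite /cexp ReE ImE; apply: complex_eqP; rewrite /=; ring.
split.
  under eq_fun do rewrite E /=.
  by rewrite E /=; apply: is_derive_eq; rewrite /GRing.scale /=; ring.
under eq_fun do rewrite E /=.
by rewrite E /=; apply: is_derive_eq; rewrite /GRing.scale /=; ring.
Qed.

Lemma ccontinuousD u v : ccontinuous u -> ccontinuous v ->
  ccontinuous (fun x => u x + v x).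
Proof.
move=> [u1 u2] [v1 v2]; split => x.
  by under eq_fun do rewrite ?Re_add ?Im_add; apply: cvgD; [exact: u1|exact: v1].
by under eq_fun do rewrite ?Re_add ?Im_add; apply: cvgD; [exact: u2|exact: v2].
Qed.

Lemma ccontinuousM u v : ccontinuous u -> ccontinuous v ->
  ccontinuous (fun x => u x * v x).
Proof.
move=> [u1 u2] [v1 v2]; split => x.
  under eq_fun do rewrite Re_mul.
  by apply: cvgB; apply: cvgM; [exact: u1|exact: v1|exact: u2|exact: v2].
under eq_fun do rewrite Im_mul.
by apply: cvgD; apply: cvgM; [exact: u1|exact: v2|exact: u2|exact: v1].
Qed.

Lemma ccontinuous_cst c : ccontinuous (fun=> c).
Proof. exact: is_cderive_continuous (is_cderive_cst c). Qed.

Lemma ccontinuous_affine u (a b : R) : ccontinuous u ->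
  ccontinuous (fun x => u (a * x + b)).
Proof.
have aff : continuous (fun x : R => a * x + b).
  move=> x; apply: cvgD; [apply: cvgM; [exact: cvg_cst|exact: cvg_id] | exact: cvg_cst].
move=> [u1 u2]; split => x.
  exact: (@continuous_comp _ _ _ _ (fun y => complex.Re (u y)) x (aff x) (u1 _)).
exact: (@continuous_comp _ _ _ _ (fun y => complex.Im (u y)) x (aff x) (u2 _)).
Qed.

(** Integrating a bound on the derivative raises its order by one; three
integrations starting from |exp| <= e give the Taylor bound of the exponential. *)
Lemma integrate_growth (g g' : R -> R) (K : R) n :
  (forall x : R, is_derive x 1 g (g' x)) -> g 0 = 0 ->
  (forall x : R, `|x| <= 1 -> `|g' x| <= K * `|x| ^+ n) ->
  forall x : R, `|x| <= 1 -> `|g x| <= K * `|x| ^+ n.+1.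
Proof.
move=> dg g0 hg x x1.
have cg : continuous g.
  by move=> y; apply: differentiable_continuous; apply/derivable1_diffP; by case: (dg y).
have K0 : 0 <= K.
  by have := hg 1; rewrite normr1 expr1n mulr1 => /(_ (lexx _)); apply: le_trans.
have [x0|x0] := leP 0 x.
  have [c] := MVT_segment x0 (fun y _ => dg y) (continuous_subspaceT cg).
  rewrite in_itv/= => /andP[c0 cx]; rewrite g0 !subr0 => ->.
  rewrite normrM exprSr mulrA ler_wpM2r//.
  have ac : `|c| <= `|x| by rewrite !ger0_norm.
  apply: le_trans (hg _ (le_trans ac x1)) _.
  by rewrite ler_wpM2l// lerXn2r// ?nnegrE.
have [c] := MVT_segment (ltW x0) (fun y _ => dg y) (continuous_subspaceT cg).
rewrite in_itv/= => /andP[c0 cx]; rewrite g0 !sub0r => /eqP.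
rewrite eqr_oppLR mulrN opprK => /eqP ->.
rewrite normrM exprSr mulrA ler_wpM2r//.
have ac : `|c| <= `|x| by rewrite !ler0_norm ?lerN2// ltW.
apply: le_trans (hg _ (le_trans ac x1)) _.
by rewrite ler_wpM2l// lerXn2r// ?nnegrE.
Qed.

Lemma cintegrate_growth (u u' : R -> C) (w : C) (K : R) n :
  is_cderive u (fun t => w * u' t) -> u 0 = 0 ->
  (forall t, `|t| <= 1 -> normc (u' t) <= K * `|t| ^+ n) ->
  forall t, `|t| <= 1 -> normc (u t) <= 2 * normc w * K * `|t| ^+ n.+1.
Proof.
move=> du u0 hu t t1.
have part (p : C -> R) : (forall z, `|p z| <= normc z) -> p 0 = 0 ->
    (forall x : R, is_derive x 1 (fun t => p (u t)) (p (w * u' x))) ->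
    `|p (u t)| <= normc w * K * `|t| ^+ n.+1.
  move=> p1 p0 dp; apply: (integrate_growth dp) => [|s s1|//]; first by rewrite u0.
  apply: le_trans (p1 _) _; rewrite normcM -mulrA.
  by rewrite ler_wpM2l ?normc_ge0 ?hu.
apply: le_trans (normc_le_ReIm _) _; rewrite -2!mulrA mulr_natl mulr2n mulrA lerD//.
  by apply: part => // [z|x]; [exact: Re_le_normc | exact: (du x).1].
by apply: part => // [z|x]; [exact: Im_le_normc | exact: (du x).2].
Qed.

Lemma cexp_taylor2 : exists2 K : R, 0 <= K & forall w, normc w <= 1 ->
  normc (cexp w - 1 - w - w ^+ 2 / 2%:R) <= K * normc w ^+ 3.
Proof.
exists (8 * expR 1) => [|w w1]; first by rewrite mulr_ge0 ?expR_ge0.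
pose r0 t := cexp (w * t%:C + 0); pose r1 t := r0 t + -1.
pose r2 t := r1 t + - w * t%:C; pose r3 t := r2 t + - (w ^+ 2 / 2%:R) * (t%:C * t%:C).
have eqd (u u' v' : R -> C) : is_cderive u u' -> u' =1 v' -> is_cderive u v'.
  by move=> du /funext <-.
have d0 : is_cderive r0 (fun t => w * r0 t) := is_cderive_cexp w 0.
have did : is_cderive (fun t : R => t%:C) (fun=> 1).
  by move=> t; split; [exact: is_derive_id | exact: is_derive_cst].
have d1 : is_cderive r1 (fun t => w * r0 t).
  by apply: eqd (is_cderiveD d0 (is_cderive_cst _)) _ => t; rewrite addr0.
have d2 : is_cderive r2 (fun t => w * r1 t).
  by apply: eqd (is_cderiveD d1 (is_cderiveZ _ did)) _ => t; rewrite /r1; ring.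
have d3 : is_cderive r3 (fun t => w * r2 t).
  apply: eqd (is_cderiveD d2 (is_cderiveZ _ (is_cderiveM did did))) _ => t.
  by rewrite /r2; field.
have b0 t : `|t| <= 1 -> normc (r0 t) <= expR 1 * `|t| ^+ 0.
  move=> t1; rewrite normc_cexp expr0 mulr1 ler_expR addr0.
  apply: le_trans (ler_norm _) (le_trans (Re_le_normc _) _).
  by rewrite normcM normc_real mulr_ile1 ?normc_ge0.
have z0 : r0 0 = 1 by rewrite /r0 mulr0 addr0 cexp0.
have z1 : r1 0 = 0 by rewrite /r1 z0 subrr.
have z2 : r2 0 = 0 by rewrite /r2 z1 mulr0 addr0.
have z3 : r3 0 = 0 by rewrite /r3 z2 !mulr0 addr0.
have := cintegrate_growth d3 z3 (cintegrate_growth d2 z2 (cintegrate_growth d1 z1 b0)).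
have -> : cexp w - 1 - w - w ^+ 2 / 2%:R = r3 1.
  by rewrite /r3 /r2 /r1 /r0 rmorph1 !mulr1 addr0; ring.
move=> /(_ 1); rewrite normr1 => /(_ (lexx _))/le_trans; apply.
by rewrite expr1n mulr1; apply: le_of_eq; ring.
Qed.

End ComplexFunctions.

(** * Lebesgue integrals of complex-valued functions *)

Section ComplexIntegral.
Variable R : realType.
Local Notation C := R[i].
Local Notation mu := (@lebesgue_measure R).
Implicit Types (f g u v : R -> C) (c : C) (D : set R).

Definition cintegrable D f :=
  mu.-integrable D (EFin \o (fun x => complex.Re (f x))) /\
  mu.-integrable D (EFin \o (fun x => complex.Im (f x))).

Lemma Rintegrable_add D (f g : R -> R) : measurable D ->
  mu.-integrable D (EFin \o f) -> mu.-integrable D (EFin \o g) ->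
  mu.-integrable D (EFin \o (fun x => f x + g x)).
Proof.
move=> mD fi gi; rewrite (_ : _ \o _ = (EFin \o f) \+ (EFin \o g))%E.
  exact: integrableD.
by apply/funext.
Qed.

Lemma Rintegrable_sub D (f g : R -> R) : measurable D ->
  mu.-integrable D (EFin \o f) -> mu.-integrable D (EFin \o g) ->
  mu.-integrable D (EFin \o (fun x => f x - g x)).
Proof.
move=> mD fi gi; rewrite (_ : _ \o _ = (EFin \o f) \- (EFin \o g))%E.
  exact: integrableB.
by apply/funext.
Qed.

Lemma cintegrableD D f g : measurable D -> cintegrable D f -> cintegrable D g ->
  cintegrable D (fun x => f x + g x).
Proof.
move=> mD [f1 f2] [g1 g2]; split.
  by under eq_fun do rewrite Re_add; exact: Rintegrable_add.
by under eq_fun do rewrite Im_add; exact: Rintegrable_add.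
Qed.

Lemma cintegralD D f g : measurable D -> cintegrable D f -> cintegrable D g ->
  cintegral D (fun x => f x + g x) = cintegral D f + cintegral D g.
Proof.
move=> mD [f1 f2] [g1 g2]; apply: complex_eqP; rewrite /cintegral /=.
  by rewrite -RintegralD//; apply: eq_Rintegral => x _; rewrite ?Re_add ?Im_add.
by rewrite -RintegralD//; apply: eq_Rintegral => x _; rewrite ?Re_add ?Im_add.
Qed.

(** The interval [-4, 4] serves as a fixed bounded set with 0 and 1 in its
interior: functions on the edge are continued beyond 1, so that the two-sided
derivatives at 1 of the problem make sense. *)
Lemma integrable_mul_bounded D (f u : R -> R) : measurable D -> D `<=` `[-4, 4] ->
  mu.-integrable D (EFin \o f) -> continuous u ->
  mu.-integrable D (EFin \o (fun x => u x * f x)).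
Proof.
move=> mD D4 fi cu.
have L : -4 <= 4 :> R by lra.
have cn : {within `[-4, 4 : R], continuous (fun x => `|u x|)}.
  by apply: continuous_subspaceT => x; apply: continuous_comp (cu x) _; exact: norm_continuous.
have [c _ hc] := EVT_max L cn.
have mu_ : measurable_fun D u by apply: measurable_funTS; exact: continuous_measurable_fun.
have mf : measurable_fun D f by apply/measurable_EFinP; exact: measurable_int fi.
apply: (@le_integrable _ _ _ mu D mD _ (EFin \o (fun x => `|u c| * f x))).
- by apply/measurable_EFinP; exact: measurable_funM.
- move=> x Dx /=; rewrite lee_fin !normrM normr_id ler_wpM2r//.
  by apply: hc; rewrite in_itv; have := D4 _ Dx; rewrite /= in_itv.
rewrite (_ : _ \o _ = (fun x => (`|u c|)%:E * (EFin \o f) x)%E); first exact: integrableZl.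
by apply/funext.
Qed.

Lemma cintegrableMc D f u : measurable D -> D `<=` `[-4, 4] ->
  cintegrable D f -> ccontinuous u -> cintegrable D (fun x => u x * f x).
Proof.
move=> mD D4 [f1 f2] [u1 u2]; split.
  under eq_fun do rewrite Re_mul.
  by apply: Rintegrable_sub => //; exact: integrable_mul_bounded.
under eq_fun do rewrite Im_mul.
by apply: Rintegrable_add => //; exact: integrable_mul_bounded.
Qed.

Lemma cintegralZ D f c : measurable D -> D `<=` `[-4, 4] -> cintegrable D f ->
  cintegral D (fun x => c * f x) = c * cintegral D f.
Proof.
move=> mD D4 [f1 f2].
have iz (a : R) (h : R -> R) : mu.-integrable D (EFin \o h) ->
    mu.-integrable D (EFin \o (fun x => a * h x)).
  by move=> hi; apply: integrable_mul_bounded => //; exact: cst_continuous.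
apply: complex_eqP; rewrite /cintegral ?Re_mul ?Im_mul /=.
  rewrite -!RintegralZl// -RintegralB//; [|exact: iz..].
  by apply: eq_Rintegral => x _; rewrite Re_mul.
rewrite -!RintegralZl// -RintegralD//; [|exact: iz..].
by apply: eq_Rintegral => x _; rewrite Im_mul.
Qed.

Lemma eq_cintegral D f g : (forall x, D x -> f x = g x) ->
  cintegral D f = cintegral D g.
Proof.
by move=> h; congr (_ +i* _); apply: eq_Rintegral => x; rewrite inE => /h ->.
Qed.

Lemma cintegrable_normc D f : measurable D -> cintegrable D f ->
  mu.-integrable D (EFin \o (fun x => normc (f x))).
Proof.
move=> mD [f1 f2].
have mf1 : measurable_fun D (fun x => complex.Re (f x)).
  by apply/measurable_EFinP; exact: measurable_int f1.
have mf2 : measurable_fun D (fun x => complex.Im (f x)).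
  by apply/measurable_EFinP; exact: measurable_int f2.
apply: (@le_integrable _ _ _ mu D mD _ (EFin \o (fun x => `|complex.Re (f x)| + `|complex.Im (f x)|))).
- apply/measurable_EFinP.
  rewrite (_ : (fun x => normc (f x)) = (fun x => Num.sqrt (complex.Re (f x) ^+ 2 + complex.Im (f x) ^+ 2))).
    apply: measurableT_comp => //; first exact: continuous_measurable_fun (@sqrt_continuous R).
    by apply: measurable_funD; exact: measurable_funX.
  by apply/funext => x; case: (f x).
- move=> x Dx /=; rewrite lee_fin ger0_norm ?normc_ge0//.
  by rewrite ger0_norm ?addr_ge0// normc_le_ReIm.
by apply: Rintegrable_add => //; exact: integrable_norm.
Qed.

(** The factor 2 comes from estimating the real and imaginary parts apart. *)
Lemma normc_cintegral D f (G : R -> R) : measurable D -> cintegrable D f ->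
  mu.-integrable D (EFin \o G) -> (forall x, D x -> normc (f x) <= G x) ->
  normc (cintegral D f) <= 2 * \int[mu]_(x in D) G x.
Proof.
move=> mD [f1 f2] iG fG; apply: le_trans (normc_le_ReIm _) _; rewrite /cintegral /=.
have hh (h : R -> R) : mu.-integrable D (EFin \o h) -> (forall x, D x -> `|h x| <= G x) ->
    `|\int[mu]_(x in D) h x| <= \int[mu]_(x in D) G x.
  move=> ih hG; have h1 := @le_normr_Rintegral _ _ R mu _ _ mD ih.
  apply: (le_trans h1).
  by apply: le_Rintegral => //; exact: integrable_norm ih.
rewrite mulrDl mul1r; apply: lerD; apply: hh => // x Dx; apply: le_trans (fG _ Dx).
  exact: Re_le_normc.
exact: Im_le_normc.
Qed.

Lemma cintegrableS D E f : measurable D -> measurable E -> E `<=` D ->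
  cintegrable D f -> cintegrable E f.
Proof. 
by move=> mD mE ED [f1 f2]; split; [apply: (integrableS _ _ _ f1)|apply: (integrableS _ _ _ f2)].
 Qed.

(** |f| <= 1 + |f|^2, and the interval has finite measure. *)
Lemma L2_integrable (f : R -> C) : L2_01 f -> cintegrable `]0, 1[ f.
Proof.
move=> [mr mi fi].
pose g x := 1 + (complex.Re (f x) ^+ 2 + complex.Im (f x) ^+ 2).
have m01 : measurable (`]0, 1[ : set R) by exact: measurable_itv.
have i1 : mu.-integrable `]0, 1[ (EFin \o g).
  apply: Rintegrable_add => //; apply/integrableP; split; first exact/measurable_EFinP.
  rewrite (_ : (fun x => _) = cst 1%:E); last by apply/funext => x /=; rewrite normr1.
  rewrite integral_cst//= mul1e lebesgue_measure_itv /= lte01.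
  by rewrite -EFinB ltry.
have sq (a b : R) : `|a| <= 1 + (a ^+ 2 + b ^+ 2).
  have : 0 <= (`|a| - 1) ^+ 2 by exact: sqr_ge0.
  rewrite sqrrB expr1n mulr1 real_normK ?num_real//.
  have := normr_ge0 a; have := sqr_ge0 b; have := sqr_ge0 a; lra.
split.
  apply: (@le_integrable _ _ _ mu _ m01 _ (EFin \o g)) => //; first exact/measurable_EFinP.
  by move=> x _ /=; rewrite lee_fin (le_trans (sq _ (complex.Im (f x))))// ler_norm.
apply: (@le_integrable _ _ _ mu _ m01 _ (EFin \o g)) => //; first exact/measurable_EFinP.
move=> x _ /=; rewrite lee_fin (le_trans (sq _ (complex.Re (f x))))//.
by rewrite [X in _ + X]addrC ler_norm.
Qed.

End ComplexIntegral.

(** * Integration by parts against a primitive *)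

Section IntegrationByParts.
Variable R : realType.
Local Notation C := R[i].
Local Notation mu := (@lebesgue_measure R).
Implicit Types (u v i : R -> C) (x y : R).

Lemma ccontinuous_cintegrable u (A : set R) : compact A -> ccontinuous u ->
  cintegrable A u.
Proof.
move=> cA [u1 u2].
by split; apply: continuous_compact_integrable => //; exact: continuous_subspaceT.
Qed.

Lemma FTC2_real (f f' : R -> R) x y : x <= y ->
  (forall t : R, is_derive t (1 : R) f (f' t)) -> continuous f' ->
  \int[mu]_(t in `[x, y]) f' t = f y - f x.
Proof.
move=> xy df cf'; move: xy; rewrite le_eqVlt => /predU1P[->|xy].
  by rewrite set_itv1 Rintegral_set1 subrr.
have cf : continuous f.
  by move=> t; apply: differentiable_continuous; apply/derivable1_diffP; case: (df t).
rewrite /Rintegral (continuous_FTC2 xy (F := f)) //=.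
- exact: continuous_subspaceT.
- split; first by move=> t _; case: (df t).
    by apply: cvg_at_right_filter; exact: cf.
  by apply: cvg_at_left_filter; exact: cf.
- by move=> t _; rewrite derive1E; apply: derive_val.
Qed.

Lemma cFTC2 u u' x y : x <= y -> is_cderive u u' -> ccontinuous u' ->
  u y = u x + cintegral `[x, y] u'.
Proof.
move=> xy du [c1 c2]; apply: complex_eqP; rewrite ?Re_add ?Im_add /cintegral /=.
  by rewrite (FTC2_real xy (fun t => (du t).1) c1) addrC subrK.
by rewrite (FTC2_real xy (fun t => (du t).2) c2) addrC subrK.
Qed.

Lemma cintegral_itvB i a x y : a <= x -> x <= y -> cintegrable `[a, y] i ->
  cintegral `[a, y] i = cintegral `[a, x] i + cintegral `]x, y] i.
Proof.
move=> ax xy [i1 i2].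
apply: complex_eqP; rewrite ?Re_add ?Im_add /cintegral /=.
  by rewrite -(Rintegral_itvB (x := x) i1) ?bnd_simp// addrC subrK.
by rewrite -(Rintegral_itvB (x := x) i2) ?bnd_simp// addrC subrK.
Qed.

Lemma cintegral_obnd i x y : cintegrable `]x, y] i ->
  cintegral `]x, y] i = cintegral `[x, y] i.
Proof. by move=> [i1 i2]; rewrite /cintegral !Rintegral_itv_obnd_cbnd. Qed.

Definition cprimitive i x := cintegral `[0, x] i.

Lemma cprimitive_within i b : 0 <= b -> cintegrable `[0, b] i ->
  {within `[0, b], continuous (fun x => complex.Re (cprimitive i x))} /\
  {within `[0, b], continuous (fun x => complex.Im (cprimitive i x))}.
Proof.
by move=> b0 [i1 i2]; split; [have := parameterized_integral_continuous b0 i1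
  | have := parameterized_integral_continuous b0 i2].
Qed.

Lemma cprimitive_cintegrable i b : 0 <= b -> cintegrable `[0, b] i ->
  cintegrable `[0, b] (cprimitive i).
Proof.
move=> b0 /(cprimitive_within b0)[c1 c2].
by split; apply: continuous_compact_integrable => //; exact: segment_compact.
Qed.

Lemma ccontinuous_bounded u : ccontinuous u -> exists2 B : R, 0 <= B &
  forall x, `|x| <= 4 -> normc (u x) <= B.
Proof.
move=> [u1 u2].
have L : -4 <= 4 :> R by lra.
have cn (f : R -> R) : continuous f -> {within `[-4, 4 : R], continuous (fun x => `|f x|)}.
  move=> cf; apply: continuous_subspaceT => x.
  by apply: continuous_comp (cf x) _; exact: norm_continuous.
have [c _ hc] := EVT_max L (cn _ u1).
have [d _ hd] := EVT_max L (cn _ u2).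
exists (`|complex.Re (u c)| + `|complex.Im (u d)|); first exact: addr_ge0.
move=> x x4; apply: le_trans (normc_le_ReIm _) _.
by apply: lerD; [apply: hc | apply: hd]; rewrite in_itv /= -ler_norml.
Qed.

Lemma integrable_cst_itv (r : R) x y : mu.-integrable `]x, y] (EFin \o cst r).
Proof.
apply: (@integrableS _ _ _ mu `[x, y]) => //.
  by move=> t /=; rewrite !in_itv /= => /andP[/ltW -> ->].
by apply: continuous_compact_integrable; [exact: segment_compact|
  apply: continuous_subspaceT; exact: cst_continuous].
Qed.

Lemma Rintegral_cst_itv (r : R) x y : x <= y ->
  \int[mu]_(t in `]x, y]) r = r * (y - x).
Proof.
move=> xy; rewrite Rintegral_cst///= lebesgue_measure_itv /= lte_fin.
by case: ltP => // yx; rewrite (le_anti (introT andP (conj xy yx))) subrr.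
Qed.

(** Over n equal parts of [0, x] the increments of P add up to at most
c x (J x - J 0) / n. *)
Lemma partition_vanish (P J : R -> R) (c x : R) : 0 <= x -> 0 <= c ->
  (forall s t, 0 <= s -> s <= t -> t <= x -> `|P t - P s| <= c * (t - s) * (J t - J s)) ->
  P x = P 0.
Proof.
move=> x0 c0 h; apply/eqP; rewrite -subr_eq0 -normr_le0.
have bound n : `|P x - P 0| <= c * x * (J x - J 0) / n.+1%:R.
  have n0 : (n.+1%:R : R) != 0 by rewrite pnatr_eq0.
  have n1 : 0 < (n.+1%:R : R) by rewrite ltr0n.
  pose t k := x * k%:R / n.+1%:R.
  have tn : t n.+1 = x by rewrite /t mulfK.
  have t0 : t 0%N = 0 by rewrite /t mulr0 mul0r.
  have HP := telescope_sumr (fun k => P (t k)) (leq0n n.+1).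
  have HJ := telescope_sumr (fun k => J (t k)) (leq0n n.+1).
  rewrite /= tn t0 in HP HJ; rewrite -HP -HJ.
  apply: le_trans (ler_norm_sum _ _ _) _; rewrite mulr_sumr mulr_suml.
  rewrite !big_nat; apply: ler_sum => k /andP[_ kn].
  have tk l : (l <= n.+1)%N -> 0 <= t l <= x.
    move=> ln; rewrite /t divr_ge0 ?mulr_ge0 //= ler_pdivrMr// ler_wpM2l//.
    by rewrite ler_nat.
  have /andP[tk0 _] := tk k (ltnW kn); have /andP[_ tkx] := tk k.+1 kn.
  have tt : t k.+1 - t k = x / n.+1%:R.
    by rewrite /t -mulrBl -mulrBr -natr1 addrAC subrr add0r mulr1.
  have tle : t k <= t k.+1 by rewrite -subr_ge0 tt divr_ge0.
  apply: le_trans (h _ _ tk0 tle tkx) _.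
  by rewrite tt; apply: le_of_eq; ring.
rewrite leNgt; apply/negP => d0.
set d := `|_| in bound d0; set e := c * x * (J x - J 0) in bound.
have := bound (Num.bound (`|e| / d)); rewrite leNgt => /negP; apply.
rewrite ltr_pdivrMr ?ltr0n//; apply: le_lt_trans (ler_norm _) _.
rewrite -natr1 mulrDr mulr1 ltr_wpDr ?ltW// mulrC -ltr_pdivrMr//.
by apply: archi_boundP; rewrite divr_ge0// ltW.
Qed.

(** With u of class C^1 and cprimitive i merely absolutely continuous, the
difference of the two sides has over [s, t] an increment bounded by t - s times
the integral of |i| over [s, t]; partition_vanish applies. *)
Lemma cintegral_by_parts u u' i b x : 0 <= b <= 4 ->
  is_cderive u u' -> ccontinuous u' -> cintegrable `[0, b] i -> 0 <= x <= b ->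
  u x * cprimitive i x = cprimitive (fun s => u' s * cprimitive i s + u s * i s) x.
Proof.
move=> /andP[b0 b4] du cu' ii xb.
have cu := is_cderive_continuous du.
have [B B0 hB] := ccontinuous_bounded cu'.
have sub4 : `[0, b] `<=` (`[-4, 4] : set R).
  by move=> t /=; rewrite !in_itv /= => /andP[t0 tb]; apply/andP; split; lra.
have m0b : measurable (`[0, b] : set R) by exact: measurable_itv.
have iI := cprimitive_cintegrable b0 ii.
have i1 : cintegrable `[0, b] (fun s => u' s * cprimitive i s) by exact: cintegrableMc.
have i2 : cintegrable `[0, b] (fun s => u s * i s) by exact: cintegrableMc.
pose k s := u' s * cprimitive i s + u s * i s.
have ik : cintegrable `[0, b] k by exact: cintegrableD.
pose P s := u s * cprimitive i s - cprimitive k s.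
pose n s := normc (i s).
have inn : mu.-integrable `[0, b] (EFin \o n) by exact: cintegrable_normc.
pose J s := \int[mu]_(t in `[0, s]) n t.
have P00 : P 0 = 0.
  have c0 f : cprimitive f 0 = 0 by rewrite /cprimitive set_itv1 /cintegral !Rintegral_set1.
  by rewrite /P !c0 mulr0 subrr.
have bound s t : 0 <= s -> s <= t -> t <= b ->
    normc (P t - P s) <= 8 * B * (t - s) * (J t - J s).
  move=> s0 st tb.
  have subst x1 x2 : s <= x1 -> x2 <= t -> `]x1, x2] `<=` (`[0, b] : set R).
    move=> sx xt z /=; rewrite !in_itv /= => /andP[z1 z2]; apply/andP; split; lra.
  have subs0 x1 : x1 <= t -> `[0, x1] `<=` (`[0, b] : set R).
    move=> sx z /=; rewrite !in_itv /= => /andP[z1 z2]; apply/andP; split; lra.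
  have res f x1 x2 : s <= x1 -> x2 <= t -> cintegrable `[0, b] f -> cintegrable `]x1, x2] f.
    by move=> ? ?; apply: cintegrableS => //; exact: subst.
  have res0 f x1 : x1 <= t -> cintegrable `[0, b] f -> cintegrable `[0, x1] f.
    by move=> ?; apply: cintegrableS => //; exact: subs0.
  have split_ f x1 x2 : 0 <= x1 -> x1 <= x2 -> x2 <= t -> cintegrable `[0, b] f ->
      cprimitive f x2 = cprimitive f x1 + cintegral `]x1, x2] f.
    by move=> *; apply: cintegral_itvB => //; exact: res0.
  have mst : measurable (`]s, t] : set R) by exact: measurable_itv.
  have s4 : `]s, t] `<=` (`[-4, 4] : set R).
    by apply: subset_trans sub4; exact: subst.
  have iu' x1 x2 : s <= x1 -> x2 <= t -> cintegrable `]x1, x2] u'.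
    move=> *; apply: res => //; apply: ccontinuous_cintegrable => //.
    exact: segment_compact.
  have uB x1 : s <= x1 -> x1 <= t -> normc (u x1 - u s) <= 2 * (B * (t - s)).
    move=> sx xt.
    rewrite (cFTC2 sx du cu') addrAC subrr add0r -cintegral_obnd; last exact: iu'.
    have mx : measurable (`]s, x1] : set R) by exact: measurable_itv.
    apply: le_trans (normc_cintegral mx (iu' _ _ _ _) (integrable_cst_itv B s x1) _) _ => //.
      move=> z /=; rewrite in_itv /= => /andP[z1 z2]; apply: hB.
      by rewrite ler_norml; apply/andP; split; lra.
    rewrite Rintegral_cst_itv// ler_wpM2l// ler_wpM2l//; lra.
  have IB x1 : s <= x1 -> x1 <= t -> normc (cprimitive i t - cprimitive i x1) <= 2 * (J t - J s).
    move=> sx xt.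
    rewrite (split_ i x1 t)//; last exact: le_trans sx.
    rewrite addrAC subrr add0r.
    have mx : measurable (`]x1, t] : set R) by exact: measurable_itv.
    have intn x2 : s <= x2 -> mu.-integrable `]x2, t] (EFin \o n).
      move=> *; apply: integrableS inn => //; exact: subst.
    have intn0 x2 : x2 <= t -> mu.-integrable `[0, x2] (EFin \o n).
      by move=> *; apply: integrableS inn => //; exact: subs0.
    apply: le_trans (normc_cintegral mx (res _ _ _ _ _ ii) (intn _ _) _) _ => //.
    rewrite ler_wpM2l// /J -(Rintegral_itvB (x := x1) (intn0 t (lexx _))) ?bnd_simp//; last lra.
    rewrite lerD2l lerN2 -subr_ge0.
    rewrite (Rintegral_itvB (x := s) (intn0 x1 xt)) ?bnd_simp//.
    by apply: Rintegral_ge0 => z _; exact: normc_ge0.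
  have -> : P t - P s = cintegral `]s, t]
      (fun z => u' z * (cprimitive i t - cprimitive i z) + (u s - u z) * i z).
    have e : cprimitive k t = cprimitive k s + cintegral `]s, t] k by exact: split_.
    have ei : cprimitive i t = cprimitive i s + cintegral `]s, t] i by exact: split_.
    have eu : u t = u s + cintegral `]s, t] u'.
      by rewrite cintegral_obnd ?(cFTC2 st du cu')//; exact: iu'.
    have j1 : cintegrable `]s, t] (fun z => u s * i z).
      by apply: cintegrableMc (res _ _ _ _ _ ii) _ => //; exact: ccontinuous_cst.
    have j2 : cintegrable `]s, t] (fun z => -1 * k z).
      by apply: cintegrableMc (res _ _ _ _ _ ik) _ => //; exact: ccontinuous_cst.
    have j3 : cintegrable `]s, t] (fun z => cprimitive i t * u' z).
      by apply: cintegrableMc (iu' _ _ _ _) _ => //; exact: ccontinuous_cst.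
    rewrite (@eq_cintegral _ _ _ (fun z => cprimitive i t * u' z + (u s * i z + -1 * k z))).
      rewrite cintegralD//; last exact: cintegrableD.
      rewrite cintegralD// !cintegralZ//; [|exact: res|exact: res|exact: iu'].
      rewrite /P e eu ei; ring.
    by move=> z _; rewrite /k; ring.
  set G := fun z => B * (2 * (J t - J s)) + 2 * (B * (t - s)) * n z.
  have intn : mu.-integrable `]s, t] (EFin \o n) by apply: integrableS inn => //; exact: subst.
  have int2 : mu.-integrable `]s, t] (EFin \o (fun z => 2 * (B * (t - s)) * n z)).
    by apply: integrable_mul_bounded => //; exact: cst_continuous.
  have intG : mu.-integrable `]s, t] (EFin \o G).
    by apply: Rintegrable_add => //; exact: integrable_cst_itv.
  apply: le_trans (normc_cintegral mst _ intG _) _.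
  - apply: cintegrableD => //.
      rewrite (_ : (fun x => _) = (fun z => cprimitive i t * u' z + -1 * (u' z * cprimitive i z))).
        apply: cintegrableD => //.
          by apply: cintegrableMc (iu' _ _ _ _) _ => //; exact: ccontinuous_cst.
        by apply: cintegrableMc (res _ _ _ _ _ i1) _ => //; exact: ccontinuous_cst.
      by apply/funext => z; ring.
    rewrite (_ : (fun x => _) = (fun z => u s * i z + -1 * (u z * i z))).
      apply: cintegrableD => //.
        by apply: cintegrableMc (res _ _ _ _ _ ii) _ => //; exact: ccontinuous_cst.
      by apply: cintegrableMc (res _ _ _ _ _ i2) _ => //; exact: ccontinuous_cst.
    by apply/funext => z; ring.
  - move=> z /=; rewrite in_itv /= => /andP[sz zt].
    apply: le_trans (le_normcD _ _) _; rewrite !normcM; apply: lerD.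
      apply: ler_pM; rewrite ?normc_ge0//; last by apply: IB => //; exact: ltW.
      by apply: hB; rewrite ler_norml; apply/andP; split; lra.
    by rewrite ler_wpM2r ?normc_ge0// normc_distC; apply: uB => //; exact: ltW.
  rewrite /G RintegralD//; last exact: integrable_cst_itv.
  rewrite Rintegral_cst_itv// RintegralZl//.
  have -> : \int[mu]_(z in `]s, t]) n z = J t - J s.
    by rewrite /J (Rintegral_itvB (x := s)) ?bnd_simp//; apply: integrableS inn => //; exact: subs0.
  apply: le_of_eq; ring.
move: xb => /andP[x0 xb].
have vanish (p : C -> R) : p 0 = 0 -> (forall z w, `|p z - p w| <= normc (z - w)) -> p (P x) = 0.
  move=> p0 hp; rewrite (@partition_vanish (fun t => p (P t)) J (8 * B) x)//.
  - by rewrite P00.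
  - by rewrite mulr_ge0.
  move=> s t s0 st tx; apply: le_trans (hp _ _) _; apply: bound => //.
  exact: le_trans xb.
apply/eqP; rewrite -subr_eq0 -/(P x); apply/eqP; apply: complex_eqP.
  apply: vanish => // z w; rewrite (_ : _ - _ = complex.Re (z - w)) ?Re_le_normc//.
  by case: z w => [? ?] [? ?].
apply: vanish => // z w; rewrite (_ : _ - _ = complex.Im (z - w)) ?Im_le_normc//.
by case: z w => [? ?] [? ?].
Qed.

End IntegrationByParts.

(** * The solutions S_0 and S_1 *)

Section TrigonometricSolutions.
Variable R : realType.
Local Notation C := R[i].
Implicit Types (z w l : C) (x t : R).

Lemma mulcii : 'i%C * 'i%C = -1 :> C.
Proof. by rewrite -expr2 sqr_i. Qed.

Lemma ci_neq0 : ('i%C : C) != 0.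
Proof. by rewrite -normc_gt0 normci. Qed.

Lemma ccosE z : ccos z = (cexp ('i%C * z) + (cexp ('i%C * z))^-1) / 2%:R.
Proof. by rewrite /ccos mulNr cexpN. Qed.

Lemma csinE z : csin z = - 'i%C * (cexp ('i%C * z) - (cexp ('i%C * z))^-1) / 2%:R.
Proof.
have n0 : (2%:R * 'i%C : C) != 0 by rewrite mulf_neq0 ?pnatr_eq0// ci_neq0.
rewrite /csin mulNr cexpN; apply: (canLR (mulfK n0)).
move: (cexp _) => a; move: (a^-1) => b.
rewrite (_ : - 'i%C * (a - b) / 2%:R * (2%:R * 'i%C) = - ('i%C * 'i%C) * (a - b)); last by field.
by rewrite mulcii opprK mul1r.
Qed.

Lemma ccosN z : ccos (- z) = ccos z.
Proof. by rewrite !ccosE mulrN cexpN invrK addrC. Qed.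

Lemma csinN z : csin (- z) = - csin z.
Proof. by rewrite !csinE mulrN cexpN invrK; ring. Qed.

Lemma ccos0 : ccos (0 : C) = 1.
Proof. by rewrite ccosE mulr0 cexp0 invr1; field. Qed.

Lemma csin0 : csin (0 : C) = 0.
Proof. by rewrite csinE mulr0 cexp0 invr1 subrr mulr0 mul0r. Qed.

Lemma csin_sub z w : csin (z - w) = csin z * ccos w - ccos z * csin w.
Proof.
rewrite !csinE !ccosE (mulrBr 'i%C z w) cexpD cexpN.
move: (cexp _) (cexp_neq0 ('i%C * z)) => a a0.
move: (cexp _) (cexp_neq0 ('i%C * w)) => b b0.
by field; rewrite a0 b0.
Qed.

Lemma ccos_sub z w : ccos (z - w) = ccos z * ccos w + csin z * csin w.
Proof.
rewrite !csinE !ccosE (mulrBr 'i%C z w) cexpD cexpN.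
move: (cexp _) (cexp_neq0 ('i%C * z)) => a a0.
move: (cexp _) (cexp_neq0 ('i%C * w)) => b b0.
rewrite (_ : - 'i%C * (a - a^-1) / 2%:R * (- 'i%C * (b - b^-1) / 2%:R) =
  ('i%C * 'i%C) * ((a - a^-1) / 2%:R * ((b - b^-1) / 2%:R))); last by ring.
by rewrite mulcii; field; rewrite a0 b0.
Qed.

Lemma ccos2Dsin2 z : ccos z ^+ 2 + csin z ^+ 2 = 1.
Proof. by rewrite !expr2 -ccos_sub subrr ccos0. Qed.

Lemma normc_ccos z : normc (ccos z) <= expR `|complex.Im z|.
Proof.
rewrite /ccos normcf normc_nat ler_pdivrMr ?ltr0n//.
apply: le_trans (le_normcD _ _) _; rewrite !normc_cexp mulr_natr mulr2n.
by case: z => a b /=; apply: lerD; rewrite ler_expR; have := ler_norm b; have := ler_norm (- b); rewrite normrN; lra.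
Qed.

Lemma normc_csin z : normc (csin z) <= expR `|complex.Im z|.
Proof.
rewrite /csin normcf normcM normci mulr1 normc_nat ler_pdivrMr ?ltr0n//.
apply: le_trans (le_normcB _ _) _; rewrite !normc_cexp mulr_natr mulr2n.
by case: z => a b /=; apply: lerD; rewrite ler_expR; have := ler_norm b; have := ler_norm (- b); rewrite normrN; lra.
Qed.

Lemma S0E x l : sqrtC l != 0 -> S0 x l = csin (sqrtC l * x%:C) / sqrtC l.
Proof. by move=> l0; rewrite /S0 (negbTE l0). Qed.

Lemma S0_x0 x : S0 x (0 : C) = x%:C.
Proof. by rewrite /S0 sqrtC0 eqxx. Qed.

Lemma S1_x0 x : S1 x (0 : C) = 1.
Proof. by rewrite /S1 sqrtC0 mul0r ccos0. Qed.

Lemma S0_sqr x z : z != 0 -> S0 x (z ^+ 2) = csin (z * x%:C) / z.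
Proof.
move=> z0; have /eqP : (sqrtC (z ^+ 2)) ^+ 2 = z ^+ 2 by rewrite sqrtCK.
rewrite eqf_sqr => /orP[] /eqP e; rewrite S0E e ?oppr_eq0//.
by rewrite mulNr csinN invrN mulrNN.
Qed.

Lemma S1_sqr x z : S1 x (z ^+ 2) = ccos (z * x%:C).
Proof.
have /eqP : (sqrtC (z ^+ 2)) ^+ 2 = z ^+ 2 by rewrite sqrtCK.
by rewrite eqf_sqr /S1 => /orP[] /eqP ->; rewrite // mulNr ccosN.
Qed.

Lemma S0_sub x t l : S0 (x - t) l = S0 x l * S1 t l - S1 x l * S0 t l.
Proof.
have [s0|s0] := eqVneq (sqrtC l) 0.
  by rewrite /S0 /S1 s0 eqxx !mul0r ccos0 mulr1 mul1r rmorphB.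
rewrite !S0E// /S1 rmorphB mulrBr csin_sub; ring.
Qed.

Lemma S0_0 l : S0 (0 : R) l = 0.
Proof.
have [s0|s0] := eqVneq (sqrtC l) 0; first by rewrite /S0 s0 eqxx.
by rewrite S0E// mulr0 csin0 mul0r.
Qed.

Lemma S1_0 l : S1 (0 : R) l = 1.
Proof. by rewrite /S1 mulr0 ccos0. Qed.

Lemma S_pythagoras x l : S1 x l ^+ 2 + l * S0 x l ^+ 2 = 1.
Proof.
have ll : l = sqrtC l ^+ 2 by rewrite sqrtCK.
have [s0|s0] := eqVneq (sqrtC l) 0.
  have -> : l = 0 by rewrite ll s0 expr0n.
  by rewrite mul0r addr0 S1_x0 expr1n.
rewrite S0E// /S1 -[RHS](ccos2Dsin2 (sqrtC l * x%:C)); congr (_ + _).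
rewrite {1}ll; move: (sqrtC l) s0 => s s0.
by rewrite expr_div_n mulrCA mulfV ?mulr1// expf_neq0.
Qed.

Lemma is_cderive_S1 l : is_cderive (@S1 R ^~ l) (fun x : R => - l * S0 x l).
Proof.
have ll : l = sqrtC l ^+ 2 by rewrite sqrtCK.
set s := sqrtC l in ll.
have E x : S1 x l = 2%:R^-1 * (cexp ('i%C * s * x%:C + 0) + cexp (- ('i%C * s) * x%:C + 0)).
  by rewrite !addr0 /S1 -/s /ccos mulrC !mulrA mulNr.
rewrite (_ : @S1 R ^~ l = fun x => 2%:R^-1 * (cexp ('i%C * s * x%:C + 0) + cexp (- ('i%C * s) * x%:C + 0))); last by apply/funext => x; exact: E.
rewrite (_ : (fun x : R => - l * S0 x l) = fun x => 2%:R^-1 * ('i%C * s * cexp ('i%C * s * x%:C + 0) + (- ('i%C * s)) * cexp (- ('i%C * s) * x%:C + 0))).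
  by apply: is_cderiveZ; apply: is_cderiveD; exact: is_cderive_cexp.
apply/funext => x; rewrite !addr0.
have [s0|s0] := eqVneq s 0; first by rewrite s0 (_ : - l = 0) ?ll ?s0 ?expr0n ?oppr0//=; ring.
rewrite S0E -/s// csinE {1}ll.
rewrite (mulNr ('i%C * s) x%:C) cexpN -(mulrA 'i%C s x%:C).
move: (cexp _) (cexp_neq0 ('i%C * (s * x%:C))) => a a0.
by field; rewrite s0 a0.
Qed.

Lemma is_cderive_S0 l : is_cderive (@S0 R ^~ l) (@S1 R ^~ l).
Proof.
have ll : l = sqrtC l ^+ 2 by rewrite sqrtCK.
set s := sqrtC l in ll.
have [s0|s0] := eqVneq s 0.
  have -> : @S0 R ^~ l = (fun x : R => x%:C) by apply/funext => x; rewrite /S0 -/s s0 eqxx.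
  have -> : @S1 R ^~ l = (fun=> 1) by apply/funext => x; rewrite /S1 -/s s0 mul0r ccos0.
  by move=> x; split => /=; [exact: is_derive_id | exact: is_derive_cst].
set c := (2%:R * 'i%C * s)^-1 : C.
have E x : S0 x l = c * (cexp ('i%C * s * x%:C + 0) + -1 * cexp (- ('i%C * s) * x%:C + 0)).
  rewrite !addr0 S0E// -/s /csin /c (mulNr ('i%C * s)) (mulNr 'i%C) -(mulrA 'i%C s x%:C).
  by move: (cexp _) (cexp _) => p q; field; rewrite ci_neq0 s0.
rewrite (_ : @S0 R ^~ l = fun x => c * (cexp ('i%C * s * x%:C + 0) + -1 * cexp (- ('i%C * s) * x%:C + 0))); last by apply/funext => x; exact: E.
rewrite (_ : @S1 R ^~ l = fun x => c * ('i%C * s * cexp ('i%C * s * x%:C + 0) + -1 * ((- ('i%C * s)) * cexp (- ('i%C * s) * x%:C + 0)))).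
  apply: is_cderiveZ; apply: is_cderiveD; last apply: is_cderiveZ; exact: is_cderive_cexp.
apply/funext => x; rewrite !addr0 /S1 -/s /ccos (mulNr ('i%C * s) x%:C) (mulNr 'i%C) -(mulrA 'i%C s x%:C) /c.
move: (cexp _) (cexp _) => a b.
by field; rewrite ci_neq0 s0.
Qed.

Definition dSnu (nu : bool) x l : C := if nu then - l * S0 x l else S1 x l.

Lemma is_cderive_Snu nu l : is_cderive (Snu nu ^~ l) (dSnu nu ^~ l).
Proof. by case: nu; [exact: is_cderive_S1 | exact: is_cderive_S0]. Qed.

Lemma is_cderive_dSnu nu l : is_cderive (dSnu nu ^~ l) (fun x => - l * Snu nu x l).
Proof.
case: nu => /=; last exact: is_cderive_S1.
by apply: is_cderiveZ; exact: is_cderive_S0.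
Qed.

Lemma ccontinuous_Snu nu l : ccontinuous (Snu nu ^~ l).
Proof. exact: is_cderive_continuous (is_cderive_Snu nu l). Qed.

End TrigonometricSolutions.

(** * Variation of constants *)

Section ParticularSolution.
Variable R : realType.
Local Notation C := R[i].
Local Notation mu := (@lebesgue_measure R).
Implicit Types (f g h : R -> C) (x t : R).

Lemma S1_sub x t (l : C) : S1 (x - t) l = S1 x l * S1 t l + l * (S0 x l * S0 t l).
Proof.
have ll : l = sqrtC l ^+ 2 by rewrite sqrtCK.
have [s0|s0] := eqVneq (sqrtC l) 0.
  have -> : l = 0 by rewrite ll s0 expr0n.
  by rewrite !S1_x0 mul0r addr0 mulr1.
rewrite !S0E// /S1 rmorphB mulrBr ccos_sub; congr (_ + _).
move: (csin _) (csin _) => A B; rewrite {1}ll.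
by move: (sqrtC l) s0 => s s0; field.
Qed.

Lemma measurable_itv04 : measurable (`[0, 4] : set R).
Proof. exact: measurable_itv. Qed.

Lemma itv04_sub : `[0, 4] `<=` (`[-4, 4] : set R).
Proof.
by move=> t /=; rewrite !in_itv /= => /andP[t0 tb]; apply/andP; split; lra.
Qed.

Lemma measurable_itv01 : measurable (`[0, 1] : set R).
Proof. exact: measurable_itv. Qed.

Lemma itv01_sub : `[0, 1] `<=` (`[-4, 4] : set R).
Proof.
by move=> t /=; rewrite !in_itv /= => /andP[t0 t1]; apply/andP; split; lra.
Qed.

Lemma cintegrable04S f x : x <= 4 -> cintegrable `[0, 4] f -> cintegrable `[0, x] f.
Proof.
move=> x4; apply: cintegrableS => // t /=; rewrite !in_itv /= => /andP[-> tx].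
exact: le_trans x4.
Qed.

Lemma cintegrable04M u f : ccontinuous u -> cintegrable `[0, 4] f ->
  cintegrable `[0, 4] (fun t => u t * f t).
Proof. by move=> cu fi; apply: cintegrableMc => //; exact: itv04_sub. Qed.

Lemma cprimitiveD f g x : x <= 4 -> cintegrable `[0, 4] f -> cintegrable `[0, 4] g ->
  cprimitive (fun t => f t + g t) x = cprimitive f x + cprimitive g x.
Proof. by move=> x4 fi gi; apply: cintegralD => //; exact: cintegrable04S. Qed.

Lemma cprimitiveZ c f x : x <= 4 -> cintegrable `[0, 4] f ->
  cprimitive (fun t => c * f t) x = c * cprimitive f x.
Proof.
move=> x4 fi; apply: cintegralZ => //; last exact: cintegrable04S.
move=> t /=; rewrite !in_itv /= => /andP[t0 tx]; apply/andP; split; lra.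
Qed.

Definition ccontinuous_at f x :=
  {for x, continuous (fun t => complex.Re (f t))} /\
  {for x, continuous (fun t => complex.Im (f t))}.

Lemma ccontinuous_atD f g x : ccontinuous_at f x -> ccontinuous_at g x ->
  ccontinuous_at (fun t => f t + g t) x.
Proof.
move=> [f1 f2] [g1 g2]; split; rewrite /prop_for.
  under eq_fun do rewrite Re_add.
  exact: cvgD.
under eq_fun do rewrite Im_add.
exact: cvgD.
Qed.

Lemma ccontinuous_atM f g x : ccontinuous_at f x -> ccontinuous_at g x ->
  ccontinuous_at (fun t => f t * g t) x.
Proof.
move=> [f1 f2] [g1 g2]; split; rewrite /prop_for.
  under eq_fun do rewrite Re_mul.
  by apply: cvgB; exact: cvgM.
under eq_fun do rewrite Im_mul.
by apply: cvgD; exact: cvgM.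
Qed.

Lemma cprimitive_continuous_at g x : cintegrable `[0, 4] g -> 0 < x < 4 ->
  ccontinuous_at (cprimitive g) x.
Proof.
move=> gi x04; have [c1 c2] := cprimitive_within (ltac:(lra) : 0 <= 4 :> R) gi.
have xin : x \in `]0, 4[%classic by rewrite inE /= in_itv.
have sub : `]0, 4[ `<=` (`[0, 4] : set R).
  by move=> t /=; rewrite !in_itv /= => /andP[t0 t4]; apply/andP; split; lra.
have op : open (`]0, 4[%classic : set R) by exact: interval_open.
have cW (f : R -> R) : {within `[0, 4], continuous f} -> {for x, continuous f}.
  move=> /(continuous_subspaceW sub) cf.
  by move: cf; rewrite continuous_open_subspace// => /(_ x xin).
by split; exact: cW.
Qed.

Lemma cderive_cprimitive f g x : cintegrable `[0, 4] g -> 0 < x < 4 ->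
  ccontinuous_at g x -> (forall t, 0 <= t <= 4 -> f t = cprimitive g t) ->
  cderive f x = g x.
Proof.
move=> [g1 g2] /andP[x0 x4] [c1 c2] fg.
have nr : \forall t \near x, f t = cprimitive g t.
  by apply: filterS2 (lt_nbhsr x0) (lt_nbhsl x4) => t /ltW t0 /ltW t4; rewrite fg// t0.
have ftc (p : C -> R) (k : R -> R) : mu.-integrable `[0, 4] (EFin \o k) ->
   {for x, continuous k} -> (forall t, p (cprimitive g t) = \int[mu]_(s in `[0, t]) k s) ->
   derive1 (fun t => p (f t)) x = k x.
  move=> ki ck pk; have [_ <-] := continuous_FTC1_closed x4 ki x0 ck.
  rewrite !derive1E; apply: near_eq_derive.
  by apply: filterS nr => t ->; rewrite -pk.
by apply: complex_eqP; rewrite /cderive /=; [apply: (ftc _ _ g1 c1) | apply: (ftc _ _ g2 c2)].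
Qed.

Variables (g : R -> C) (l : C).
Hypothesis gi : cintegrable `[0, 4] g.

Let s0g t := S0 t l * g t.
Let s1g t := S1 t l * g t.

(** The solution of - y'' + g = l y with zero initial data, and its derivative. *)
Definition particular x := S0 x l * cprimitive s1g x + - S1 x l * cprimitive s0g x.
Definition dparticular x := S1 x l * cprimitive s1g x + l * S0 x l * cprimitive s0g x.

Let cS0 : ccontinuous (@S0 R ^~ l) := is_cderive_continuous (is_cderive_S0 l).
Let cS1 : ccontinuous (@S1 R ^~ l) := is_cderive_continuous (is_cderive_S1 l).
Let clS0 (c : C) : ccontinuous (fun x : R => c * S0 x l).
Proof. by apply: ccontinuousM => //; exact: ccontinuous_cst. Qed.
Let cNS1 : ccontinuous (fun x : R => - S1 x l).
Proof.
by under eq_fun do rewrite -mulN1r; apply: ccontinuousM => //; exact: ccontinuous_cst.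
Qed.

Let i0 : cintegrable `[0, 4] s0g. Proof. exact: cintegrable04M. Qed.
Let i1 : cintegrable `[0, 4] s1g. Proof. exact: cintegrable04M. Qed.
Let le04 : 0 <= 4 :> R. Proof. lra. Qed.
Let I0 : cintegrable `[0, 4] (cprimitive s0g). Proof. exact: cprimitive_cintegrable. Qed.
Let I1 : cintegrable `[0, 4] (cprimitive s1g). Proof. exact: cprimitive_cintegrable. Qed.
Let b44 : 0 <= (4 : R) <= 4. Proof. by rewrite le04 lexx. Qed.

Lemma cintegrable_particular : cintegrable `[0, 4] particular.
Proof. by apply: cintegrableD => //; exact: cintegrable04M. Qed.

Lemma cintegrable_dparticular : cintegrable `[0, 4] dparticular.
Proof. by apply: cintegrableD => //; exact: cintegrable04M. Qed.

Let parts u u' i x := @cintegral_by_parts R u u' i 4 x b44.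

Let is_cderive_NS1 : is_cderive (fun x : R => - S1 x l) (fun x => l * S0 x l).
Proof.
have -> : (fun x : R => - S1 x l) = (fun x => -1 * S1 x l) by apply/funext => x; rewrite mulN1r.
have -> : (fun x : R => l * S0 x l) = (fun x => -1 * (- l * S0 x l)).
  by apply/funext => x; ring.
by apply: is_cderiveZ; exact: is_cderive_S1.
Qed.

Let is_cderive_lS0 : is_cderive (fun x : R => l * S0 x l) (fun x => l * S1 x l).
Proof. by apply: is_cderiveZ; exact: is_cderive_S0. Qed.

Lemma particular_primitive x : 0 <= x <= 4 -> particular x = cprimitive dparticular x.
Proof.
move=> x04; have /andP[x0 x4] := x04; rewrite /particular.
rewrite (parts (is_cderive_S0 l) cS1 i1 x04) (parts is_cderive_NS1 (clS0 l) i0 x04).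
rewrite -cprimitiveD//; last 2 first.
- by apply: cintegrableD; [exact: measurable_itv04 | exact: cintegrable04M..].
- by apply: cintegrableD; [exact: measurable_itv04 | exact: cintegrable04M..].
apply: eq_cintegral => t _; rewrite /dparticular /s0g /s1g; ring.
Qed.

Lemma dparticular_primitive x : 0 <= x <= 4 ->
  dparticular x = cprimitive (fun t => - l * particular t + g t) x.
Proof.
move=> x04; have /andP[x0 x4] := x04; rewrite /dparticular.
have clS1 : ccontinuous (fun x : R => l * S1 x l).
  by apply: ccontinuousM => //; exact: ccontinuous_cst.
rewrite (parts (is_cderive_S1 l) (clS0 (- l)) i1 x04) (parts is_cderive_lS0 clS1 i0 x04).
rewrite -cprimitiveD//; last 2 first.
- by apply: cintegrableD; [exact: measurable_itv04 | exact: cintegrable04M..].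
- by apply: cintegrableD; [exact: measurable_itv04 | exact: cintegrable04M..].
apply: eq_cintegral => t _; rewrite /particular /s0g /s1g.
(* The Wronskian of S_0 and S_1 is 1. *)
rewrite -[X in _ = _ + X]mul1r -(S_pythagoras t l); ring.
Qed.

Lemma cderive_particular f x : 0 < x < 4 ->
  (forall t, 0 <= t <= 4 -> f t = particular t) -> cderive f x = dparticular x.
Proof.
move=> x04 fp; apply: (cderive_cprimitive cintegrable_dparticular x04).
  have at_ (u : R -> C) : ccontinuous u -> ccontinuous_at u x by move=> [u1 u2]; split; [exact: u1 | exact: u2].
  apply: ccontinuous_atD.
    exact: ccontinuous_atM (at_ _ cS1) (cprimitive_continuous_at i1 x04).
  exact: ccontinuous_atM (at_ _ (clS0 l)) (cprimitive_continuous_at i0 x04).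
by move=> t t04; rewrite fp// particular_primitive.
Qed.

Lemma particularE x : 0 <= x <= 4 ->
  particular x = cintegral `[0, x] (fun t => S0 (x - t) l * g t).
Proof.
move=> /andP[x0 x4]; rewrite /particular -!cprimitiveZ// -cprimitiveD//; last 2 first.
- by apply: cintegrable04M => //; exact: ccontinuous_cst.
- by apply: cintegrable04M => //; exact: ccontinuous_cst.
by apply: eq_cintegral => t _; rewrite S0_sub /s0g /s1g; ring.
Qed.

Lemma dparticularE x : 0 <= x <= 4 ->
  dparticular x = cintegral `[0, x] (fun t => S1 (x - t) l * g t).
Proof.
move=> /andP[x0 x4]; rewrite /dparticular -!cprimitiveZ// -cprimitiveD//; last 2 first.
- by apply: cintegrable04M => //; exact: ccontinuous_cst.
- by apply: cintegrable04M => //; exact: ccontinuous_cst.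
by apply: eq_cintegral => t _; rewrite S1_sub /s0g /s1g; ring.
Qed.

End ParticularSolution.

(** * The frozen argument and square-integrable functions *)

Section SourceTerm.
Variables (R : realType) (a : R).
Local Notation C := R[i].
Local Notation mu := (@lebesgue_measure R).
Implicit Types (f q : R -> C) (l : C) (nu : bool) (t x : R).

(** The part of the edge on which the frozen argument t - a + 1 runs over the
edge of y_1. *)
Definition active : set R := `[a - 1, 1] `&` `]0, 1[.

Definition cut f t : C := if t \in active then f t else 0.

Lemma measurable_active : measurable active.
Proof. by apply: measurableI; exact: measurable_itv. Qed.

Lemma active_sub x : 0 <= x -> `[a - 1, x] `&` `]0, 1[ = `[0, x] `&` active.
Proof.
move=> x0; apply/seteqP; split => t /=; rewrite /active /= !in_itv /=.
  by move=> [/andP[h1 h2] /andP[h3 h4]]; repeat split; apply/andP; split; lra.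
by move=> [/andP[h1 h2] [/andP[h3 h4] /andP[h5 h6]]]; split; apply/andP; split; lra.
Qed.

Lemma cintegral_cut f x : 0 <= x ->
  cintegral (`[a - 1, x] `&` `]0, 1[) f = cintegral `[0, x] (cut f).
Proof.
move=> x0; rewrite active_sub// /cintegral !Rintegral_mkcondr.
congr (_ +i* _); apply: eq_Rintegral => t _; rewrite /cut patchE; by case: ifP.
Qed.

Lemma cutM (g f : R -> C) t : cut (fun s => g s * f s) t = g t * cut f t.
Proof. by rewrite /cut; case: ifP => // _; rewrite mulr0. Qed.

Lemma cutB (g f : R -> C) t : cut (fun s => g s - f s) t = cut g t - cut f t.
Proof. by rewrite /cut; case: ifP => // _; rewrite subr0. Qed.

Lemma cintegrable_cut q : cintegrable `]0, 1[ q -> cintegrable `[0, 4] (cut q).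
Proof.
have sub : active `<=` `]0, 1[ by move=> t [].
have m01 : measurable (`]0, 1[ : set R) by exact: measurable_itv.
have measurable_itv04 : measurable (`[0, 4] : set R) by exact: measurable_itv.
have h (f : R -> R) : mu.-integrable `]0, 1[ (EFin \o f) ->
    mu.-integrable `[0, 4] (EFin \o (f \_ active)).
  move=> fi; apply: (@integrableS _ _ _ mu setT) => //.
  rewrite -restrict_EFin; apply/(@integrable_mkcond _ _ _ mu active _ measurable_active).
  by apply: integrableS fi => //; exact: measurable_active.
have E (p : C -> R) : p 0 = 0 -> (fun t => p (cut q t)) = (fun t => p (q t)) \_ active.
  by move=> p0; apply/funext => t; rewrite patchE /cut; case: ifP.
by move=> [q1 q2]; split; rewrite E//; exact: h.
Qed.

End SourceTerm.

Section SquareIntegrable.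
Variable R : realType.
Local Notation C := R[i].
Local Notation mu := (@lebesgue_measure R).
Implicit Types (f g u : R -> C).

Let m01 : measurable (`]0, 1[ : set R). Proof. exact: measurable_itv. Qed.

Lemma L2_dominated f (G : R -> R) :
  measurable_fun (`]0, 1[ : set R) (fun x => complex.Re (f x)) ->
  measurable_fun (`]0, 1[ : set R) (fun x => complex.Im (f x)) ->
  mu.-integrable `]0, 1[ (EFin \o G) ->
  (forall x, 0 < x < 1 -> normc (f x) ^+ 2 <= G x) -> L2_01 f.
Proof.
move=> mr mi iG fG; split => //.
apply: (@le_integrable _ _ _ mu _ m01 _ (EFin \o G)) => //.
  by apply/measurable_EFinP; apply: measurable_funD; exact: measurable_funX.
move=> x /=; rewrite in_itv /= => x01; rewrite lee_fin -sqr_normcE.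
by rewrite ger0_norm ?sqr_ge0// (le_trans (fG _ x01))// ler_norm.
Qed.

Lemma L2_normc f : L2_01 f -> mu.-integrable `]0, 1[ (EFin \o (fun x => normc (f x) ^+ 2)).
Proof.
move=> [_ _]; congr (_.-integrable _ _).
by apply/funext => x /=; rewrite sqr_normcE.
Qed.

Lemma L2_add f g : L2_01 f -> L2_01 g -> L2_01 (fun x => f x + g x).
Proof.
move=> Lf Lg; have [f1 f2 _] := Lf; have [g1 g2 _] := Lg.
apply: (@L2_dominated _ (fun x => 2 * normc (f x) ^+ 2 + 2 * normc (g x) ^+ 2)).
- by rewrite (_ : (fun x => complex.Re (f x + g x)) = (fun x => complex.Re (f x) + complex.Re (g x))); last (by apply/funext => x; exact: Re_add); exact: measurable_funD.
- by rewrite (_ : (fun x => complex.Im (f x + g x)) = (fun x => complex.Im (f x) + complex.Im (g x))); last (by apply/funext => x; exact: Im_add); exact: measurable_funD.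
- have sub : `]0, 1[ `<=` (`[-4, 4] : set R).
    by move=> t /=; rewrite !in_itv /= => /andP[? ?]; apply/andP; split; lra.
  by apply: Rintegrable_add => //; apply: integrable_mul_bounded => //;
    [exact: L2_normc | exact: cst_continuous | exact: L2_normc | exact: cst_continuous].
move=> x _.
apply: (@le_trans _ _ ((normc (f x) + normc (g x)) ^+ 2)).
  by rewrite lerXn2r ?nnegrE ?addr_ge0 ?normc_ge0// le_normcD.
have := sqr_ge0 (normc (f x) - normc (g x)); nra.
Qed.

Lemma L2_mul u f : ccontinuous u -> L2_01 f -> L2_01 (fun x => u x * f x).
Proof.
move=> cu Lf; have [f1 f2 _] := Lf; have [B B0 hB] := ccontinuous_bounded cu.
have [u1 u2] := cu.
have mu1 : measurable_fun (`]0, 1[ : set R) (fun x => complex.Re (u x)).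
  by apply: measurable_funTS; exact: continuous_measurable_fun.
have mu2 : measurable_fun (`]0, 1[ : set R) (fun x => complex.Im (u x)).
  by apply: measurable_funTS; exact: continuous_measurable_fun.
apply: (@L2_dominated _ (fun x => B ^+ 2 * normc (f x) ^+ 2)).
- by rewrite (_ : (fun x => complex.Re (u x * f x)) = (fun x => complex.Re (u x) * complex.Re (f x) - complex.Im (u x) * complex.Im (f x))); last (by apply/funext => x; exact: Re_mul); apply: measurable_funB; exact: measurable_funM.
- by rewrite (_ : (fun x => complex.Im (u x * f x)) = (fun x => complex.Re (u x) * complex.Im (f x) + complex.Im (u x) * complex.Re (f x))); last (by apply/funext => x; exact: Im_mul); apply: measurable_funD; exact: measurable_funM.
- have sub : `]0, 1[ `<=` (`[-4, 4] : set R).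
    by move=> t /=; rewrite !in_itv /= => /andP[? ?]; apply/andP; split; lra.
  by apply: integrable_mul_bounded => //; [exact: L2_normc | exact: cst_continuous].
move=> x /andP[x0 x1]; rewrite normcM exprMn ler_wpM2r ?sqr_ge0//.
rewrite lerXn2r ?nnegrE ?normc_ge0//; apply: hB.
rewrite ler_norml; apply/andP; split; lra.
Qed.

Lemma L2_within f : {within `[0, 4], continuous (fun x => complex.Re (f x))} ->
  {within `[0, 4], continuous (fun x => complex.Im (f x))} -> L2_01 f.
Proof.
move=> c1 c2.
have sub : `]0, 1[ `<=` (`[0, 4] : set R).
  by move=> t /=; rewrite !in_itv /= => /andP[? ?]; apply/andP; split; lra.
have ms (h : R -> R) : {within `[0, 4], continuous h} -> measurable_fun (`]0, 1[ : set R) h.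
  move=> ch; apply: (measurable_funS _ sub) => //.
  by apply: subspace_continuous_measurable_fun.
split; [exact: ms | exact: ms |].
have m0 : measurable (`[0, 4] : set R) by exact: measurable_itv.
apply: (@integrableS _ _ _ mu _ _ _ m0 m01 sub).
apply: continuous_compact_integrable; first exact: segment_compact.
by move=> x; apply: cvgD; apply: cvgM; [exact: c1|exact: c1|exact: c2|exact: c2].
Qed.

Lemma L2_continuous u : ccontinuous u -> L2_01 u.
Proof. by move=> [u1 u2]; apply: L2_within; exact: continuous_subspaceT. Qed.

Lemma L2_cut (a : R) f : L2_01 f -> L2_01 (cut a f).
Proof.
move=> Lf; have [f1 f2 _] := Lf.
have E (p : C -> R) : p 0 = 0 -> (fun t => p (cut a f t)) = (fun t => p (f t)) \_ (active a).
  by move=> p0; apply/funext => t; rewrite patchE /cut; case: ifP.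
have me (h : R -> R) : measurable_fun (`]0, 1[ : set R) h -> measurable_fun (`]0, 1[ : set R) (h \_ (active a)).
  move=> mh; apply/measurable_restrict => //; first exact: measurable_active.
  by apply: measurable_funS mh.
apply: (@L2_dominated _ (fun x => normc (f x) ^+ 2)).
- by rewrite E//; exact: me.
- by rewrite E//; exact: me.
- exact: L2_normc.
by move=> x _; rewrite /cut; case: ifP => // _; rewrite normc0 expr0n sqr_ge0.
Qed.

End SquareIntegrable.

(** * The characteristic function *)

(** A pole-free form of the linear system for the coefficients b_j of S_0 on
the edges: its determinant is the left-hand side of the first hypothesis. *)
Lemma solve_bordered_system (F : fieldType) (I : finType) (d : F) (E v : I -> F) :
  d * \prod_j v j + \sum_j E j * \prod_(l | l != j) v l = 0 ->
  (forall i j, v i = 0 -> v j = 0 -> i = j) ->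
  exists2 b : I -> F, forall j, E j + b j * v j = 0 & \sum_j b j = d.
Proof.
move=> det vI.
have [/existsP[k /eqP vk]|] := boolP [exists k, v k == 0].
  have v0 l : l != k -> v l != 0.
    by move=> lk; apply: contra lk => /eqP vl; apply/eqP; exact: vI.
  have Ek : E k = 0.
    have := det; rewrite (bigD1 k)//= vk mul0r mulr0 add0r (bigD1 k)//= [X in _ + X]big1 ?addr0.
      move=> /eqP; rewrite mulf_eq0 => /orP[/eqP//|].
      by rewrite prodf_seq_eq0 => /hasP[l _ /andP[/v0/negbTE ->]].
    by move=> j jk; rewrite (bigD1 k) 1?eq_sym//= vk mul0r mulr0.
  pose c l := - E l / v l.
  exists (fun j => if j == k then d - \sum_(l | l != k) c l else c j).
    move=> j; have [->|jk] := eqVneq j k; first by rewrite Ek vk mulr0 addr0.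
    by rewrite divfK ?subrr ?addrN// v0.
  rewrite (bigD1 k)//= eqxx.
  rewrite [X in _ + X](eq_bigr c) ?subrK// => j jk; by rewrite (negbTE jk).
rewrite negb_exists => /forallP v0.
exists (fun j => - E j / v j) => [j|]; first by rewrite divfK// addrN.
have P0 : \prod_j v j != 0 by apply/prodf_neq0 => j _.
apply: (mulIf P0); move/eqP: det; rewrite addr_eq0 => /eqP ->.
rewrite mulr_suml -sumrN; apply: eq_bigr => j _.
by rewrite (bigD1 j)//= mulrA divfK// mulNr.
Qed.

Section CharacteristicFunction.
Variables (R : realType) (a : R).
Local Notation C := R[i].
Local Notation mu := (@lebesgue_measure R).
Implicit Types (f q : R -> C) (l h : C) (nu : bool) (t x : R).

Definition source nu q l t : C := Snu nu (t - a + 1) l * cut a q t.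

(** The linear form in the potential through which an edge enters Delta. *)
Definition edge_form nu q h l : C :=
  cintegral `[0, 1] (fun t => (S1 (1 - t) l + h * S0 (1 - t) l) * source nu q l t).

Lemma ccontinuous_Snu_shift nu l : ccontinuous (fun t => Snu nu (t - a + 1) l).
Proof.
have -> : (fun t => Snu nu (t - a + 1) l) = (fun t => Snu nu (1 * t + (1 - a)) l).
  by apply/funext => t; congr (Snu _ _ _); ring.
by apply: (ccontinuous_affine (u := fun x => Snu nu x l)); exact: ccontinuous_Snu.
Qed.

Lemma cintegrable_source nu q l : cintegrable `]0, 1[ q ->
  cintegrable `[0, 4] (source nu q l).
Proof.
move=> iq; apply: cintegrable04M; first exact: ccontinuous_Snu_shift.
exact: cintegrable_cut.
Qed.

Lemma Q_particular m (q : 'I_m.-1 -> R -> C) nu j l x :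
  cintegrable `]0, 1[ (q j) -> 0 <= x <= 4 ->
  Q a q nu j x l = particular (source nu (q j) l) l x.
Proof.
move=> iq x04; have /andP[x0 x4] := x04.
rewrite (particularE l (cintegrable_source nu l iq))// /Q cintegral_cut//.
apply: eq_cintegral => t _; rewrite /source.
rewrite (_ : (fun s => _) = (fun s => (S0 (x - s) l * Snu nu (s - a + 1) l) * q j s)).
  by rewrite cutM mulrA.
by apply/funext => s; ring.
Qed.

(** Both sides are the value at 1 of y' + h y for the particular solution y of
the edge with zero initial data. *)
Lemma edge_formE nu q h l : cintegrable `]0, 1[ q ->
  edge_form nu q h l = dparticular (source nu q l) l 1 + h * particular (source nu q l) l 1.
Proof.
move=> iq; have is_ := cintegrable_source nu l iq.
have x1 : 0 <= (1 : R) <= 4 by lra.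
rewrite (particularE l is_)// (dparticularE l is_)//.
have cS (u : R -> C) : ccontinuous u -> ccontinuous (fun t => u (1 - t)).
  move=> cu; have -> : (fun t => u (1 - t)) = (fun t => u (-1 * t + 1)).
    by apply/funext => t; congr u; ring.
  exact: ccontinuous_affine.
have c0 := cS _ (is_cderive_continuous (is_cderive_S0 l)).
have c1 := cS _ (is_cderive_continuous (is_cderive_S1 l)).
have le1 : (1 : R) <= 4 by lra.
rewrite -!/(cprimitive _ 1) -cprimitiveZ//; last exact: cintegrable04M.
rewrite -cprimitiveD//; last 2 first.
- exact: cintegrable04M.
- apply: cintegrable04M; first exact: ccontinuous_cst.
  exact: cintegrable04M.
by apply: eq_cintegral => t _; rewrite mulrDl mulrA.
Qed.

Lemma V_Q m (q : 'I_m.-1 -> R -> C) (H : 'I_m.-1 -> C) nu j l :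
  cintegrable `]0, 1[ (q j) ->
  V H j (Q a q nu j ^~ l) = edge_form nu (q j) (H j) l.
Proof.
move=> iq; have is_ := cintegrable_source nu l iq.
have x1 : 0 <= (1 : R) <= 4 by lra.
have x14 : 0 < (1 : R) < 4 by lra.
rewrite /V (cderive_particular (l := l) is_ x14); last by move=> t; exact: Q_particular.
by rewrite Q_particular// edge_formE.
Qed.

Lemma v_false m (H : 'I_m.-1 -> C) j l : v H false j l = S1 1 l + H j * S0 1 l.
Proof. by rewrite /v /V /= (is_cderiveE 1 (is_cderive_S0 l)). Qed.

Lemma v_true m (H : 'I_m.-1 -> C) j l : v H true j l = - l * S0 1 l + H j * S1 1 l.
Proof. by rewrite /v /V /= (is_cderiveE 1 (is_cderive_S1 l)). Qed.

Lemma DeltaE m (q : 'I_m.-1 -> R -> C) (H : 'I_m.-1 -> C) nu l :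
  (forall j, cintegrable `]0, 1[ (q j)) ->
  Delta a q H nu l = dSnu nu 1 l * \prod_j v H false j l +
    \sum_j (Snu nu 1 l * v H true j l + edge_form nu (q j) (H j) l) *
      \prod_(k | k != j) v H false k l.
Proof.
move=> iq; rewrite /Delta (is_cderiveE 1 (is_cderive_Snu nu l)); congr (_ + _).
by apply: eq_bigr => j _; rewrite V_Q.
Qed.

(** S_0 and S_1 have no common zero at x = 1, so v_{0,j} = 0 determines H_j. *)
Lemma v_false_eq0_inj m (H : 'I_m.-1 -> C) i j l : injective H ->
  v H false i l = 0 -> v H false j l = 0 -> i = j.
Proof.
move=> injH; rewrite !v_false => vi vj; apply: injH; apply/eqP.
have : (H i - H j) * S0 1 l = 0.
  by rewrite -[RHS](subrr 0) -{1}vi -vj; ring.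
move=> /eqP; rewrite mulf_eq0 subr_eq0 => /orP[//|/eqP s0].
move: vi; rewrite s0 mulr0 addr0 => s1.
have := S_pythagoras (1 : R) l; rewrite s0 s1 !expr0n /= mulr0 addr0.
by move=> /esym/eqP; rewrite oner_eq0.
Qed.

Lemma W22_cderive (y y' y'' : R -> C) : is_cderive y y' -> is_cderive y' y'' ->
  ccontinuous y'' -> W22 y y' y''.
Proof.
move=> d1 d2 c2; split; first exact: L2_continuous.
move=> x /andP[x0 _]; split; first exact: cFTC2 (is_cderive_continuous d2).
exact: cFTC2.
Qed.

Lemma ccontinuousZ (c : C) (u : R -> C) : ccontinuous u -> ccontinuous (fun x => c * u x).
Proof. by move=> cu; apply: ccontinuousM => //; exact: ccontinuous_cst. Qed.

Lemma W22_Snu nu l : W22 (Snu nu ^~ l) (dSnu nu ^~ l) (fun x => - l * Snu nu x l).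
Proof.
apply: W22_cderive; [exact: is_cderive_Snu | exact: is_cderive_dSnu |].
by apply: ccontinuousZ; exact: ccontinuous_Snu.
Qed.

Lemma W22_add (y y' y'' z z' z'' : R -> C) : W22 y y' y'' -> W22 z z' z'' ->
  cintegrable `[0, 1] y' -> cintegrable `[0, 1] y'' ->
  cintegrable `[0, 1] z' -> cintegrable `[0, 1] z'' ->
  W22 (fun x => y x + z x) (fun x => y' x + z' x) (fun x => y'' x + z'' x).
Proof.
move=> [ly hy] [lz hz] iy' iy'' iz' iz''; split; first exact: L2_add.
move=> x x01; have [y1 y2] := hy _ x01; have [z1 z2] := hz _ x01.
have sub f : cintegrable `[0, 1] f -> cintegrable `[0, x] f.
  apply: cintegrableS => // t /=; rewrite !in_itv /= => /andP[-> tx].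
  by apply: le_trans tx _; case/andP: x01.
by split; rewrite cintegralD//; [rewrite y1 z1 | exact: sub | exact: sub | rewrite y2 z2 | exact: sub | exact: sub]; ring.
Qed.

(** Its second derivative is only square-integrable, as is the potential in the
source term. *)
Lemma W22_particular q nu l : L2_01 q ->
  W22 (particular (source nu q l) l) (dparticular (source nu q l) l)
    (fun t => - l * particular (source nu q l) l t + source nu q l t).
Proof.
move=> Lq; have is_ := cintegrable_source nu l (L2_integrable Lq).
have part0 f : cprimitive f 0 = 0.
  by rewrite /cprimitive set_itv1 /cintegral !Rintegral_set1.
split.
  apply: L2_add; last by apply: L2_mul; [exact: ccontinuous_Snu_shift | exact: L2_cut].
  apply: L2_mul; first exact: ccontinuous_cst.
  have Lp f : cintegrable `[0, 4] f -> L2_01 (cprimitive f).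
    by move=> fi; have [] := cprimitive_within (ltac:(lra) : 0 <= 4 :> R) fi; exact: L2_within.
  have c0 := is_cderive_continuous (is_cderive_S0 l).
  have c1 := is_cderive_continuous (is_cderive_S1 l).
  apply: L2_add; apply: L2_mul.
  - exact: c0.
  - by apply: Lp; exact: cintegrable04M.
  - have := ccontinuousZ (-1) c1; congr (ccontinuous _).
    by apply/funext => x; rewrite mulN1r.
  - by apply: Lp; exact: cintegrable04M.
move=> x /andP[x0 x1].
have x04 : 0 <= x <= 4 by lra.
have z04 : 0 <= (0 : R) <= 4 by lra.
rewrite (particular_primitive l is_ x04) (particular_primitive l is_ z04).
rewrite (dparticular_primitive l is_ x04) (dparticular_primitive l is_ z04).
by rewrite !part0 !add0r.
Qed.

End CharacteristicFunction.

(** * Zeros of the characteristic function are eigenvalues *)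

Section Eigenvalue.
Variables (R : realType) (m : nat) (a : R).
Local Notation C := R[i].
Local Notation mu := (@lebesgue_measure R).
Variables (q : 'I_m.-1 -> R -> C) (H : 'I_m.-1 -> C) (nu : bool).
Hypotheses (Lq : forall j, L2_01 (q j)) (injH : injective H).

(** y_1 = S_nu may be taken outright: the coefficients of S_0 on the other
edges then solve a linear system whose determinant is Delta. *)
Lemma eigenvalue_of_Delta_eq0 l : Delta a q H nu l = 0 -> eigenvalue_B a q H nu l.
Proof.
have iq j : cintegrable `]0, 1[ (q j) by exact: L2_integrable.
rewrite (DeltaE a H nu l iq) => /solve_bordered_system sol.
have [i j|b hb sb] := sol; first exact: v_false_eq0_inj.
pose P j := particular (source a nu (q j) l) l.
pose dP j := dparticular (source a nu (q j) l) l.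
pose c := Snu nu 1 l.
exists (Snu nu ^~ l), (dSnu nu ^~ l), (fun x => - l * Snu nu x l).
exists (fun j x => (c * S1 x l + b j * S0 x l) + P j x).
exists (fun j x => (c * (- l * S0 x l) + b j * S1 x l) + dP j x).
exists (fun j x => (c * (- l * S1 x l) + b j * (- l * S0 x l)) +
   (- l * P j x + source a nu (q j) l x)).
have c0 := is_cderive_continuous (is_cderive_S0 l).
have c1 := is_cderive_continuous (is_cderive_S1 l).
have P0 j : P j 0 = 0.
  by rewrite /P /particular /cprimitive set_itv1 /cintegral !Rintegral_set1 !mulr0 addr0.
have dP0 j : dP j 0 = 0.
  by rewrite /dP /dparticular /cprimitive set_itv1 /cintegral !Rintegral_set1 !mulr0 addr0.
split.
- split; first exact: W22_Snu.
  move=> j; apply: W22_add.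
  + apply: W22_cderive.
    * apply: is_cderiveD; apply: is_cderiveZ; [exact: is_cderive_S1|exact: is_cderive_S0].
    * apply: is_cderiveD; apply: is_cderiveZ; last exact: is_cderive_S1.
      by apply: is_cderiveZ; exact: is_cderive_S0.
    * by apply: ccontinuousD; apply: ccontinuousZ; apply: ccontinuousZ.
  + exact: W22_particular.
  + apply: ccontinuous_cintegrable; first exact: segment_compact.
    by apply: ccontinuousD; apply: ccontinuousZ => //; exact: ccontinuousZ.
  + apply: ccontinuous_cintegrable; first exact: segment_compact.
    by apply: ccontinuousD; apply: ccontinuousZ; exact: ccontinuousZ.
  + apply: cintegrable04S; first lra.
    by apply: cintegrable_dparticular; exact: cintegrable_source.
  + apply: cintegrable04S; first lra.
    apply: cintegrableD => //; last exact: cintegrable_source.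
    apply: cintegrable04M; first exact: ccontinuous_cst.
    by apply: cintegrable_particular; exact: cintegrable_source.
- split; first by apply: aeW => x _; rewrite mulNr opprK.
  move=> j; exists [set a - 1]; split.
  + exact: measurable_set1.
  + exact: lebesgue_measure_set1.
  move=> x /= nx; apply: contrapT => xa; apply: nx => /andP[x0 x1].
  rewrite /source /cut; case: ifPn => [|].
    rewrite inE /active /= !in_itv /= => -[/andP[ax _] _].
    have -> : a - 1 < x by rewrite lt_neqAle ax andbT; apply/eqP => /esym.
    rewrite /P; ring.
  rewrite notin_setE /active /= !in_itv /= => nax.
  rewrite ifF; first by rewrite /P; ring.
  apply/negP => ax; apply: nax; split; apply/andP; split; lra.
- split; first by move=> j; rewrite /c P0 S1_0 S0_0; ring.
  by rewrite -sb; apply: eq_bigr => j _; rewrite dP0 S1_0 S0_0; ring.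
- split; first by case: (nu); rewrite /= S0_0 ?mulr0.
  move=> j; rewrite -[RHS](hb j) v_false v_true edge_formE// /P /dP /c.
  by ring.
- have [nz|allz] := pselect (exists2 x : R, 0 <= x <= 1 & Snu nu x l != 0).
    by have [x x01 nzx] := nz; exists x => //; left.
  exfalso; have z x : 0 <= x <= 1 -> Snu nu x l = 0.
    by move=> x01; apply/eqP; apply: contrapT => /negP nz; apply: allz; exists x.
  have z01 : 0 <= (0 : R) <= 1 by lra.
  case: (nu) z => z.
    by have := z 0 z01; rewrite /= S1_0 => /eqP; rewrite oner_eq0.
  have int0 (f : R -> C) x : (forall t, 0 <= t <= x -> f t = 0) -> cintegral `[0, x] f = 0.
    move=> f0; rewrite (@eq_cintegral _ _ _ (fun=> 0)).
      by rewrite /cintegral /= !Rintegral_cst// !mul0r.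
    by move=> t /=; rewrite in_itv /= => /f0.
  have s1 x : 0 <= x <= 1 -> S1 x l = 1.
    move=> /andP[x0 x1]; rewrite (cFTC2 x0 (is_cderive_S1 l)); last exact: ccontinuousZ.
    rewrite S1_0 int0 ?addr0// => t /andP[t0 tx].
    by rewrite [S0 t l](z t) ?mulr0// t0 (le_trans tx).
  have := S_pythagoras (1 : R) l; have := cFTC2 (ler01 : 0 <= 1 :> R) (is_cderive_S0 l) c1.
  rewrite S0_0 [S0 1 l](z 1); last by lra.
  rewrite (@eq_cintegral _ _ _ (fun=> 1)); last first.
    by move=> t /=; rewrite in_itv /= => /s1.
  rewrite add0r /cintegral /= !Rintegral_cst//= lebesgue_measure_itv /= lte01.
  by rewrite oppr0 adde0 /= mulr1 => -[/eqP]; rewrite eq_sym oner_eq0.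
Qed.

End Eigenvalue.

(** * Functions of rho with a removable singularity at 0 *)

Section PuncturedExpansion.
Variable R : realType.
Local Notation C := R[i].
Implicit Types (z w h : C) (f g F G : C -> C).

Lemma lipschitz_atD f g z : lipschitz_at f z -> lipschitz_at g z ->
  lipschitz_at (fun w => f w + g w) z.
Proof.
move=> [K [r [r0 K0 hf]]] [L [s [s0 L0 hg]]].
exists (K + L), (Num.min r s); split; [by rewrite lt_min r0|exact: addr_ge0|].
move=> h; rewrite le_min => /andP[hr hs].
rewrite opprD addrACA (le_trans (le_normcD _ _))// [X in _ <= X]mulrDl.
by rewrite lerD ?hf ?hg.
Qed.

Lemma lipschitz_atM f g z : lipschitz_at f z -> lipschitz_at g z ->
  lipschitz_at (fun w => f w * g w) z.
Proof.
move=> lf lg; have [B [t [t0 B0 hB]]] := lipschitz_at_bounded lg.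
move: lf lg => [K [r [r0 K0 hf]]] [L [s [s0 L0 hg]]].
exists (K * B + normc (f z) * L), (Num.min t (Num.min r s)).
split; [by rewrite !lt_min r0 t0|by rewrite addr_ge0 ?mulr_ge0 ?normc_ge0|].
move=> h; rewrite !le_min => /and3P[ht hr hs].
rewrite (_ : _ - _ = (f (z + h) - f z) * g (z + h) + f z * (g (z + h) - g z)); last by ring.
rewrite (le_trans (le_normcD _ _))// [X in _ <= X]mulrDl lerD// normcM.
  by rewrite mulrAC ler_pM ?normc_ge0 ?hf ?hB.
by rewrite -mulrA ler_wpM2l ?normc_ge0 ?hg.
Qed.

Lemma expands2_near f g z (r : R) : 0 < r ->
  (forall h, normc h <= r -> f (z + h) = g (z + h)) -> expands2 g z -> expands2 f z.
Proof.
move=> r0 fg [g1 [g2 [K [s [s0 K0 hg]]]]].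
exists g1, g2, K, (Num.min r s); split=> //; first by rewrite lt_min r0.
move=> h; rewrite le_min => /andP[hr hs]; rewrite fg//.
have := fg 0; rewrite normc0 addr0 => -> //; last exact: ltW.
exact: hg.
Qed.

(** The functions of rho met below are quotients by powers of rho with a
removable singularity at 0: there continuity is all that is needed, since the
maximum principle can be applied after multiplication by rho. *)
Definition expands2_punctured f :=
  (forall z, z != 0 -> expands2 f z) /\ lipschitz_at f 0.

Lemma punctured_cst (c : C) : expands2_punctured (fun=> c).
Proof.
by split => [z _|]; [|apply: expands2_lipschitz]; exact: expands2_cst.
Qed.

Lemma punctured_id : expands2_punctured id.
Proof.
by split => [z _|]; [|apply: expands2_lipschitz]; exact: expands2_id.
Qed.

Lemma puncturedD f g : expands2_punctured f -> expands2_punctured g ->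
  expands2_punctured (fun z => f z + g z).
Proof.
move=> [f1 f2] [g1 g2]; split; last exact: lipschitz_atD.
by move=> z z0; apply: expands2D; [exact: f1 | exact: g1].
Qed.

Lemma puncturedM f g : expands2_punctured f -> expands2_punctured g ->
  expands2_punctured (fun z => f z * g z).
Proof.
move=> [f1 f2] [g1 g2]; split; last exact: lipschitz_atM.
by move=> z z0; apply: expands2M; [exact: f1 | exact: g1].
Qed.

Lemma punctured_sum (I : Type) (r : seq I) (P : pred I) (F : I -> C -> C) :
  (forall i, expands2_punctured (F i)) ->
  expands2_punctured (fun z => \sum_(i <- r | P i) F i z).
Proof.
move=> hF; elim: r => [|i r IH].
  by under eq_fun do rewrite big_nil; exact: punctured_cst.
under eq_fun do rewrite big_cons.
by case: (P i) => //; exact: puncturedD.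
Qed.

Lemma punctured_prod (I : Type) (r : seq I) (P : pred I) (F : I -> C -> C) :
  (forall i, expands2_punctured (F i)) ->
  expands2_punctured (fun z => \prod_(i <- r | P i) F i z).
Proof.
move=> hF; elim: r => [|i r IH].
  by under eq_fun do rewrite big_nil; exact: punctured_cst.
under eq_fun do rewrite big_cons.
by case: (P i) => //; exact: puncturedM.
Qed.

Lemma punctured_lipschitz f z : expands2_punctured f -> lipschitz_at f z.
Proof.
move=> [f1 f2]; have [->//|z0] := eqVneq z 0.
by apply: expands2_lipschitz; exact: f1.
Qed.

Lemma lipschitz_at_eq0 f z (r : R) : 0 < r -> lipschitz_at f z ->
  (forall h, h != 0 -> normc h <= r -> f (z + h) = 0) -> f z = 0.
Proof.
move=> r0 /lipschitz_at_cvg lf f0; apply: eq0_normc; apply/eqP.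
rewrite eq_le normc_ge0 andbT; apply/ler_addgt0Pr => e e0; rewrite add0r.
have [d d0 hd] := lf e e0; pose t := Num.min d r.
have t0 : 0 < t by rewrite lt_min d0.
have nt : normc t%:C = t by rewrite normc_real ger0_norm// ltW.
have := hd t%:C; rewrite nt f0 ?sub0r ?normcN.
- by apply; rewrite /t ge_min lexx.
- by rewrite -normc_gt0 nt.
- by rewrite nt /t ge_min lexx orbT.
Qed.

Lemma punctured_eq0 f : expands2_punctured f -> (forall z, z != 0 -> f z = 0) ->
  forall z, f z = 0.
Proof.
move=> [_ lf] f0 z; have [->|] := eqVneq z 0; last exact: f0.
by apply: (lipschitz_at_eq0 ltr01 lf) => h h0 _; rewrite add0r f0.
Qed.

Definition locally_dominated f g := forall z, g z = 0 ->
  exists K r : R, [/\ 0 < r, 0 <= K &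
    forall h, normc h <= r -> normc (f (z + h)) <= K * normc (g (z + h))].

Lemma entire_ratio_punctured f g : expands2_punctured f -> expands2_punctured g ->
  locally_dominated f g -> entire_ratio (fun z => z * f z) (fun z => z * g z).
Proof.
move=> pf pg dom; split.
  move=> z; rewrite mulf_eq0 negb_or => /andP[z0 _].
  by split; apply: expands2M; [exact: expands2_id|apply pf|exact: expands2_id|apply pg].
move=> z zg; split.
  by apply: punctured_lipschitz; exact: puncturedM punctured_id pg.
have [K [r [r0 K0 h]]] : exists K r : R, [/\ 0 < r, 0 <= K &
    forall h, normc h <= r -> normc (f (z + h)) <= K * normc (g (z + h))].
  have [gz|gz] := eqVneq (g z) 0; first exact: dom.
  have [s s0 hs] := lipschitz_at_neq0 (punctured_lipschitz z pg) gz.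
  have [B [t [t0 B0 hB]]] := lipschitz_at_bounded (punctured_lipschitz z pf).
  have g2 : 0 < normc (g z) / 2 by rewrite divr_gt0// normc_gt0.
  exists (B / (normc (g z) / 2)), (Num.min s t); split.
  - by rewrite lt_min s0.
  - by rewrite divr_ge0// ltW.
  move=> h; rewrite le_min => /andP[h1 h2]; apply: le_trans (hB _ h2) _.
  by rewrite mulrAC ler_pdivlMr// ler_wpM2l// hs.
exists K, r; split=> // w wr; rewrite !normcM mulrCA ler_wpM2l ?normc_ge0//.
exact: h.
Qed.

Lemma punctured_liouville0 f g : expands2_punctured f -> expands2_punctured g ->
  locally_dominated f g ->
  (forall e B : R, 0 < e -> exists2 L, B <= L & forall z,
     on_square_boundary L z -> normc (f z) <= e * normc (g z)) ->
  forall z, f z = 0.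
Proof.
move=> pf pg dom hB; apply: punctured_eq0 => // z z0; apply: (mulfI z0).
rewrite mulr0; apply: (liouville0 (entire_ratio_punctured pf pg dom)).
move=> e B e0; have [L BL hL] := hB e B e0; exists L => // w /hL.
by rewrite !normcM mulrCA => h; rewrite ler_wpM2l ?normc_ge0.
Qed.

Lemma punctured_liouville f g (M : R) z0 : expands2_punctured f ->
  expands2_punctured g -> locally_dominated f g -> z0 != 0 -> g z0 != 0 -> 0 <= M ->
  (forall B : R, exists2 L, B <= L & forall z,
     on_square_boundary L z -> normc (f z) <= M * normc (g z)) ->
  exists c, forall z, z != 0 -> f z = c * g z.
Proof.
move=> pf pg dom z00 gz0 M0 hB; exists (f z0 / g z0) => z zn0.
have zg : z0 * g z0 != 0 by rewrite mulf_neq0.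
have hB' (B : R) : exists2 L, B <= L & forall w, on_square_boundary L w ->
    normc (w * f w) <= M * normc (w * g w).
  have [L BL hL] := hB B; exists L => // w /hL.
  by rewrite !normcM mulrCA => h; rewrite ler_wpM2l ?normc_ge0.
have := liouville (entire_ratio_punctured pf pg dom) zg M0 hB' z.
move=> e; apply: (mulfI (mulf_neq0 zn0 zg)).
have -> : z * (z0 * g z0) * f z = z * f z * (z0 * g z0) by ring.
by rewrite e; field.
Qed.

End PuncturedExpansion.

(** * The contribution of one edge *)

Section EdgeForm.
Variables (R : realType) (a : R).
Hypothesis a12 : 1 <= a < 2.
Local Notation C := R[i].
Local Notation mu := (@lebesgue_measure R).
Variable q : R -> C.
Hypothesis iq : cintegrable `]0, 1[ q.
Implicit Types (z w r : C) (t x s : R).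

Let sub01 : `[0, 1] `<=` (`[-4, 4] : set R) := @itv01_sub R.

Definition expi r s : C := cexp ('i%C * r * s%:C).

Lemma expiD r s x : expi r (s + x) = expi r s * expi r x.
Proof. by rewrite /expi rmorphD mulrDr cexpD. Qed.

Lemma expiN r s : expi r (- s) = (expi r s)^-1.
Proof. by rewrite /expi rmorphN mulrN cexpN. Qed.

Lemma expiNl r s : expi (- r) s = (expi r s)^-1.
Proof. by rewrite /expi mulrN mulNr cexpN. Qed.

Lemma expi_neq0 r s : expi r s != 0.
Proof. exact: cexp_neq0. Qed.

Lemma normc_expi r s : normc (expi r s) = expR (- (complex.Im r * s)).
Proof. by rewrite /expi normc_cexp; congr expR; case: r => b c /=; ring. Qed.

Lemma normc_expi_le r s : `|s| <= 1 -> normc (expi r s) <= expR `|complex.Im r|.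
Proof.
move=> s1; rewrite normc_expi ler_expR (le_trans (ler_norm _))//.
by rewrite normrN normrM ler_piMr.
Qed.

Lemma ccontinuous_expi r (k b : R) : ccontinuous (fun t => expi r (k * t + b)).
Proof.
have -> : (fun t => expi r (k * t + b)) =
    (fun t => cexp (('i%C * r * k%:C) * t%:C + 'i%C * r * b%:C)).
  by apply/funext => t; rewrite /expi rmorphD rmorphM; congr cexp; ring.
exact: is_cderive_continuous (is_cderive_cexp _ _).
Qed.

Lemma ccos_expi r x : ccos (r * x%:C) = (expi r x + (expi r x)^-1) / 2%:R.
Proof. by rewrite ccosE /expi mulrA. Qed.

Lemma csin_expi r x : csin (r * x%:C) = - 'i%C * (expi r x - (expi r x)^-1) / 2%:R.
Proof. by rewrite csinE /expi mulrA. Qed.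

Definition edge_mass : C := cintegral `[0, 1] (cut a q).

Definition edge_fourier r : C :=
  cintegral `[0, 1] (fun t => expi r (2 * t - a) * cut a q t).

Definition edge_norm : R := \int[mu]_(t in `[0, 1]) normc (cut a q t).

Lemma cintegrable_cut01 : cintegrable `[0, 1] (cut a q).
Proof. by apply: cintegrable04S; [lra | exact: cintegrable_cut]. Qed.

Let iN : mu.-integrable `[0, 1] (EFin \o (fun t => normc (cut a q t))).
Proof. by apply: cintegrable_normc => //; exact: cintegrable_cut01. Qed.

Lemma edge_norm_ge0 : 0 <= edge_norm.
Proof. by apply: Rintegral_ge0 => t _; exact: normc_ge0. Qed.

(** Estimates of integrals against the potential only matter where the
frozen argument is active, that is for t >= a - 1. *)
Lemma normc_cintegral_cut (u : R -> C) (B : R) : ccontinuous u ->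
  (forall t, 0 <= t <= 1 -> a - 1 <= t -> normc (u t) <= B) ->
  normc (cintegral `[0, 1] (fun t => u t * cut a q t)) <= 2 * (B * edge_norm).
Proof.
move=> cu uB.
have iB : mu.-integrable `[0, 1] (EFin \o (fun t => B * normc (cut a q t))).
  by apply: integrable_mul_bounded => //; exact: cst_continuous.
apply: le_trans (normc_cintegral (@measurable_itv01 R) _ iB _) _.
- by apply: cintegrableMc => //; exact: cintegrable_cut01.
- move=> t /=; rewrite in_itv /= => t01; rewrite normcM /cut.
  case: ifPn => [|_]; last by rewrite normc0 !mulr0.
  rewrite inE /active /= !in_itv /= => -[/andP[ta _] _].
  by rewrite ler_wpM2r ?normc_ge0// uB.
by rewrite RintegralZl.
Qed.

Let a2t t : 0 <= t <= 1 -> a - 1 <= t -> `|2 * t - a| <= 1.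
Proof. move=> t01 ta; have /andP[a1 a2] := a12; have /andP[t0 t1] := t01; rewrite ler_norml; apply/andP; split; lra. Qed.

Lemma ccontinuous_kernel r : ccontinuous (fun t => expi r (2 * t - a)).
Proof. exact: ccontinuous_expi. Qed.

Lemma normc_edge_fourier r :
  normc (edge_fourier r) <= 2 * (expR `|complex.Im r| * edge_norm).
Proof.
apply: normc_cintegral_cut; first exact: ccontinuous_kernel.
by move=> t t01 ta; apply: normc_expi_le; exact: a2t.
Qed.

Lemma expands2_edge_fourier r : expands2 edge_fourier r.
Proof.
have [K K0 hK] := cexp_taylor2 R.
have cl (c : C) : ccontinuous (fun t => c * (2 * t - a)%:C).
  apply: ccontinuousZ; split => x /=; last exact: cst_continuous.
  apply: cvgB; last exact: cvg_cst.
  by apply: cvgM; [exact: cvg_cst | exact: cvg_id].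
pose k1 t := 'i%C * (2 * t - a)%:C * expi r (2 * t - a).
pose k2 t := ('i%C * (2 * t - a)%:C) * ('i%C * (2 * t - a)%:C) / 2%:R * expi r (2 * t - a).
have c1 : ccontinuous k1 by apply: ccontinuousM => //; exact: ccontinuous_kernel.
have c2 : ccontinuous k2.
  apply: ccontinuousM; last exact: ccontinuous_kernel.
  by apply: ccontinuousM; [exact: ccontinuousM | exact: ccontinuous_cst].
have ic u : ccontinuous u -> cintegrable `[0, 1] (fun t => u t * cut a q t).
  by move=> cu; apply: cintegrableMc => //; exact: cintegrable_cut01.
exists (cintegral `[0, 1] (fun t => k1 t * cut a q t)).
exists (cintegral `[0, 1] (fun t => k2 t * cut a q t)).
exists (2 * (expR `|complex.Im r| * K * edge_norm)), 1; split => //.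
  by rewrite !mulr_ge0 ?expR_ge0// edge_norm_ge0.
move=> h h1.
pose k t := expi (r + h) (2 * t - a) + -1 * (expi r (2 * t - a) + (h * k1 t + h ^+ 2 * k2 t)).
have ck : ccontinuous k.
  apply: ccontinuousD; first exact: ccontinuous_kernel.
  apply: ccontinuousZ; apply: ccontinuousD; first exact: ccontinuous_kernel.
  by apply: ccontinuousD; exact: ccontinuousZ.
have -> : edge_fourier (r + h) - (edge_fourier r + cintegral `[0, 1] (fun t => k1 t * cut a q t) * h +
    cintegral `[0, 1] (fun t => k2 t * cut a q t) * h ^+ 2) =
    cintegral `[0, 1] (fun t => k t * cut a q t).
  rewrite (@eq_cintegral _ _ (fun t => k t * cut a q t) (fun t => expi (r + h) (2 * t - a) * cut a q t +
    ((-1) * (expi r (2 * t - a) * cut a q t) + ((- h) * (k1 t * cut a q t) + (- h ^+ 2) * (k2 t * cut a q t))))).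
    have iz c u : ccontinuous u -> cintegrable `[0, 1] (fun t => c * (u t * cut a q t)).
      by move=> cu; apply: cintegrableMc => //; [exact: ic | exact: ccontinuous_cst].
    have e0 := ccontinuous_kernel r; have e1 := ccontinuous_kernel (r + h).
    have i12 := cintegrableD (@measurable_itv01 R) (iz (- h) _ c1) (iz (- h ^+ 2) _ c2).
    rewrite cintegralD//; [|exact: ic|by apply: cintegrableD => //; exact: iz].
    rewrite cintegralD//; last exact: iz.
    rewrite cintegralD//; [|exact: iz|exact: iz].
    rewrite !cintegralZ//; [|exact: ic..].
    by rewrite /edge_fourier; ring.
  by move=> t _; rewrite /k; ring.
apply: le_trans (normc_cintegral_cut (B := expR `|complex.Im r| * K * normc h ^+ 3) ck _) _.
  move=> t t01 ta.
  have -> : k t = expi r (2 * t - a) * (cexp ('i%C * h * (2 * t - a)%:C) - 1 -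
      'i%C * h * (2 * t - a)%:C - ('i%C * h * (2 * t - a)%:C) ^+ 2 / 2%:R).
    rewrite /k /k1 /k2 {1}/expi mulrDr mulrDl cexpD -!/(expi _ _); ring.
  have w1 : normc ('i%C * h * (2 * t - a)%:C) <= normc h.
    by rewrite !normcM normci mul1r normc_real ler_piMr ?normc_ge0// a2t.
  rewrite normcM -[X in _ <= X]mulrA; apply: ler_pM; rewrite ?normc_ge0//.
    by apply: normc_expi_le; exact: a2t.
  apply: le_trans (hK _ (le_trans w1 h1)) _.
  by rewrite ler_wpM2l// lerXn2r ?nnegrE ?normc_ge0.
by apply: le_of_eq; ring.
Qed.

End EdgeForm.

Section NearZero.
Variable R : realType.
Local Notation C := R[i].
Implicit Types (z w r : C) (t x s : R).

Lemma expands2_expi s z : expands2 (fun r : C => expi r s) z.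
Proof.
have [K K0 hK] := cexp_taylor2 R.
have s1 : 0 < `|s| + 1 by rewrite ltr_wpDl.
exists (expi z s * ('i%C * s%:C)), (expi z s * (('i%C * s%:C) ^+ 2 / 2%:R)).
exists (normc (expi z s) * (K * `|s| ^+ 3)), (`|s| + 1)^-1; split.
- by rewrite invr_gt0.
- by rewrite !mulr_ge0 ?normc_ge0// exprn_ge0.
move=> h hs; have nw : normc ('i%C * h * s%:C) = `|s| * normc h.
  by rewrite !normcM normci mul1r normc_real mulrC.
have w1 : normc ('i%C * h * s%:C) <= 1.
  rewrite nw; apply: (@le_trans _ _ ((`|s| + 1) * normc h)).
    by rewrite ler_wpM2r ?normc_ge0// lerDl.
  by rewrite mulrC -ler_pdivlMr// mul1r.
have -> : expi (z + h) s - (expi z s + expi z s * ('i%C * s%:C) * h + expi z s * (('i%C * s%:C) ^+ 2 / 2%:R) * h ^+ 2) =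
    expi z s * (cexp ('i%C * h * s%:C) - 1 - 'i%C * h * s%:C - ('i%C * h * s%:C) ^+ 2 / 2%:R).
  rewrite {1}/expi mulrDr mulrDl cexpD -!/(expi _ _); ring.
rewrite normcM -[X in _ <= X]mulrA ler_wpM2l ?normc_ge0//.
apply: le_trans (hK _ w1) _; rewrite nw exprMn mulrA//.
Qed.

Lemma expands2_opp (f : C -> C) z : expands2 f (- z) -> expands2 (fun w => f (- w)) z.
Proof.
move=> [f1 [f2 [K [r [r0 K0 hf]]]]]; exists (- f1), f2, K, r; split => // h hr.
have := hf (- h); rewrite normcN => /(_ hr).
by rewrite (opprD z h) mulrN (mulNr f1 h) sqrrN.
Qed.

Lemma csin_near0 : exists2 K : R, 0 <= K & forall z, normc z <= 1 ->
  normc (csin z - z) <= K * normc z ^+ 2 /\ normc (ccos z - 1) <= K * normc z.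
Proof.
have [K K0 hK] := cexp_taylor2 R; exists (K + 1); first exact: addr_ge0.
move=> z z1; have n0 := normc_ge0 z.
have nz : normc ('i%C * z) = normc z by rewrite normcM normci mul1r.
have h1 := hK ('i%C * z); rewrite nz in h1; have {}h1 := h1 z1.
have h2 := hK (- ('i%C * z)); rewrite normcN nz in h2; have {}h2 := h2 z1.
set r1 := cexp _ - _ - _ - _ in h1; set r2 := cexp _ - _ - _ - _ in h2.
have n2 : normc (2%:R : C) = 2 by rewrite normc_nat.
have half w : normc (w / 2%:R) = normc w / 2 by rewrite normcf n2.
have z32 : normc z ^+ 3 <= normc z ^+ 2 by rewrite exprS ler_piMl// exprn_ge0.
have z31 : normc z ^+ 3 <= normc z.
  by rewrite exprS ler_piMr// exprn_ile1.
have z21 : normc z ^+ 2 <= normc z by rewrite expr2 ler_piMl.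
have K32 : K * normc z ^+ 3 <= K * normc z ^+ 2 by rewrite ler_wpM2l.
have K31 : K * normc z ^+ 3 <= K * normc z by rewrite ler_wpM2l.
split.
  have -> : csin z - z = - 'i%C * ((r1 - r2) / 2%:R).
    rewrite csinE -cexpN /r1 /r2.
    move: (cexp ('i%C * z)) (cexp (- ('i%C * z))) => A B.
    transitivity (- 'i%C * (A - B) / 2%:R + 'i%C * 'i%C * z); first by rewrite mulcii; ring.
    by field.
  rewrite normcM normcN normci mul1r half ler_pdivrMr//.
  have := le_normcB r1 r2; have := sqr_ge0 (normc z); lra.
have -> : ccos z - 1 = (r1 + r2) / 2%:R + ('i%C * z) ^+ 2 / 2%:R.
  rewrite ccosE -cexpN /r1 /r2; move: (cexp ('i%C * z)) (cexp (- ('i%C * z))) => A B; by field.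
have := le_normcD ((r1 + r2) / 2%:R) (('i%C * z) ^+ 2 / 2%:R).
rewrite !half normcX nz; have := le_normcD r1 r2; lra.
Qed.

Lemma Snu_near0 nu : exists2 K : R, 0 <= K & forall x r, `|x| <= 4 -> normc r <= 4^-1 ->
  normc (Snu nu x (r ^+ 2) - Snu nu x 0) <= K * normc r.
Proof.
have [K K0 hK] := csin_near0; exists (16 * K); first by rewrite mulr_ge0.
move=> x r x4 r4; have n0 := normc_ge0 r.
have [->|r0] := eqVneq r 0.
  by rewrite expr0n subrr normc0 mulr0.
have nz : normc (r * x%:C) = normc r * `|x| by rewrite normcM normc_real.
have z1 : normc (r * x%:C) <= 1.
  rewrite nz; apply: (@le_trans _ _ (4^-1 * 4)); first exact: ler_pM.
  by rewrite mulVf.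
have nr0 : 0 < normc r by rewrite normc_gt0.
have [hs hc] := hK _ z1.
case: nu; rewrite /Snu.
  rewrite S1_sqr S1_x0; apply: le_trans hc _; rewrite nz.
  rewrite (_ : 16 * K * normc r = K * (normc r * 16)); last by ring.
  by rewrite ler_wpM2l// ler_wpM2l//; lra.
rewrite S0_sqr// S0_x0.
have -> : csin (r * x%:C) / r - x%:C = (csin (r * x%:C) - r * x%:C) / r by field.
rewrite normcf ler_pdivrMr//; apply: le_trans hs _; rewrite nz.
rewrite (_ : 16 * K * normc r * normc r = K * (normc r ^+ 2 * 4 ^+ 2)); last by ring.
by rewrite exprMn ler_wpM2l// ler_wpM2l ?sqr_ge0// lerXn2r ?nnegrE.
Qed.

Lemma punctured_Snu nu x : `|x| <= 4 -> expands2_punctured (fun r : C => Snu nu x (r ^+ 2)).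
Proof.
move=> x4; split; last first.
  have [K K0 hK] := Snu_near0 nu; exists K, 4^-1; split => //.
  by move=> h h4; rewrite add0r expr0n; exact: hK.
move=> z z0; have nz : 0 < normc z by rewrite normc_gt0.
have pe : expands2 (fun r : C => expi r x) z by exact: expands2_expi.
have ie : expands2 (fun r : C => (expi r x)^-1) z by apply: expands2V => //; exact: expi_neq0.
apply: (@expands2_near _ _ (fun r => if nu then (expi r x + (expi r x)^-1) * 2%:R^-1
   else - 'i%C * (expi r x + -1 * (expi r x)^-1) * (2%:R^-1 * r^-1)) z (normc z / 2)).
- by rewrite divr_gt0.
- move=> h hz; have zh : z + h != 0.
    rewrite -normc_gt0; apply: lt_le_trans (le_normc_addr _ _); lra.
  case: nu; rewrite /= ?S1_sqr ?S0_sqr// ?ccos_expi ?csin_expi//.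
  by rewrite mulN1r; ring.
case: nu; last first.
  apply: expands2M; last first.
    by apply: expands2M; [exact: expands2_cst | apply: expands2V; [exact: expands2_id|]].
  apply: expands2M; first exact: expands2_cst.
  by apply: expands2D => //; apply: expands2M => //; exact: expands2_cst.
by apply: expands2M; [exact: expands2D | exact: expands2_cst].
Qed.

End NearZero.

Section EdgeFormRho.
Variables (R : realType) (a : R).
Hypothesis a12 : 1 <= a < 2.
Local Notation C := R[i].
Local Notation mu := (@lebesgue_measure R).
Variable q : R -> C.
Hypothesis iq : cintegrable `]0, 1[ q.
Variable h : C.
Implicit Types (z w r : C) (t x s : R).

Let sub01 : `[0, 1] `<=` (`[-4, 4] : set R) := @itv01_sub R.

Let A := edge_mass a q.
Let F := edge_fourier a q.

(** The integrals of phi e^{i rho (t - a + 1)} and phi e^{- i rho (t - a + 1)}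
against the potential, where phi t = cos rho (1 - t) + h sin rho (1 - t) / rho.
In the product the exponential e^{i rho (1 - t)} of phi combines with
e^{i rho (t - a + 1)} to a factor independent of t: whence the total mass. *)
Definition edge_plus r : C :=
  (1 - 'i%C * h / r) / 2%:R * (expi r (2 - a) * A) + (1 + 'i%C * h / r) / 2%:R * F r.
Definition edge_minus r : C :=
  (1 - 'i%C * h / r) / 2%:R * F (- r) + (1 + 'i%C * h / r) / 2%:R * ((expi r (2 - a))^-1 * A).

Let ic u : ccontinuous u -> cintegrable `[0, 1] (fun t => u t * cut a q t).
Proof. by move=> cu; apply: cintegrableMc => //; exact: cintegrable_cut01. Qed.

(** Once the three integrals in edge_plus and edge_minus stand under one integral
sign, identities between them reduce to identities of exponentials. *)
Lemma edge_combination c1 c2 c3 r :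
  c1 * A + c2 * F r + c3 * F (- r) =
  cintegral `[0, 1] (fun t => (c1 + c2 * expi r (2 * t - a) + c3 * (expi r (2 * t - a))^-1) * cut a q t).
Proof.
have e1 := ccontinuous_kernel a r; have e2 := ccontinuous_kernel a (- r).
have iz c u : ccontinuous u -> cintegrable `[0, 1] (fun t => c * (u t * cut a q t)).
  by move=> cu; apply: cintegrableMc => //; [exact: ic | exact: ccontinuous_cst].
have i1 : cintegrable `[0, 1] (fun t => c1 * cut a q t).
  by apply: ic; exact: ccontinuous_cst.
rewrite /A /F /edge_mass /edge_fourier -!cintegralZ//; [|exact: ic|exact: ic|exact: cintegrable_cut01].
rewrite -cintegralD//; last exact: iz.
rewrite -cintegralD//; [|by apply: cintegrableD => //; exact: iz|exact: iz].
by apply: eq_cintegral => t _; rewrite expiNl; ring.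
Qed.

Lemma edge_form_plus_minus nu r : r != 0 -> edge_form a nu q h (r ^+ 2) =
  if nu then (edge_plus r + edge_minus r) / 2%:R
  else - 'i%C * (edge_plus r - edge_minus r) / (2%:R * r).
Proof.
move=> r0.
set al := (1 - 'i%C * h / r) / 2%:R; set be := (1 + 'i%C * h / r) / 2%:R.
set E := expi r (2 - a); have E0 : E != 0 by exact: expi_neq0.
have -> : (if nu then (edge_plus r + edge_minus r) / 2%:R
  else - 'i%C * (edge_plus r - edge_minus r) / (2%:R * r)) =
  (if nu then (al * E + be * E^-1) / 2%:R else - 'i%C * (al * E - be * E^-1) / (2%:R * r)) * A
  + (if nu then be / 2%:R else - 'i%C * be / (2%:R * r)) * F r
  + (if nu then al / 2%:R else 'i%C * al / (2%:R * r)) * F (- r).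
  rewrite /edge_plus /edge_minus -/al -/be -/E; move: (al) (be) (F r) (F (- r)) => ? ? ? ?.
  by case: nu; field; rewrite ?r0 ?E0.
rewrite edge_combination; apply: eq_cintegral => t _.
rewrite /source mulrA; congr (_ * _).
pose e1 := expi r (1 - t); pose e2 := expi r (t - a + 1).
have EE : E = e1 * e2 by rewrite /E -expiD; congr expi; ring.
have KE : expi r (2 * t - a) = e2 * e1^-1 by rewrite -expiN -expiD; congr expi; ring.
have e10 : e1 != 0 by exact: expi_neq0.
have e20 : e2 != 0 by exact: expi_neq0.
rewrite S1_sqr S0_sqr// ccos_expi csin_expi KE EE -/e1.
case: nu; rewrite /= ?S1_sqr ?S0_sqr// ?ccos_expi ?csin_expi -/e2 /al /be.
  by field; rewrite ?e10 ?e20 ?r0.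
by field; rewrite ?e10 ?e20 ?r0.
Qed.

Lemma edge_plusE r : r != 0 ->
  edge_plus r = edge_form a true q h (r ^+ 2) + 'i%C * r * edge_form a false q h (r ^+ 2).
Proof.
move=> r0; rewrite !edge_form_plus_minus//.
set P := edge_plus r; set M := edge_minus r.
transitivity ((P + M) / 2%:R - 'i%C * 'i%C * (P - M) / 2%:R); first by rewrite mulcii; field.
by field.
Qed.

Lemma edge_form_bound : exists2 K : R, 0 <= K & forall r, 1 <= normc r ->
  normc (edge_form a true q h (r ^+ 2)) <= K * expR `|complex.Im r| /\
  normc (edge_form a false q h (r ^+ 2)) <= K * expR `|complex.Im r| / normc r.
Proof.
have N0 := edge_norm_ge0 a q; have A0 := normc_ge0 A; have h0 := normc_ge0 h.
pose K := (1 + normc h) / 2 * (normc A + 2 * edge_norm a q).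
exists (2 * K); first by rewrite mulr_ge0// mulr_ge0 ?divr_ge0 ?addr_ge0// mulr_ge0.
move=> r r1; have rn0 : 0 < normc r by lra.
have r0 : r != 0 by rewrite -normc_gt0.
set e := expR _; have e0 : 0 <= e by exact: expR_ge0.
have hr : normc ('i%C * h / r) <= normc h.
  by rewrite normcf normcM normci mul1r ler_pdivrMr// ler_peMr.
have al : normc ((1 - 'i%C * h / r) / 2%:R) <= (1 + normc h) / 2.
  rewrite normcf normc_nat ler_wpM2r ?invr_ge0// (le_trans (le_normcB _ _))//.
  by rewrite normc1 lerD2l.
have be : normc ((1 + 'i%C * h / r) / 2%:R) <= (1 + normc h) / 2.
  rewrite normcf normc_nat ler_wpM2r ?invr_ge0// (le_trans (le_normcD _ _))//.
  by rewrite normc1 lerD2l.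
have a2 : `|2 - a| <= 1 by have /andP[? ?] := a12; rewrite ler_norml; apply/andP; split; lra.
have a2' : `|- (2 - a)| <= 1 by rewrite normrN.
have Ea : normc (expi r (2 - a) * A) <= e * normc A.
  by rewrite normcM ler_wpM2r// normc_expi_le.
have Ea' : normc ((expi r (2 - a))^-1 * A) <= e * normc A.
  by rewrite -expiN normcM ler_wpM2r// normc_expi_le.
have Fr : normc (F r) <= 2 * (e * edge_norm a q) by exact: normc_edge_fourier.
have Fr' : normc (F (- r)) <= 2 * (e * edge_norm a q).
  have := normc_edge_fourier a12 iq (- r).
  by case: (r) @e e0 {Ea Ea' Fr al be hr r1 rn0 r0} => ? ? /=; rewrite normrN.
have P1 : normc (edge_plus r) <= K * e.
  rewrite /edge_plus (le_trans (le_normcD _ _))// !(normcM (_ / 2%:R)).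
  apply: le_trans (lerD (ler_pM (normc_ge0 _) (normc_ge0 _) al Ea) (ler_pM (normc_ge0 _) (normc_ge0 _) be Fr)) _.
  by apply: le_of_eq; rewrite /K; ring.
have P2 : normc (edge_minus r) <= K * e.
  rewrite /edge_minus (le_trans (le_normcD _ _))// !(normcM (_ / 2%:R)).
  apply: le_trans (lerD (ler_pM (normc_ge0 _) (normc_ge0 _) al Fr') (ler_pM (normc_ge0 _) (normc_ge0 _) be Ea')) _.
  by apply: le_of_eq; rewrite /K; ring.
have Ke : 0 <= K * e by exact: le_trans (normc_ge0 _) P1.
rewrite !edge_form_plus_minus//; split.
  rewrite normcf normc_nat ler_pdivrMr//.
  by have := le_normcD (edge_plus r) (edge_minus r); lra.
rewrite !normcf !normcM normcN normci mul1r normc_nat invfM mulrA.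
rewrite ler_wpM2r ?invr_ge0 ?normc_ge0// ler_pdivrMr//.
by have := le_normcB (edge_plus r) (edge_minus r); lra.
Qed.

(** Away from 0 the form is an explicit combination of exponentials. At 0 its
powers of 1 / rho cancel, which is read off from S_0 and S_1 instead. *)
Lemma punctured_edge_form nu :
  expands2_punctured (fun r => edge_form a nu q h (r ^+ 2)).
Proof.
split.
  move=> z z0; have nz : 0 < normc z by rewrite normc_gt0.
  apply: (@expands2_near _ _ (fun r => if nu then (edge_plus r + edge_minus r) * 2%:R^-1
    else - 'i%C * (edge_plus r + -1 * edge_minus r) * (2%:R^-1 * r^-1)) z (normc z / 2)).
  - by rewrite divr_gt0.
  - move=> w hz; have zh : z + w != 0.
      rewrite -normc_gt0; apply: lt_le_trans (le_normc_addr _ _); lra.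
    rewrite edge_form_plus_minus//; case: nu => //.
    by rewrite mulN1r invfM.
  have iz : expands2 (fun r : C => r^-1) z by apply: expands2V => //; exact: expands2_id.
  have cM (c : C) f : expands2 f z -> expands2 (fun r => c * f r) z.
    by move=> ef; apply: expands2M => //; exact: expands2_cst.
  have Mc f (c : C) : expands2 f z -> expands2 (fun r => f r * c) z.
    by move=> ef; apply: expands2M => //; exact: expands2_cst.
  have cD (c : C) f : expands2 f z -> expands2 (fun r => c + f r) z.
    by move=> ef; apply: expands2D => //; exact: expands2_cst.
  have eal : expands2 (fun r => (1 - 'i%C * h / r) / 2%:R) z.
    have -> : (fun r => (1 - 'i%C * h / r) / 2%:R) = (fun r => (1 + -1 * ('i%C * h * r^-1)) / 2%:R).
      by apply/funext => r; rewrite mulN1r.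
    by apply: (Mc (fun r => 1 + -1 * ('i%C * h * r^-1))); apply: (cD); apply: (cM); exact: cM.
  have ebe : expands2 (fun r => (1 + 'i%C * h / r) / 2%:R) z.
    by apply: (Mc (fun r => 1 + 'i%C * h * r^-1)); apply: (cD); exact: cM.
  have eE : expands2 (fun r => expi r (2 - a)) z by exact: expands2_expi.
  have eF w : expands2 F w by exact: expands2_edge_fourier.
  have ep : expands2 edge_plus z.
    apply: expands2D; apply: expands2M => //; exact: Mc.
  have em : expands2 edge_minus z.
    apply: expands2D; apply: expands2M => //; first by apply: expands2_opp.
    by apply: (Mc (fun r => (expi r (2 - a))^-1)); apply: expands2V => //; exact: expi_neq0.
  case: nu; first by apply: (Mc); exact: expands2D.
  apply: expands2M; first by apply: (cM); apply: expands2D => //; exact: cM.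
  exact: cM.
have [K1 K10 hK1] := Snu_near0 R true.
have [K0 K00 hK0] := Snu_near0 R false.
have [K K_0 hK] := Snu_near0 R nu.
have h0 := normc_ge0 h.
pose B := (K1 + normc h * K0) * (4 + K) + (1 + normc h * 4) * K.
have B0 : 0 <= B by rewrite /B addr_ge0// mulr_ge0// ?addr_ge0// mulr_ge0.
exists (2 * (B * edge_norm a q)), 4^-1; split => //.
  by rewrite !mulr_ge0// edge_norm_ge0.
move=> r r4; rewrite add0r [X in _ - edge_form _ _ _ _ X](_ : _ = 0) ?expr0n//.
pose P l t : C := S1 (1 - t) l + h * S0 (1 - t) l.
pose S l t : C := Snu nu (t - a + 1) l.
have cS (u : R -> C) : ccontinuous u -> ccontinuous (fun t => u (1 - t)).
  move=> cu; have -> : (fun t => u (1 - t)) = (fun t => u (-1 * t + 1)).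
    by apply/funext => t; congr u; ring.
  exact: ccontinuous_affine.
have cPS l : ccontinuous (fun t => P l t * S l t).
  apply: ccontinuousM; last exact: ccontinuous_Snu_shift.
  have c0 := cS _ (is_cderive_continuous (is_cderive_S0 l)).
  have c1 := cS _ (is_cderive_continuous (is_cderive_S1 l)).
  by apply: ccontinuousD => //; exact: ccontinuousZ.
have eP l : edge_form a nu q h l = cintegral `[0, 1] (fun t => P l t * S l t * cut a q t).
  by apply: eq_cintegral => t _; rewrite /source /P /S mulrA.
have -> : edge_form a nu q h (r ^+ 2) - edge_form a nu q h 0 =
    cintegral `[0, 1] (fun t => (P (r ^+ 2) t * S (r ^+ 2) t + -1 * (P 0 t * S 0 t)) * cut a q t).
  rewrite -(mulN1r (edge_form _ _ _ _ 0)) !eP -cintegralZ//; last exact: ic.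
  rewrite -cintegralD//; [|exact: ic|].
    by apply: eq_cintegral => t _; ring.
  by apply: cintegrableMc => //; [exact: ic | exact: ccontinuous_cst].
rewrite (_ : 2 * (B * _) * _ = 2 * (B * normc r * edge_norm a q)); last by ring.
apply: (normc_cintegral_cut iq).
  by apply: ccontinuousD => //; exact: ccontinuousZ.
move=> t t01 ta; have /andP[a1 a2] := a12.
have t4 : `|1 - t| <= 4 by rewrite ler_norml; apply/andP; split; lra.
have u4 : `|t - a + 1| <= 4 by rewrite ler_norml; apply/andP; split; lra.
have d1 := hK1 _ _ t4 r4; have d0 := hK0 _ _ t4 r4; have d := hK _ _ u4 r4.
rewrite /Snu S1_x0 in d1; rewrite /Snu S0_x0 in d0.
rewrite -/(S (r ^+ 2) t) -/(S 0 t) in d.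
have nr0 := normc_ge0 r; have nr1 : normc r <= 1 by lra.
have S04 : normc (S 0 t) <= 4.
  by rewrite /S /Snu; case: (nu); rewrite ?S1_x0 ?S0_x0 ?normc1 ?normc_real//; lra.
have Sr : normc (S (r ^+ 2) t) <= 4 + K.
  rewrite -(subrK (S 0 t) (S (r ^+ 2) t)) addrC (le_trans (le_normcD _ _))// lerD//.
  by rewrite (le_trans d)// ler_piMr.
have P0 : normc (P 0 t) <= 1 + normc h * 4.
  rewrite /P S1_x0 S0_x0 (le_trans (le_normcD _ _))// normc1 lerD2l normcM normc_real.
  by rewrite ler_wpM2l.
have dP : normc (P (r ^+ 2) t - P 0 t) <= (K1 + normc h * K0) * normc r.
  rewrite /P S1_x0 S0_x0.
  rewrite (_ : _ - _ = (S1 (1 - t) (r ^+ 2) - 1) + h * (S0 (1 - t) (r ^+ 2) - (1 - t)%:C)); last by ring.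
  rewrite (le_trans (le_normcD _ _))// [X in _ <= X]mulrDl lerD// normcM -mulrA.
  by rewrite ler_wpM2l.
rewrite (_ : _ + _ = (P (r ^+ 2) t - P 0 t) * S (r ^+ 2) t + P 0 t * (S (r ^+ 2) t - S 0 t)); last by ring.
rewrite (le_trans (le_normcD _ _))// !normcM.
apply: le_trans (lerD (ler_pM (normc_ge0 _) (normc_ge0 _) dP Sr) (ler_pM (normc_ge0 _) (normc_ge0 _) P0 d)) _.
by apply: le_of_eq; rewrite /B; ring.
Qed.

End EdgeFormRho.

(** * Domination near the zeros *)

Section Spectrum.
Variable R : realType.
Local Notation C := R[i].
Implicit Types (z w h : C).

Let K : numFieldType := R[i].

Lemma near_normc (z : K) (P : set K) : (\forall w \near z, P w) ->
  exists2 d : R, 0 < d & forall w, normc (w - z) < d -> P w.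
Proof.
move=> /nbhs_ballP[e /= e0 he]; exists (complex.Re e).
  by move: e0; rewrite ltcE => /andP[].
move=> w wz; apply: he; rewrite /ball /= normc_normr normc_distC.
move: e0; rewrite ltcE /= => /andP[/eqP ie _].
by rewrite ltcE /= ie eqxx.
Qed.

Lemma derivable_continuous_normc (g : K -> K) (z : K) : derivable g z 1 ->
  forall e : R, 0 < e -> exists2 d : R, 0 < d & forall w, normc (w - z) < d ->
    normc (g w - g z) < e.
Proof.
move=> /derivable1_diffP/differentiable_continuous cg e e0.
have e0C : 0 < e%:C :> C by rewrite ltcR.
have : \forall w \near z, `|g z - g w| < (e%:C : K).
  by move/cvgrPdist_lt : cg; apply.
move=> /near_normc[d d0 hd]; exists d => // w /hd.
by rewrite normc_normr ltcR normc_distC.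
Qed.

(** After division by (w - z)^k both functions have nonzero limits at z. *)
Lemma zero_of_order_dominated (f g : C -> C) z k :
  zero_of_order f z k -> zero_of_order g z k ->
  exists K d : R, [/\ 0 < d, 0 <= K & forall w, normc (w - z) < d ->
    normc (f w) <= K * normc (g w)].
Proof.
move=> [f1 f10 hf] [g1 g10 hg].
have [df df0 Hf] := near_normc hf; have [dg dg0 Hg] := near_normc hg.
have at0 (d : R) : 0 < d -> normc (z - z) < d by rewrite subrr normc0.
have [[cf _] [cg _]] := (Hf z (at0 _ df0), Hg z (at0 _ dg0)).
have ng : 0 < normc (g1 z) by rewrite normc_gt0.
have [d1 d10 H1] := derivable_continuous_normc cf ltr01.
have [d2 d20 H2] := derivable_continuous_normc cg (divr_gt0 ng (ltr0n R 2)).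
exists ((normc (f1 z) + 1) / (normc (g1 z) / 2)).
exists (Num.min (Num.min df dg) (Num.min d1 d2)); split.
- by rewrite !lt_min df0 dg0 d10.
- by rewrite divr_ge0 ?addr_ge0 ?divr_ge0 ?normc_ge0.
move=> w; rewrite !lt_min => /andP[/andP[wf wg] /andP[w1 w2]].
have [_ ->] := Hf _ wf; have [_ ->] := Hg _ wg; rewrite !normcM mulrCA.
rewrite ler_wpM2l ?normc_ge0// mulrAC ler_pdivlMr ?divr_gt0//.
apply: ler_pM; rewrite ?normc_ge0 ?divr_ge0 ?normc_ge0//.
  have := le_normcD (f1 z) (f1 w - f1 z); rewrite addrC subrK.
  have := H1 _ w1; lra.
have := le_normc_subr (g1 z) (g1 z - g1 w); rewrite subKr normc_distC.
have := H2 _ w2; lra.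
Qed.

Lemma zero_of_order_gt0 (f : C -> C) z k : zero_of_order f z k -> f z = 0 -> (0 < k)%N.
Proof.
move=> [g gz hf] fz; rewrite lt0n; apply/eqP => k0.
have [d d0 hd] := near_normc hf.
have := hd z; rewrite subrr normc0 => /(_ d0)[_]; rewrite fz k0 expr0 mul1r.
by move/esym/eqP; rewrite (negbTE gz).
Qed.

Variables (m : nat) (a : R) (q qt : 'I_m.-1 -> R -> C) (H : 'I_m.-1 -> C) (nu : bool).
Hypotheses (Lq : forall j, L2_01 (q j)) (injH : injective H).
Variable lam : nat -> C.
Hypotheses (spec_q : is_spectrum a q H nu lam) (spec_qt : is_spectrum a qt H nu lam).

(** Every zero of Delta is an eigenvalue, hence a member of the common
sequence, and so a zero of the other characteristic function of equal order. *)
Lemma Delta_dominated z : Delta a q H nu z = 0 ->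
  exists K d : R, [/\ 0 < d, 0 <= K & forall w, normc (w - z) < d ->
    normc (Delta a qt H nu w) <= K * normc (Delta a q H nu w)].
Proof.
move=> Dz; have ez := eigenvalue_of_Delta_eq0 Lq injH Dz.
have [k ok ck] := spec_q.2 _ ez.
have k0 := zero_of_order_gt0 ok Dz.
have [n /= ln] : [set n | lam n = z] !=set0.
  apply/set0P/negP => /eqP s0; move: ck; rewrite s0 card_eq_sym card_eq0.
  by move=> /eqP/seteqP[/(_ 0%N k0)].
have [k' ok' ck'] : exists2 k', zero_of_order (Delta a qt H nu) z k' &
    ([set n | lam n = z] #= `I_k')%card.
  by apply: spec_qt.2; rewrite -ln; exact: spec_qt.1.
have kk : k = k'.
  by apply/card_eq_II; apply: card_eq_trans ck'; exact: card_esym.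
by subst k'; exact: zero_of_order_dominated ok' ok.
Qed.

End Spectrum.

(** * Sine and cosine on large squares *)

Section SquareEstimates.
Variable R : realType.
Local Notation C := R[i].
Implicit Types (z w r : C) (x y : R).

Definition hcos y : R := (expR y + expR (- y)) / 2.
Definition hsin y : R := (expR y - expR (- y)) / 2.

Lemma hcos2B y : hcos y ^+ 2 - hsin y ^+ 2 = 1.
Proof.
have : expR y * expR (- y) = 1 by rewrite -expRD addrN expR0.
by rewrite /hcos /hsin => h; field: h.
Qed.

Lemma half_complex : (2%:R : C)^-1 = (2^-1 : R)%:C.
Proof. by rewrite rmorphV ?unitfE// rmorph_nat. Qed.

Lemma ccos_ReIm x y : ccos (x +i* y) = (cos x * hcos y) +i* (- (sin x * hsin y)).
Proof.
by rewrite /ccos half_complex /cexp /hcos /hsin; apply: complex_eqP; rewrite /= ?mulNr ?mul0r ?mul1r ?oppr0 ?add0r ?addr0 ?sub0r ?opprK ?cosN ?sinN; field.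
Qed.

Lemma csin_ReIm x y : csin (x +i* y) = (sin x * hcos y) +i* (cos x * hsin y).
Proof.
by rewrite csinE half_complex -cexpN /cexp /hcos /hsin; apply: complex_eqP; rewrite /= ?mulNr ?mul0r ?mul1r ?oppr0 ?add0r ?addr0 ?sub0r ?opprK ?cosN ?sinN; field.
Qed.

Lemma hsinN y : hsin (- y) = - hsin y.
Proof. by rewrite /hsin opprK; ring. Qed.

Lemma hsin_sqr_ge y : 1 <= `|y| -> (expR `|y| / 4) ^+ 2 <= hsin y ^+ 2.
Proof.
have pos t : 1 <= t -> (expR t / 4) ^+ 2 <= hsin t ^+ 2.
  move=> t1; have e2 := expR_ge1Dx t; have e0 := expR_gt0 t.
  have em : expR (- t) <= 1 by rewrite -[X in _ <= X]expR0 ler_expR; lra.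
  by rewrite lerXn2r ?nnegrE /hsin; lra.
have [y0|y0] := leP 0 y; first by rewrite ger0_norm//; exact: pos.
rewrite ltr0_norm// => y1; have := pos _ y1.
by rewrite hsinN sqrrN.
Qed.

Lemma hcos_ge y : expR `|y| / 2 <= hcos y.
Proof.
rewrite /hcos ler_wpM2r ?invr_ge0//; have e0 := expR_ge0 y; have e1 := expR_ge0 (- y).
have [y0|y0] := leP 0 y; first by rewrite ger0_norm//; lra.
rewrite ltr0_norm//; lra.
Qed.

Lemma hcos_sqr_ge y : (expR `|y| / 2) ^+ 2 <= hcos y ^+ 2.
Proof.
have e0 := expR_ge0 `|y|; have := hcos_ge y => h.
by rewrite lerXn2r ?nnegrE//; lra.
Qed.

Lemma hcos_sqr_ge1 y : 1 <= hcos y ^+ 2.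
Proof. by have := hcos2B y; have := sqr_ge0 (hsin y); lra. Qed.

Lemma sqr_normc_ccos x y : normc (ccos (x +i* y)) ^+ 2 = cos x ^+ 2 + hsin y ^+ 2.
Proof.
rewrite ccos_ReIm sqr_normcE -[complex.Re _]/(cos x * hcos y) -[complex.Im _]/(- (sin x * hsin y)).
have := hcos2B y; have := cos2Dsin2 x.
move: (hcos y) (hsin y) (cos x) (sin x) => p q c s h1 h2.
have s2 : s ^+ 2 = 1 - c ^+ 2 by lra.
by rewrite sqrrN !exprMn (_ : p ^+ 2 = 1 + q ^+ 2) ?s2; [ring | lra].
Qed.

Lemma sqr_normc_csin x y : normc (csin (x +i* y)) ^+ 2 = sin x ^+ 2 + hsin y ^+ 2.
Proof.
rewrite csin_ReIm sqr_normcE -[complex.Re _]/(sin x * hcos y) -[complex.Im _]/(cos x * hsin y).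
have := hcos2B y; have := cos2Dsin2 x.
move: (hcos y) (hsin y) (cos x) (sin x) => p q c s h1 h2.
have c2 : c ^+ 2 = 1 - s ^+ 2 by lra.
by rewrite !exprMn (_ : p ^+ 2 = 1 + q ^+ 2) ?c2; [ring | lra].
Qed.

Lemma growth_ge (t y : R) : 0 <= t -> 2^-1 <= t \/ 1 <= `|y| ->
  (expR `|y| / 4) ^+ 2 <= t + hsin y ^+ 2.
Proof.
move=> t0 [t1|y1]; last by have := hsin_sqr_ge y1; lra.
have := hcos_sqr_ge y; have := hcos_sqr_ge1 y; have := hcos2B y.
rewrite !exprMn; have := sqr_ge0 (expR `|y|); lra.
Qed.

Lemma normc_ccos_ge z : 2^-1 <= cos (complex.Re z) ^+ 2 \/ 1 <= `|complex.Im z| ->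
  expR `|complex.Im z| / 4 <= normc (ccos z).
Proof.
case: z => x y /= h; rewrite -(@ler_pXn2r _ 2) ?nnegrE ?normc_ge0 ?divr_ge0 ?expR_ge0//.
by rewrite sqr_normc_ccos; apply: growth_ge => //; exact: sqr_ge0.
Qed.

Lemma normc_csin_ge z : 2^-1 <= sin (complex.Re z) ^+ 2 \/ 1 <= `|complex.Im z| ->
  expR `|complex.Im z| / 4 <= normc (csin z).
Proof.
case: z => x y /= h; rewrite -(@ler_pXn2r _ 2) ?nnegrE ?normc_ge0 ?divr_ge0 ?expR_ge0//.
by rewrite sqr_normc_csin; apply: growth_ge => //; exact: sqr_ge0.
Qed.

(** Expanding the modulus, the claim is that Re ((c s^* )^2) <= 0 for
c = cos z, s = sin z; and c s^* = sin x cos x - i sinh y cosh y. *)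
Lemma normc_cos2_sin2_ge z (M : R) : 0 <= M ->
  sin (complex.Re z) = 0 \/ 1 <= `|complex.Im z| ->
  normc (ccos z) ^+ 2 <= normc (ccos z ^+ 2 - M%:C * csin z ^+ 2).
Proof.
case: z => x y M0; rewrite [complex.Re _]/= [complex.Im _]/= => h.
rewrite -(@ler_pXn2r _ 2) ?nnegrE ?normc_ge0 ?exprn_ge0 ?normc_ge0//.
have id (c1 c2 s1 s2 : R) : normc ((c1 +i* c2) ^+ 2 - M%:C * (s1 +i* s2) ^+ 2) ^+ 2 =
    (c1 ^+ 2 + c2 ^+ 2) ^+ 2 + 2 * M * ((c2 * s1 - c1 * s2) ^+ 2 - (c1 * s1 + c2 * s2) ^+ 2) +
    M ^+ 2 * (s1 ^+ 2 + s2 ^+ 2) ^+ 2.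
  by rewrite sqr_normcE !expr2 /=; ring.
set c1 := cos x * hcos y; set c2 := - (sin x * hsin y).
set s1 := sin x * hcos y; set s2 := cos x * hsin y.
rewrite ccos_ReIm csin_ReIm -/c1 -/c2 -/s1 -/s2 id sqr_normcE.
rewrite -[complex.Re _]/c1 -[complex.Im _]/c2.
have CS := hcos2B y; have cs := cos2Dsin2 x.
have P : c1 * s1 + c2 * s2 = sin x * cos x.
  by rewrite -[RHS]mulr1 -CS /c1 /c2 /s1 /s2; ring.
have Q : c2 * s1 - c1 * s2 = - (hsin y * hcos y).
  by rewrite -[RHS]mulr1 -cs /c1 /c2 /s1 /s2; ring.
rewrite P Q -addrA lerDl addr_ge0//; last by rewrite mulr_ge0 ?sqr_ge0.
rewrite !mulr_ge0// subr_ge0 sqrrN (exprMn 2 (sin x) (cos x)) (exprMn 2 (hsin y) (hcos y)).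
case: h => [->|y1]; first by rewrite expr0n /= mul0r mulr_ge0 ?sqr_ge0.
have h1 := hsin_sqr_ge y1; have h2 := hcos_sqr_ge1 y.
have e2 : 2 <= expR `|y| by have := expR_ge1Dx `|y|; lra.
have h3 : 4^-1 <= hsin y ^+ 2.
  apply: le_trans h1; rewrite (_ : 4^-1 = 2^-1 ^+ 2); last by field.
  by rewrite lerXn2r ?nnegrE; lra.
have h4 : 4^-1 <= hsin y ^+ 2 * hcos y ^+ 2.
  by rewrite -[X in X <= _]mulr1 ler_pM.
apply: le_trans h4.
have -> : sin x ^+ 2 = 1 - cos x ^+ 2 by lra.
have := sqr_ge0 (cos x ^+ 2 - 2^-1); lra.
Qed.

Lemma sin_cos_shift n x : sin (x + pi *+ n) ^+ 2 = sin x ^+ 2 /\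
  cos (x + pi *+ n) ^+ 2 = cos x ^+ 2.
Proof.
elim: n => [|n [IH1 IH2]]; first by rewrite mulr0n addr0.
by rewrite mulrSr addrA sinDpi cosDpi !sqrrN.
Qed.

(** Up to powers of cos rho, the leading term of Delta_0 is
cos^2 rho - M sin^2 rho, where M is the number of edges with a potential, and
that of Delta_1 is a multiple of rho sin rho; the bounds keep these away from 0,
together with v_{0,j} ~ cos rho. *)
Definition tame_point (nu : bool) z :=
  expR `|complex.Im z| / 4 <= normc (ccos z) /\
  (if nu return Prop then expR `|complex.Im z| / 4 <= normc (csin z)
   else forall M : R, 0 <= M -> normc (ccos z) ^+ 2 <= normc (ccos z ^+ 2 - M%:C * csin z ^+ 2)).

(** The squares have half side n pi for nu = 0 and n pi + pi / 4 for nu = 1: on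
the vertical sides sine and cosine of the real part are then known, and on the
horizontal ones |Im rho| >= 1. *)
Lemma tame_squares nu (B : R) : exists2 L, B <= L &
  forall z, on_square_boundary L z -> tame_point nu z.
Proof.
have pi1 : 1 <= pi :> R by have := pi_ge2 R; lra.
pose x0 : R := if nu then pi / 4 else 0.
have x00 : 0 <= x0 by rewrite /x0; case: (nu) => //; lra.
pose n := (Num.bound `|B|).+1.
pose L := x0 + pi *+ n.
have nL : n%:R <= L.
  rewrite /L -mulr_natr; have : (n%:R : R) <= pi * n%:R by rewrite ler_peMl.
  lra.
have n1 : 1 <= n%:R :> R by rewrite ler1n.
exists L.
  apply: le_trans nL; apply: le_trans (ler_norm _) _.
  by apply: ltW; apply: lt_le_trans (archi_boundP (normr_ge0 B)) _; rewrite ler_nat.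
have sc x : `|x| = L -> cos x ^+ 2 = cos x0 ^+ 2 /\ sin x ^+ 2 = sin x0 ^+ 2.
  move=> xL; have [<- <-] := sin_cos_shift n x0; rewrite -/L -xL.
  by have [x1|x1] := leP 0 x; [rewrite ger0_norm | rewrite ltr0_norm// cosN sinN sqrrN].
move=> z [_ zL].
have key : (cos (complex.Re z) ^+ 2 = cos x0 ^+ 2 /\ sin (complex.Re z) ^+ 2 = sin x0 ^+ 2)
    \/ 1 <= `|complex.Im z|.
  by case: zL => [/sc//|->]; [left | right; exact: le_trans n1 nL].
have x0T : nu -> cos x0 ^+ 2 = 2^-1 /\ sin x0 ^+ 2 = 2^-1.
  rewrite /x0 => ->; have c4 : cos (pi / 4 : R) ^+ 2 = 2^-1.
    have := cos_mulr2n (pi / 4 : R).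
    rewrite (_ : (pi / 4) *+ 2 = pi / 2); last by rewrite -mulr_natr; field.
    by rewrite cos_pihalf -[X in _ = X - _]mulr_natr; lra.
  by split=> //; have := cos2Dsin2 (pi / 4 : R); lra.
have x0F : ~~ nu -> cos x0 ^+ 2 = 1 /\ sin x0 ^+ 2 = 0.
  by rewrite /x0 => /negbTE ->; rewrite cos0 sin0 expr1n expr0n.
split.
  apply: normc_ccos_ge; case: key => [[-> _]|]; [left|by right].
  by case: (boolP nu) => [/x0T|/x0F] [-> _]; lra.
case: (boolP nu) => [/x0T|/x0F] [_ s0].
  by apply: normc_csin_ge; case: key => [[_ ->]|]; [left; rewrite s0|right].
move=> M M0; apply: normc_cos2_sin2_ge => //; case: key => [[_]|]; last by right.
by rewrite s0 => /eqP; rewrite sqrf_eq0 => /eqP; left.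
Qed.

End SquareEstimates.

(** * Lower bounds for the characteristic function on large squares *)

Lemma sumr_card (A : pzRingType) (I : finType) (x : A) :
  \sum_(i : I) x = #|I|%:R * x.
Proof. by rewrite sumr_const mulr_natl. Qed.

Section DeltaLowerBound.
Variable R : realType.
Local Notation C := R[i].
Variables (I : finType) (h : I -> C) (hM K : R).
Hypotheses (hM0 : 0 <= hM) (K0 : 0 <= K) (hle : forall j, normc (h j) <= hM).
Local Notation M := (#|I|%:R : R).

(** Delta is thus a sum of fractions, in which every edge is compared with its
own v_{0,j}. *)
Lemma factor_bordered (d : C) (X v : I -> C) : (forall j, v j != 0) ->
  d * \prod_j v j + \sum_j X j * \prod_(l | l != j) v l =
  (\prod_j v j) * (d + \sum_j X j / v j).
Proof.
move=> v0; rewrite mulrDr mulrC; congr (_ + _); rewrite mulr_sumr.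
by apply: eq_bigr => j _; rewrite [in RHS](bigD1 j)//= mulrC; field.
Qed.

Lemma normc_sum_le (F : I -> C) (B : R) : (forall j, normc (F j) <= B) ->
  normc (\sum_j F j) <= M * B.
Proof.
move=> FB; apply: le_trans (normc_sum _ _ _) _.
apply: (@le_trans _ _ (\sum_(j : I) B)); first by apply: ler_sum => j _.
by rewrite sumr_card.
Qed.

(** In the application r, c, s and e are rho, cos rho, sin rho and e^{|Im rho|},
and v j and W j are v_{0,j} and the contribution of the potential of an edge. *)
Variables (r c s : C) (e : R).
Hypotheses (e1 : 1 <= e) (cs : c ^+ 2 + s ^+ 2 = 1) (r0 : 0 < normc r).
Hypotheses (ce : normc c <= e) (se : normc s <= e) (ec : e / 4 <= normc c).
Hypothesis rh : 8 * hM <= normc r.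

Let v j := c + h j * (s / r).

Lemma normc_v_ge j : e / 8 <= normc (v j).
Proof.
apply: le_trans (le_normc_addr _ _).
have : normc (h j * (s / r)) <= e / 8.
  rewrite normcM normcf mulrA ler_pdivrMr//.
  apply: (@le_trans _ _ (hM * e)); first by rewrite ler_pM ?normc_ge0.
  have e0 : 0 <= e by move: e1; lra.
  have := ler_wpM2l e0 rh; lra.
by move: ec; lra.
Qed.

Lemma v_neq0 j : v j != 0.
Proof. by rewrite -normc_gt0; apply: lt_le_trans (normc_v_ge j); move: e1; lra. Qed.

Let c0 : c != 0.
Proof. by rewrite -normc_gt0; apply: lt_le_trans ec; move: e1; lra. Qed.

Let r_neq0 : r != 0. Proof. by rewrite -normc_gt0. Qed.

Lemma normc_div_v (X : C) (B : R) j : normc X <= B -> normc (X / v j) <= B * 8 / e.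
Proof.
have e0 : 0 < e by move: e1; lra.
have vg := normc_v_ge j; have v0 : 0 < normc (v j) by rewrite normc_gt0 v_neq0.
move=> XB; have B0 : 0 <= B by exact: le_trans (normc_ge0 X) XB.
rewrite normcf ler_pdivrMr//; apply: (le_trans XB).
apply: (@le_trans _ _ (B * 8 / e * (e / 8))).
  by apply: le_of_eq; field; rewrite gt_eqF.
by rewrite ler_wpM2l// divr_ge0 ?mulr_ge0// ltW.
Qed.

Variable W : I -> C.

(** By c^2 + s^2 = 1 the j-th summand is - r s up to a bounded term. *)
Lemma Delta1_lower : e / 4 <= normc s -> (forall j, normc (W j) <= K * e) ->
  64 * M * (hM + K) <= normc r ->
  e * normc r / 8 <=
    normc (- r * s + \sum_j (c * (- r * s + h j * c) + W j) / v j).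
Proof.
move=> es We rK; have e0 : 0 < e by move: e1; lra.
have -> : - r * s + \sum_j (c * (- r * s + h j * c) + W j) / v j =
    - ((1 + #|I|%:R) * (r * s)) + \sum_j (h j + W j) / v j.
  rewrite (eq_bigr (fun j => - (r * s) + (h j + W j) / v j)).
    rewrite big_split /= sumr_card; ring.
  move=> j _; have vj := v_neq0 j; apply: (mulIf vj).
  rewrite [RHS]mulrDl !divfK//.
  transitivity (c * (- r * s) + h j * c ^+ 2 + W j); first by ring.
  rewrite (_ : c ^+ 2 = 1 - s ^+ 2); last by rewrite -cs addrK.
  by rewrite /v; field.
have S1 : normc (\sum_j (h j + W j) / v j) <= M * ((hM + K) * 8).
  apply: normc_sum_le => j.
  have hW : normc (h j + W j) <= (hM + K) * e.
    rewrite (le_trans (le_normcD _ _))// mulrDl lerD//.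
    by apply: le_trans (hle j) _; rewrite ler_peMr.
  by apply: le_trans (normc_div_v j hW) _; rewrite mulrAC mulfK ?gt_eqF.
have S2 : normc r * (e / 4) <= normc ((1 + #|I|%:R) * (r * s) : C).
  rewrite !normcM (_ : 1 + #|I|%:R = (1 + #|I|)%:R); last by rewrite natrD.
  have e40 : 0 <= e / 4 by rewrite divr_ge0// ltW.
  rewrite normc_nat -[X in X <= _]mul1r; apply: ler_pM => //.
  - by rewrite mulr_ge0// normc_ge0.
  - by rewrite ler1n.
  - by apply: ler_pM; rewrite ?normc_ge0.
rewrite addrC; set T := \sum_j _ in S1 *; set U := _ * (r * s) in S2 *.
have := le_normc_subr U T; rewrite normc_distC => h1.
have : M * ((hM + K) * 8) <= normc r * e / 8.
  rewrite ler_pdivlMr//; apply: le_trans (ler_peMr (normc_ge0 r) e1).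
  by apply: le_trans rK; apply: le_of_eq; ring.
lra.
Qed.

(** By c^2 + s^2 = 1 the j-th summand is - s^2 / c up to O(1 / |r|). *)
Lemma Delta0_lower : normc c ^+ 2 <= normc (c ^+ 2 - M%:C * s ^+ 2) ->
  (forall j, normc (W j) <= K * e / normc r) ->
  256 * M * (hM + K) <= normc r ->
  e / 8 <= normc (c + \sum_j (s / r * (- r * s + h j * c) + W j) / v j).
Proof.
move=> csM We rK; have e0 : 0 < e by move: e1; lra.
have ceq : M%:C = #|I|%:R :> C by rewrite rmorph_nat.
have -> : c + \sum_j (s / r * (- r * s + h j * c) + W j) / v j =
    (c ^+ 2 - #|I|%:R * s ^+ 2) / c + \sum_j (h j * s / r + W j * c) / (v j * c).
  rewrite (eq_bigr (fun j => - (s ^+ 2 / c) + (h j * s / r + W j * c) / (v j * c))).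
    by rewrite big_split /= sumr_card; field.
  move=> j _; have vj := v_neq0 j; apply: (mulIf vj).
  rewrite [RHS]mulrDl divfK// invfM mulrA [X in _ = _ + X]mulrAC divfK//.
  transitivity (- (s ^+ 2 / c) * v j + (h j * s / r * (c ^+ 2 + s ^+ 2) + W j * c) / c).
    by rewrite /v; field; rewrite c0 r_neq0.
  by rewrite cs mulr1 mulrAC.
have S1 : normc (\sum_j (h j * s / r + W j * c) / (v j * c)) <= M * (32 * (hM + K) / normc r).
  apply: normc_sum_le => j.
  have hW : normc (h j * s / r + W j * c) <= (hM + K) * e ^+ 2 / normc r.
    rewrite (le_trans (le_normcD _ _))// !mulrDl lerD//.
      rewrite normcf normcM ler_wpM2r ?invr_ge0 ?normc_ge0//.
      rewrite ler_pM ?normc_ge0// (le_trans se)// expr2 ler_peMr// ltW//.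
    rewrite normcM (_ : K * e ^+ 2 / normc r = K * e / normc r * e); last by ring.
    by rewrite ler_pM ?normc_ge0.
  rewrite invfM mulrA; apply: (@le_trans _ _ ((hM + K) * e ^+ 2 / normc r * 8 / e * (4 / e))).
    rewrite normcM normcV ler_pM ?normc_ge0 ?invr_ge0 ?normc_ge0//; first exact: normc_div_v.
    by rewrite -[4 / e]invrK invf_div lef_pV2 ?posrE ?divr_gt0 ?normc_gt0.
  by apply: le_of_eq; field; rewrite !gt_eqF.
have S2 : e / 4 <= normc ((c ^+ 2 - #|I|%:R * s ^+ 2) / c).
  rewrite normcf ler_pdivlMr ?normc_gt0// -ceq; apply: le_trans csM.
  by rewrite expr2 ler_wpM2r ?normc_ge0.
set T := \sum_j _ in S1 *; set U := _ / c in S2 *.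
have h1 := le_normc_addr U T.
have : M * (32 * (hM + K) / normc r) <= e / 8.
  rewrite mulrA ler_pdivrMr// mulrAC ler_pdivlMr//.
  apply: le_trans (_ : normc r <= _); last by rewrite ler_peMl ?normc_ge0.
  by apply: le_trans rK; apply: le_of_eq; ring.
lra.
Qed.

End DeltaLowerBound.

Section Rho.
Variables (R : realType) (m : nat) (a : R).
Hypothesis a12 : 1 <= a < 2.
Local Notation C := R[i].
Variable H : 'I_m.-1 -> C.
Implicit Types (z w : C) (q : 'I_m.-1 -> R -> C) (nu : bool).
Local Notation edges := (#|'I_m.-1|%:R : R).

Let le14 : `|1 : R| <= 4. Proof. by rewrite normr1; lra. Qed.

Lemma punctured_sqr : expands2_punctured (fun z : C => z ^+ 2).
Proof. exact: puncturedM (punctured_id R) (punctured_id R). Qed.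

Lemma puncturedZ (c : C) (f : C -> C) : expands2_punctured f ->
  expands2_punctured (fun z => c * f z).
Proof. by move=> pf; apply: puncturedM => //; exact: punctured_cst. Qed.

Lemma punctured_S0 : expands2_punctured (fun z : C => S0 1 (z ^+ 2)).
Proof. exact: (punctured_Snu false le14). Qed.

Lemma punctured_S1 : expands2_punctured (fun z : C => S1 1 (z ^+ 2)).
Proof. exact: (punctured_Snu true le14). Qed.

Lemma punctured_dS1 : expands2_punctured (fun z : C => - z ^+ 2 * S0 1 (z ^+ 2)).
Proof.
have -> : (fun z : C => - z ^+ 2 * S0 1 (z ^+ 2)) = (fun z => -1 * z ^+ 2 * S0 1 (z ^+ 2)).
  by apply/funext => z; rewrite mulN1r.
by apply: puncturedM; [apply: puncturedZ; exact: punctured_sqr | exact: punctured_S0].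
Qed.

Lemma punctured_dSnu nu : expands2_punctured (fun z : C => dSnu nu 1 (z ^+ 2)).
Proof. by case: nu; [exact: punctured_dS1 | exact: punctured_S1]. Qed.

Lemma punctured_v nu j : expands2_punctured (fun z : C => v H nu j (z ^+ 2)).
Proof.
case: nu.
  have -> : (fun z : C => v H true j (z ^+ 2)) =
      (fun z => - z ^+ 2 * S0 1 (z ^+ 2) + H j * S1 1 (z ^+ 2)).
    by apply/funext => z; rewrite v_true.
  by apply: puncturedD; [exact: punctured_dS1|apply: puncturedZ; exact: punctured_S1].
have -> : (fun z : C => v H false j (z ^+ 2)) =
    (fun z => S1 1 (z ^+ 2) + H j * S0 1 (z ^+ 2)).
  by apply/funext => z; rewrite v_false.
by apply: puncturedD; [exact: punctured_S1|apply: puncturedZ; exact: punctured_S0].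
Qed.

Lemma punctured_Delta q nu : (forall j, cintegrable `]0, 1[ (q j)) ->
  expands2_punctured (fun z => Delta a q H nu (z ^+ 2)).
Proof.
move=> iq.
have -> : (fun z => Delta a q H nu (z ^+ 2)) = (fun z =>
    dSnu nu 1 (z ^+ 2) * \prod_j v H false j (z ^+ 2) +
    \sum_j (Snu nu 1 (z ^+ 2) * v H true j (z ^+ 2) + edge_form a nu (q j) (H j) (z ^+ 2)) *
      \prod_(k | k != j) v H false k (z ^+ 2)).
  by apply/funext => z; rewrite DeltaE.
apply: puncturedD.
  apply: puncturedM; first exact: punctured_dSnu.
  by apply: (@punctured_prod R _ _ _ (fun j z => v H false j (z ^+ 2))) => j; exact: punctured_v.
apply: (@punctured_sum R _ _ _ (fun j z => (Snu nu 1 (z ^+ 2) * v H true j (z ^+ 2) +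
    edge_form a nu (q j) (H j) (z ^+ 2)) * \prod_(k | k != j) v H false k (z ^+ 2))) => j.
apply: puncturedM; last first.
  by apply: (@punctured_prod R _ _ _ (fun j z => v H false j (z ^+ 2))) => k; exact: punctured_v.
apply: puncturedD; last exact: punctured_edge_form.
by apply: puncturedM; [exact: punctured_Snu | exact: punctured_v].
Qed.

Lemma edge_form_bound_all q : (forall j, cintegrable `]0, 1[ (q j)) ->
  exists2 K : R, 0 <= K & forall j z, 1 <= normc z ->
    normc (edge_form a true (q j) (H j) (z ^+ 2)) <= K * expR `|complex.Im z| /\
    normc (edge_form a false (q j) (H j) (z ^+ 2)) <= K * expR `|complex.Im z| / normc z.
Proof.
move=> iq.
have [K K0 hK] := fin_all_exists2 (fun j => edge_form_bound a12 (iq j) (H j)).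
exists (\sum_j K j); first by apply: sumr_ge0 => j _.
move=> j z z1; have [h1 h2] := hK j z z1.
have Kj : K j <= \sum_j K j by rewrite (bigD1 j)//= lerDl sumr_ge0.
split.
  by apply: le_trans h1 _; rewrite ler_wpM2r ?expR_ge0.
by apply: le_trans h2 _; rewrite ler_wpM2r ?invr_ge0 ?normc_ge0// ler_wpM2r ?expR_ge0.
Qed.

Lemma normc_H_bound j : normc (H j) <= \sum_j normc (H j).
Proof. by rewrite (bigD1 j)//= lerDl sumr_ge0// => k _; exact: normc_ge0. Qed.

Lemma expR_norm_ge1 (y : R) : 1 <= expR `|y|.
Proof. by rewrite -[X in X <= _]expR0 ler_expR. Qed.

Lemma v_falseE j z : z != 0 -> v H false j (z ^+ 2) = ccos z + H j * (csin z / z).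
Proof. by move=> z0; rewrite v_false S1_sqr S0_sqr// rmorph1 mulr1. Qed.

Lemma v_trueE j z : z != 0 -> v H true j (z ^+ 2) = - z * csin z + H j * ccos z.
Proof.
move=> z0; rewrite v_true S1_sqr S0_sqr// rmorph1 mulr1.
by congr (_ + _); field.
Qed.

Lemma Delta_factored q nu z : (forall j, cintegrable `]0, 1[ (q j)) -> z != 0 ->
  (forall j, v H false j (z ^+ 2) != 0) ->
  Delta a q H nu (z ^+ 2) = (\prod_j v H false j (z ^+ 2)) *
    (if nu then - z * csin z + \sum_j (ccos z * (- z * csin z + H j * ccos z) +
        edge_form a nu (q j) (H j) (z ^+ 2)) / v H false j (z ^+ 2)
     else ccos z + \sum_j (csin z / z * (- z * csin z + H j * ccos z) +
        edge_form a nu (q j) (H j) (z ^+ 2)) / v H false j (z ^+ 2)).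
Proof.
move=> iq z0 v0; rewrite DeltaE// factor_bordered//; congr (_ * _).
have e0 : S0 1 (z ^+ 2) = csin z / z by rewrite S0_sqr// rmorph1 mulr1.
have e1 : S1 1 (z ^+ 2) = ccos z by rewrite S1_sqr rmorph1 mulr1.
case: nu; rewrite /dSnu /Snu ?e1 ?e0.
  congr (_ + _); first by field.
  by apply: eq_bigr => j _; rewrite v_trueE.
by congr (_ + _); apply: eq_bigr => j _; rewrite v_trueE.
Qed.

Lemma v_false_ge j z : tame_point false z \/ tame_point true z ->
  8 * \sum_j normc (H j) <= normc z -> 0 < normc z ->
  expR `|complex.Im z| / 8 <= normc (v H false j (z ^+ 2)).
Proof.
move=> tz rh z0; have zn : z != 0 by rewrite -normc_gt0.
rewrite v_falseE//; apply: (normc_v_ge normc_H_bound (expR_norm_ge1 _)) => //.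
- exact: normc_csin.
- by case: tz => -[].
Qed.

Variables (q qt : 'I_m.-1 -> R -> C) (nu : bool).
Hypotheses (iq : forall j, cintegrable `]0, 1[ (q j)).
Hypotheses (iqt : forall j, cintegrable `]0, 1[ (qt j)).

(** The forms of the potentials are smaller than the leading term of Delta by a
factor of order rho. *)
Lemma Delta_difference_small (eps : R) : 0 < eps -> exists B : R, forall z,
  B <= normc z -> tame_point nu z ->
  normc (Delta a qt H nu (z ^+ 2) + -1 * Delta a q H nu (z ^+ 2)) <=
    eps * normc (Delta a q H nu (z ^+ 2)).
Proof.
move=> eps0.
have [K K0 hK] := edge_form_bound_all iq.
have [Kt Kt0 hKt] := edge_form_bound_all iqt.
set hM := \sum_j normc (H j).
have hM0 : 0 <= hM by apply: sumr_ge0 => j _; exact: normc_ge0.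
have M0 : 0 <= edges by exact: ler0n.
pose N := edges * (K + Kt) * 64 / eps.
have N0 : 0 <= N by rewrite /N divr_ge0 ?mulr_ge0 ?addr_ge0// ltW.
have hK0 : 0 <= edges * (hM + K) by rewrite mulr_ge0// addr_ge0.
exists (1 + 8 * hM + 256 * edges * (hM + K) + N) => z zB tz.
have z1 : 1 <= normc z by apply: le_trans zB; lra.
have zh : 8 * hM <= normc z by apply: le_trans zB; lra.
have zK : 256 * edges * (hM + K) <= normc z by apply: le_trans zB; lra.
have zK' : 64 * edges * (hM + K) <= normc z by apply: le_trans zK; lra.
have zN : N <= normc z by apply: le_trans zB; lra.
have nz : 0 < normc z by lra.
have z0 : z != 0 by rewrite -normc_gt0.
set e := expR `|complex.Im z|; have e1 : 1 <= e by exact: expR_norm_ge1.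
have [ec tz2] := tz.
have se : normc (csin z) <= e by exact: normc_csin.
have ce : normc (ccos z) <= e by exact: normc_ccos.
have cs := ccos2Dsin2 z.
have v0 j : v H false j (z ^+ 2) != 0.
  by rewrite v_falseE//; exact: (v_neq0 normc_H_bound e1 nz se ec zh).
rewrite !Delta_factored//; set P := \prod_j _.
pose W j := edge_form a nu (q j) (H j) (z ^+ 2).
pose Wt j := edge_form a nu (qt j) (H j) (z ^+ 2).
set D := (X in _ <= eps * normc (P * X)).
set Dt := (X in P * X + _).
have -> : P * Dt + -1 * (P * D) = P * \sum_j (Wt j - W j) / v H false j (z ^+ 2).
  rewrite (_ : \sum_j _ = Dt - D); first by ring.
  by rewrite /Dt /D; case: (nu) @W @Wt => W Wt;
    rewrite opprD addrACA subrr add0r -sumrB; apply: eq_bigr => j _; rewrite -mulrBl opprD addrACA subrr add0r.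
rewrite !normcM [X in _ <= X]mulrCA ler_wpM2l ?normc_ge0//.
have main (B : R) : (forall j, normc (Wt j - W j) <= B) ->
    normc (\sum_j (Wt j - W j) / v H false j (z ^+ 2)) <= edges * (B * 8 / e).
  move=> WB; apply: normc_sum_le => j; rewrite v_falseE//.
  exact: (normc_div_v normc_H_bound e1 nz se ec zh).
have e0 : 0 < e by lra.
have NE : edges * (K + Kt) * 64 <= eps * normc z by move: zN; rewrite /N ler_pdivrMr// [normc z * eps]mulrC.
have Dge : (if nu then e * normc z / 8 else e / 8) <= normc D.
  rewrite /D; under eq_bigr do rewrite v_falseE//.
  move: tz2 @W @Wt {main D Dt tz}; case: (nu) => tz2 W Wt.
    apply: (Delta1_lower (K := K) hM0 normc_H_bound e1 cs nz se ec zh) => //.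
    by move=> j; have [] := hK j z z1.
  under eq_bigr do rewrite v_falseE//.
  apply: (Delta0_lower (K := K) normc_H_bound e1 cs nz ce se ec zh) => //.
    exact: tz2.
  by move=> j; have [_] := hK j z z1.
case: (nu) @W @Wt main Dge => W Wt main Dge.
  apply: le_trans (main ((K + Kt) * e) _) _.
    move=> j; have [h1 _] := hK j z z1; have [h2 _] := hKt j z z1.
    by rewrite mulrDl [X in _ <= X]addrC (le_trans (le_normcB _ _))// lerD.
  apply: le_trans (_ : eps * (e * normc z / 8) <= _); last by rewrite ler_wpM2l// ltW.
  rewrite (_ : (K + Kt) * e * 8 / e = (K + Kt) * 8); last by field; rewrite gt_eqF.
  have := ler_wpM2r (ltW e0) NE.
  have : 0 <= edges * (K + Kt) by rewrite mulr_ge0// addr_ge0.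
  move=> x0; have := ler_wpM2l x0 e1; lra.
apply: le_trans (main ((K + Kt) * e / normc z) _) _.
  move=> j; have [_ h1] := hK j z z1; have [_ h2] := hKt j z z1.
  by rewrite !mulrDl [X in _ <= X]addrC (le_trans (le_normcB _ _))// lerD.
apply: le_trans (_ : eps * (e / 8) <= _); last by rewrite ler_wpM2l// ltW.
rewrite (_ : _ * (_ * 8 / e) = edges * (K + Kt) * 8 / normc z); last by field; rewrite !gt_eqF.
rewrite ler_pdivrMr//.
have x0 : 0 <= eps * normc z by rewrite mulr_ge0// ltW.
have := ler_wpM2l x0 e1; lra.
Qed.

End Rho.

(** * Equality of the characteristic functions and separation of the edges *)

Section Separation.
Variables (R : realType) (m : nat) (a : R).
Hypothesis a12 : 1 <= a < 2.
Local Notation C := R[i].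
Variables (H : 'I_m.-1 -> C) (q qt : 'I_m.-1 -> R -> C).
Hypotheses (injH : injective H) (Lq : forall j, L2_01 (q j)) (Lqt : forall j, L2_01 (qt j)).
Implicit Types (z w : C).

Let iq j : cintegrable `]0, 1[ (q j). Proof. exact: L2_integrable. Qed.
Let iqt j : cintegrable `]0, 1[ (qt j). Proof. exact: L2_integrable. Qed.

Lemma sqr_near z (d : R) : 0 < d -> exists2 r : R, 0 < r &
  forall h, normc h <= r -> normc ((z + h) ^+ 2 - z ^+ 2) < d.
Proof.
move=> d0; have z1 : 0 < 2 * normc z + 1.
  by rewrite ltr_wpDl// mulr_ge0// normc_ge0.
exists (Num.min 1 (d / (2 * (2 * normc z + 1)))).
  by rewrite lt_min ltr01 divr_gt0// mulr_gt0.
move=> h; rewrite le_min => /andP[h1]; rewrite ler_pdivlMr ?mulr_gt0// => hd.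
rewrite (_ : _ - _ = h * (2%:R * z + h)); last by ring.
rewrite normcM; apply: (@le_lt_trans _ _ (normc h * (2 * normc z + 1))).
  rewrite ler_wpM2l ?normc_ge0// (le_trans (le_normcD _ _))// lerD//.
  by rewrite normcM normc_nat.
by lra.
Qed.

(** Delta for qt, divided by Delta for q, is entire by Delta_dominated and tends
to 1 on large squares. *)
Lemma Delta_agree nu (lam : nat -> C) :
  is_spectrum a q H nu lam -> is_spectrum a qt H nu lam ->
  forall z, Delta a qt H nu (z ^+ 2) = Delta a q H nu (z ^+ 2).
Proof.
move=> sq sqt z; apply/eqP; rewrite -subr_eq0 -mulN1r; apply/eqP.
have pD := punctured_Delta a12 H nu iq; have pDt := punctured_Delta a12 H nu iqt.
apply: (punctured_liouville0 (puncturedD pDt (puncturedZ (-1) pD)) pD).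
  move=> w Dw; have [K [d [d0 K0 hd]]] := Delta_dominated Lq injH sq sqt Dw.
  have [r r0 hr] := sqr_near w d0.
  exists (K + 1), r; split => //; first exact: addr_ge0.
  move=> h /hr/hd hK; rewrite (le_trans (le_normcD _ _))// mulrDl lerD//.
  by rewrite normcM normcN normc1.
move=> e B e0; have [B0 hB0] := Delta_difference_small a12 H nu iq iqt e0.
have [L BL hL] := tame_squares nu (Num.max B B0).
move: BL; rewrite ge_max => /andP[BL BL0]; exists L => // w wL.
by apply: hB0; [exact: le_trans BL0 (on_square_boundary_normc wL) | exact: hL].
Qed.

Lemma edge_formB nu (f g : R -> C) h l : cintegrable `]0, 1[ f -> cintegrable `]0, 1[ g ->
  edge_form a nu (fun t => f t - g t) h l = edge_form a nu f h l - edge_form a nu g h l.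
Proof.
move=> fi gi; rewrite !edge_formE//; last first.
  have := cintegrableD (measurable_itv _) fi (cintegrableMc (measurable_itv _) _ gi (ccontinuous_cst (-1))).
  move=> h1; have {h1} := h1 (ltac:(move=> t /=; rewrite !in_itv /= => /andP[? ?]; apply/andP; split; lra)).
  by congr (cintegrable _ _); apply/funext => t; rewrite mulN1r.
have is_f := cintegrable_source a nu l fi; have is_g := cintegrable_source a nu l gi.
have lin u : ccontinuous u -> cprimitive (fun t => u t * source a nu (fun t => f t - g t) l t) 1 =
    cprimitive (fun t => u t * source a nu f l t) 1 - cprimitive (fun t => u t * source a nu g l t) 1.
  move=> cu; rewrite -mulN1r -cprimitiveZ//; [|lra|exact: cintegrable04M].
  rewrite -cprimitiveD//; [|lra|exact: cintegrable04M|].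
    by apply: eq_cintegral => t _; rewrite /source cutB; ring.
  by apply: cintegrable04M; [exact: ccontinuous_cst | exact: cintegrable04M].
have c0 := is_cderive_continuous (is_cderive_S0 l).
have c1 := is_cderive_continuous (is_cderive_S1 l).
rewrite /particular /dparticular (lin _ c0) (lin _ c1); ring.
Qed.

Definition difference j t : C := qt j t - q j t.

Lemma difference_integrable j : cintegrable `]0, 1[ (difference j).
Proof.
apply: L2_integrable; have := L2_add (Lqt j) (L2_mul (ccontinuous_cst (-1)) (Lq j)).
by congr L2_01; apply/funext => t; rewrite mulN1r.
Qed.

(** Delta is affine in the potentials, so that only the forms of the differences
survive when two characteristic functions are subtracted. *)
Lemma sum_edge_forms nu z :
  Delta a qt H nu (z ^+ 2) = Delta a q H nu (z ^+ 2) ->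
  \sum_j edge_form a nu (difference j) (H j) (z ^+ 2) *
    \prod_(l | l != j) v H false l (z ^+ 2) = 0.
Proof.
rewrite !DeltaE// => /addrI /eqP; rewrite -subr_eq0 -sumrB => /eqP e.
by apply: etrans e; apply: eq_bigr => j _; rewrite edge_formB//; ring.
Qed.

(** Where v_j vanishes the other v_l do not, because the H_l are distinct;
this separates the edges in the identity of sum_edge_forms. *)
Lemma edge_form_dominated nu j :
  (forall z, Delta a qt H nu (z ^+ 2) = Delta a q H nu (z ^+ 2)) ->
  locally_dominated (fun z => edge_form a nu (difference j) (H j) (z ^+ 2))
    (fun z => v H false j (z ^+ 2)).
Proof.
move=> DD z vz.
pose A w := \prod_(l | l != j) v H false l (w ^+ 2).
pose B w := \sum_(i | i != j) edge_form a nu (difference i) (H i) (w ^+ 2) *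
  \prod_(l | (l != i) && (l != j)) v H false l (w ^+ 2).
have pA : expands2_punctured A.
  by apply: (@punctured_prod R _ _ _ (fun l w => v H false l (w ^+ 2))) => l; exact: punctured_v.
have pB : expands2_punctured B.
  apply: (@punctured_sum R _ _ _ (fun i w => edge_form a nu (difference i) (H i) (w ^+ 2) *
    \prod_(l | (l != i) && (l != j)) v H false l (w ^+ 2))) => i.
  apply: puncturedM; first by apply: punctured_edge_form => //; exact: difference_integrable.
  by apply: (@punctured_prod R _ _ _ (fun l w => v H false l (w ^+ 2))) => l; exact: punctured_v.
have id w : edge_form a nu (difference j) (H j) (w ^+ 2) * A w = - (v H false j (w ^+ 2) * B w).
  apply/eqP; rewrite -addr_eq0; apply/eqP; rewrite -[RHS](sum_edge_forms (DD w)).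
  rewrite [in RHS](bigD1 j)//=; congr (_ + _); rewrite /B mulr_sumr.
  apply: eq_bigr => i ij; rewrite [in RHS](bigD1 j)//= 1?eq_sym//.
  by rewrite mulrCA.
have A0 : A z != 0.
  by apply/prodf_neq0 => l lj; apply: contra lj => /eqP vl; apply/eqP; exact: (v_false_eq0_inj injH vl vz).
have [r r0 hr] := lipschitz_at_neq0 (punctured_lipschitz z pA) A0.
have [b [s [s0 b0 hs]]] := lipschitz_at_bounded (punctured_lipschitz z pB).
have A2 : 0 < normc (A z) / 2 by rewrite divr_gt0// normc_gt0.
exists (b / (normc (A z) / 2)), (Num.min r s); split.
- by rewrite lt_min r0.
- by rewrite divr_ge0// ltW.
move=> h; rewrite le_min => /andP[h1 h2].
rewrite mulrAC ler_pdivlMr//.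
apply: (@le_trans _ _ (normc (edge_form a nu (difference j) (H j) ((z + h) ^+ 2)) * normc (A (z + h)))).
  by rewrite ler_wpM2l ?normc_ge0// hr.
by rewrite -normcM id normcN normcM mulrC ler_wpM2r ?normc_ge0// hs.
Qed.

Lemma edge_form_vs_v j : exists2 K : R, 0 <= K & forall z, 1 <= normc z ->
  8 * \sum_l normc (H l) <= normc z -> tame_point false z ->
  normc (edge_form a true (difference j) (H j) (z ^+ 2)) <= K * normc (v H false j (z ^+ 2)) /\
  normc (edge_form a false (difference j) (H j) (z ^+ 2)) <=
    K / normc z * normc (v H false j (z ^+ 2)).
Proof.
have [K K0 hK] := edge_form_bound a12 (difference_integrable j) (H j).
exists (8 * K); first exact: mulr_ge0.
move=> z z1 zh tz; have nz : 0 < normc z by lra.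
have vg := v_false_ge j (or_introl tz) zh nz.
have [h1 h2] := hK z z1; have Kv := ler_wpM2l K0 vg.
split; first by lra.
apply: le_trans h2 _; rewrite [X in _ <= X]mulrAC ler_wpM2r ?invr_ge0 ?normc_ge0//.
lra.
Qed.

(** The quotient of the form by v_{0,j} is entire and O(1 / rho) on large squares
for nu = 0; for nu = 1 it is only bounded, hence constant. *)
Lemma edge_form_false_eq0 j :
  (forall z, Delta a qt H false (z ^+ 2) = Delta a q H false (z ^+ 2)) ->
  forall z, edge_form a false (difference j) (H j) (z ^+ 2) = 0.
Proof.
move=> DD z; have id_ := difference_integrable j.
apply: (punctured_liouville0 (punctured_edge_form a12 id_ (H j) false)
  (punctured_v H false j) (edge_form_dominated (j := j) DD)).
move=> e B e0; have [K K0 hK] := edge_form_vs_v j.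
have hM : 0 <= \sum_l normc (H l) by apply: sumr_ge0 => l _; exact: normc_ge0.
have [L BL hL] := tame_squares false (Num.max B (1 + 8 * (\sum_l normc (H l)) + K / e)).
move: BL; rewrite ge_max => /andP[BL BL0]; exists L => // w wL.
have wn := le_trans BL0 (on_square_boundary_normc wL).
have Ke : 0 <= K / e by rewrite divr_ge0// ltW.
have [||_ h] := hK w _ _ (hL w wL); [lra|lra|].
apply: le_trans h _; rewrite ler_wpM2r ?normc_ge0// ler_pdivrMr; last lra.
by rewrite mulrC -ler_pdivrMr//; lra.
Qed.

Lemma edge_form_true_multiple j :
  (forall z, Delta a qt H true (z ^+ 2) = Delta a q H true (z ^+ 2)) ->
  exists c, forall z, z != 0 ->
    edge_form a true (difference j) (H j) (z ^+ 2) = c * v H false j (z ^+ 2).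
Proof.
move=> DD; have id_ := difference_integrable j.
have [K K0 hK] := edge_form_vs_v j.
have hM : 0 <= \sum_l normc (H l) by apply: sumr_ge0 => l _; exact: normc_ge0.
have sq (B : R) : exists2 L, Num.max B (1 + 8 * (\sum_l normc (H l))) <= L &
    forall z, on_square_boundary L z -> tame_point false z.
  exact: tame_squares.
have sqn (B L : R) z : Num.max B (1 + 8 * (\sum_l normc (H l))) <= L ->
    on_square_boundary L z -> 1 <= normc z /\ 8 * (\sum_l normc (H l)) <= normc z.
  rewrite ge_max => /andP[_ BL] zL.
  have := le_trans BL (on_square_boundary_normc zL); split; lra.
have [L0 BL0 hL0] := sq 0.
have L0_ge : 0 <= L0 by apply: le_trans BL0; rewrite le_max lexx.
have z0L : on_square_boundary L0 L0%:C.
  by split; [split; rewrite /= ?normr0// ger0_norm|left; rewrite /= ger0_norm].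
have [z01 z0h] := sqn _ _ _ BL0 z0L.
have nz0 : 0 < normc (L0%:C : C) by lra.
apply: (punctured_liouville (M := K) (punctured_edge_form a12 id_ (H j) true)
  (punctured_v H false j) (edge_form_dominated (j := j) DD) (z0 := L0%:C)) => //.
- by rewrite -normc_gt0.
- rewrite -normc_gt0; apply: lt_le_trans (v_false_ge j (or_introl (hL0 _ z0L)) z0h nz0).
  by rewrite divr_gt0// expR_gt0.
move=> B; have [L BL hL] := sq B; exists L; first by move: BL; rewrite ge_max => /andP[].
move=> w wL; have [w1 wh] := sqn _ _ _ BL wL.
by have [] := hK w w1 wh (hL w wL).
Qed.

End Separation.

(** * Functions with vanishing exponential moments *)

Section ExponentialMoments.
Variable R : realType.
Local Notation mu := (@lebesgue_measure R).
Implicit Types (f g : R -> R) (x t y : R).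

Let sub01 : `[0, 1] `<=` (`[-4, 4] : set R) := @itv01_sub R.

Lemma Rdominated_cvg (D : set R) (f_ : nat -> R -> R) f g : measurable D ->
  (forall n, mu.-integrable D (EFin \o f_ n)) -> measurable_fun D f ->
  {ae mu, forall x, D x -> f_ ^~ x @ \oo --> f x} ->
  mu.-integrable D (EFin \o g) -> (forall n x, D x -> `|f_ n x| <= g x) ->
  (\int[mu]_(x in D) f_ n x) @[n --> \oo] --> \int[mu]_(x in D) f x.
Proof.
move=> mD if_ mf cf ig fg.
have [||||fi _ cvg] := @dominated_convergence _ _ R mu D mD (fun n => EFin \o f_ n)
  (EFin \o f) (EFin \o g) _ _ _ ig _.
- by move=> n; exact: measurable_int (if_ n).
- exact/measurable_EFinP.
- move: cf => [N [mN N0 sub]]; exists N; split => // x nQ; apply: sub => h; apply: nQ => Dx.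
  by apply: cvg_EFin; [exact: nearW | exact: h].
- by apply: aeW => x n Dx /=; rewrite lee_fin fg.
rewrite /Rintegral; apply: fine_cvg; rewrite fineK//.
exact: integrable_fin_num.
Qed.

Lemma Rintegrable01_mul g f : mu.-integrable `[0, 1] (EFin \o g) -> continuous f ->
  mu.-integrable `[0, 1] (EFin \o (fun t => f t * g t)).
Proof. by move=> gi cf; apply: integrable_mul_bounded. Qed.

Lemma continuous_expR_affine (k b : R) : continuous (fun t : R => expR (k * t + b)).
Proof.
move=> t; apply: (@continuous_comp _ _ _ (fun t => k * t + b) expR).
  by apply: cvgD; [apply: cvgM; [exact: cvg_cst|exact: cvg_id]|exact: cvg_cst].
exact: continuous_expR.
Qed.

Lemma continuous_gumbel_coeff (k b : R) n :
  continuous (fun t => exp_coeff (- expR (k * t + b)) n).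
Proof.
move=> t; rewrite /exp_coeff /=; apply: cvgM; last exact: cvg_cst.
apply: (@continuous_comp _ _ _ (fun t => - expR (k * t + b)) (fun y : R => y ^+ n));
  last exact: exprn_continuous.
by apply: cvgN; exact: continuous_expR_affine.
Qed.

Lemma continuous_gumbel_sum (k b : R) n :
  continuous (fun t => \sum_(0 <= i < n) exp_coeff (- expR (k * t + b)) i.+1).
Proof.
elim: n => [|n IH].
  by under eq_fun do rewrite big_nil; exact: cst_continuous.
under eq_fun do rewrite big_nat_recr//=.
by move=> t; apply: cvgD; [exact: IH | exact: continuous_gumbel_coeff].
Qed.

Lemma series_exp_coeff_le y n : 0 <= y -> series (exp_coeff y) n <= expR y.
Proof.
move=> y0; apply: nondecreasing_cvgn_le; last exact: is_cvg_series_exp_coeff.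
apply/nondecreasing_seqP => k; rewrite /series /= big_nat_recr//= lerDl.
exact: exp_coeff_ge0.
Qed.

Variables (g : R -> R) (n0 : nat).
Hypothesis gi : mu.-integrable `[0, 1] (EFin \o g).
Hypothesis moments : forall n, (n0 <= n)%N ->
  \int[mu]_(t in `[0, 1]) (expR (n%:R * t) * g t) = 0.

Lemma Rintegral01D f1 f2 : mu.-integrable `[0, 1] (EFin \o f1) ->
  mu.-integrable `[0, 1] (EFin \o f2) ->
  \int[mu]_(t in `[0, 1]) (f1 t + f2 t) =
  \int[mu]_(t in `[0, 1]) f1 t + \int[mu]_(t in `[0, 1]) f2 t.
Proof. by move=> *; rewrite RintegralD. Qed.

Lemma gumbel_partial_sum N x K : (0 < N)%N -> (n0 <= N)%N ->
  \int[mu]_(t in `[0, 1])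
    ((\sum_(0 <= k < K) exp_coeff (- expR (N%:R * t + - (N%:R * x))) k.+1) * g t) = 0.
Proof.
move=> N0 Nn0; elim: K => [|K IH].
  rewrite (@eq_Rintegral _ _ _ _ _ (fun=> 0)); last first.
    by move=> t _; rewrite big_nil mul0r.
  by rewrite Rintegral_cst ?mul0r.
have cy := @continuous_gumbel_coeff N%:R (- (N%:R * x)).
have cS := @continuous_gumbel_sum N%:R (- (N%:R * x)).
under eq_Rintegral do rewrite big_nat_recr//= mulrDl.
rewrite Rintegral01D; [|exact: Rintegrable01_mul|exact: Rintegrable01_mul].
rewrite IH add0r.
pose c := (-1) ^+ K.+1 * expR (- (N%:R * x)) ^+ K.+1 / K.+1`!%:R.
have E t : exp_coeff (- expR (N%:R * t + - (N%:R * x))) K.+1 * g t =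
    c * (expR ((N * K.+1)%:R * t) * g t).
  rewrite /exp_coeff /= -(mulN1r (expR _)) exprMn expRD exprMn /c.
  rewrite (_ : (N * K.+1)%:R * t = K.+1%:R * (N%:R * t)); last by rewrite natrM; ring.
  by rewrite (expRM_natl K.+1 (N%:R * t)); ring.
under eq_Rintegral do rewrite E.
have ie : mu.-integrable `[0, 1] (EFin \o (fun t => expR ((N * K.+1)%:R * t) * g t)).
  apply: Rintegrable01_mul => //; have := @continuous_expR_affine (N * K.+1)%:R 0.
  by under eq_fun do rewrite addr0.
rewrite RintegralZl// moments ?mulr0//.
by rewrite (leq_trans Nn0)// leq_pmulr.
Qed.

(** The functions exp (- e^{N (t - x)}) are entire in e^t, so that they are
orthogonal to g up to their constant term 1; as N grows they tend to the
indicator function of t < x. *)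
Lemma gumbel_orthogonal N x : (0 < N)%N -> (n0 <= N)%N ->
  \int[mu]_(t in `[0, 1]) ((expR (- expR (N%:R * t + - (N%:R * x))) - 1) * g t) = 0.
Proof.
move=> N0 Nn0; pose y t := expR (N%:R * t + - (N%:R * x)).
pose S K t := \sum_(0 <= k < K) exp_coeff (- y t) k.+1.
have SE K t : S K t = series (exp_coeff (- y t)) K.+1 - 1.
  by rewrite /series /= big_nat_recl// {1}/exp_coeff /= expr0 fact0 divr1 addrC addKr.
have cy : continuous y by exact: continuous_expR_affine.
have cS k : continuous (S k) by exact: continuous_gumbel_sum.
pose B := expR (expR (N%:R + `|N%:R * x|)).
have yB t : 0 <= t <= 1 -> y t <= expR (N%:R + `|N%:R * x|).
  move=> /andP[t0 t1]; rewrite ler_expR lerD//; first by rewrite ler_piMr.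
  by have := ler_norm (- (N%:R * x)); rewrite normrN.
have SB K t : 0 <= t <= 1 -> `|S K t| <= B.
  move=> t01; apply: le_trans (ler_norm_sum _ _ _) _.
  apply: (@le_trans _ _ (series (exp_coeff (y t)) K.+1)).
    rewrite /series /= big_nat_recl// -[X in X <= _]add0r lerD//.
      by apply: exp_coeff_ge0; exact: expR_ge0.
    apply: ler_sum => k _; rewrite /exp_coeff /= normrM normrX normrN.
    by rewrite (ger0_norm (expR_ge0 _)) ger0_norm// invr_ge0.
  apply: le_trans (series_exp_coeff_le _ (expR_ge0 _)) _.
  by rewrite ler_expR; exact: yB.
have cv : (\int[mu]_(t in `[0, 1]) (S K t * g t)) @[K --> \oo] -->
    \int[mu]_(t in `[0, 1]) ((expR (- y t) - 1) * g t).
  apply: (@Rdominated_cvg _ _ _ (fun t => B * `|g t|)) => //.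
  - by move=> n; exact: Rintegrable01_mul.
  - apply: measurable_funM; last by apply/measurable_EFinP; exact: measurable_int gi.
    apply: measurable_funTS; apply: continuous_measurable_fun => t.
    apply: cvgB; last exact: cvg_cst.
    apply: (@continuous_comp _ _ _ (fun t => - y t) expR); last exact: continuous_expR.
    by apply: cvgN; exact: cy.
  - apply: aeW => t _; apply: cvgM; last exact: cvg_cst.
    under eq_fun do rewrite SE; apply: cvgB; last exact: cvg_cst.
    have := @is_cvg_series_exp_coeff R (- y t).
    rewrite -(cvg_shiftS (series (exp_coeff (- y t)))) //.
  - apply: Rintegrable01_mul; [exact: integrable_norm | exact: cst_continuous].
  - by move=> n t; rewrite /= in_itv /= => t01; rewrite normrM ler_wpM2r// SB.
rewrite -(cvg_lim (@Rhausdorff R) cv); apply: (cvg_lim (@Rhausdorff R)).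
rewrite (_ : (fun K => _) = (fun=> 0)); first exact: cvg_cst.
by apply/funext => K; exact: gumbel_partial_sum.
Qed.

End ExponentialMoments.

Section MomentUniqueness.
Variable R : realType.
Local Notation mu := (@lebesgue_measure R).
Implicit Types (f : R -> R) (x t y : R).

Lemma expRN_le_inv y : 0 < y -> expR (- y) <= y^-1.
Proof.
move=> y0; rewrite expRN lef_pV2 ?posrE ?expR_gt0//.
by apply: le_trans (expR_ge1Dx y); lra.
Qed.

Lemma gumbel_cvg (n0 : nat) (d : R) : d != 0 ->
  (expR (- expR ((n0 + n.+1)%:R * d)) - 1) @[n --> \oo] -->
  (if 0 < d then -1 else 0 : R).
Proof.
move=> d0; apply/cvgrPdist_le => e e0; near=> n.
have nn : n%:R <= (n0 + n.+1)%:R :> R by rewrite ler_nat addnS ltnW// ltnS leq_addl.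
set N : R := (n0 + n.+1)%:R in nn *.
have N0 : 0 < N by rewrite ltr0n addnS.
have ad : 0 < `|d| by rewrite normr_gt0.
have Nd : 0 < N * `|d| by exact: mulr_gt0.
have small : expR (- (N * `|d|)) <= e.
  apply: le_trans (expRN_le_inv Nd) _.
  rewrite -[e]invrK lef_pV2 ?posrE ?invr_gt0// -ler_pdivrMr//.
  by apply: le_trans nn; rewrite -invfM; near: n; exact: nbhs_infty_ger.
case: ifPn => [dp|dn].
  rewrite (_ : -1 - _ = - expR (- expR (N * d))); last by ring.
  rewrite normrN ger0_norm ?expR_ge0//.
  apply: le_trans (expRN_le_inv (expR_gt0 _)) _.
  by rewrite -expRN; move: small; rewrite gtr0_norm.
have dn0 : d <= 0 by rewrite leNgt.
have Nd0 : N * d = - (N * `|d|) by rewrite ler0_norm// mulrN opprK.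
rewrite sub0r normrN Nd0; set Y := expR _ in small *.
have Y0 : 0 <= Y by exact: expR_ge0.
have h1 := expR_ge1Dx (- Y).
have h2 : expR (- Y) <= 1 by rewrite expR_le1 oppr_le0.
by rewrite ler_norml; apply/andP; split; lra.
Unshelve. all: by end_near. Qed.

Variables (g : R -> R) (n0 : nat).
Hypothesis gi : mu.-integrable `[0, 1] (EFin \o g).
Hypothesis moments : forall n, (n0 <= n)%N ->
  \int[mu]_(t in `[0, 1]) (expR (n%:R * t) * g t) = 0.

Lemma tail_integral_eq0 x : 0 <= x <= 1 -> \int[mu]_(t in `]x, 1]) g t = 0.
Proof.
move=> x01; have /andP[x0 x1] := x01.
pose u t : R := if 0 < t - x then -1 else 0.
have uE : u = (fun t => -1 * \1_(`]x, +oo[%classic : set R) t).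
  apply/funext => t; rewrite /u subr_gt0 indicE; case: ifPn => xt.
    by rewrite mem_set ?mulr1//= in_itv /= xt.
  by rewrite memNset ?mulr0//= in_itv /= andbT; exact/negP.
have mu_ : measurable_fun (`[0, 1] : set R) u.
  by rewrite uE; apply: measurable_funM.
have mg : measurable_fun (`[0, 1] : set R) g.
  by apply/measurable_EFinP; exact: (measurable_int mu gi).
have c1 : (\int[mu]_(t in `[0, 1]) ((expR (- expR ((n0 + n.+1)%:R * t + - ((n0 + n.+1)%:R * x))) - 1) * g t))
    @[n --> \oo] --> \int[mu]_(t in `[0, 1]) (u t * g t).
  apply: (@Rdominated_cvg _ _ _ _ (fun t => `|g t|)) => //.
  - move=> n; apply: Rintegrable01_mul => // t; apply: cvgB; last exact: cvg_cst.
    apply: (@continuous_comp _ _ _ (fun t => - expR ((n0 + n.+1)%:R * t + - ((n0 + n.+1)%:R * x))) expR);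
      last exact: continuous_expR.
    by apply: cvgN; exact: continuous_expR_affine.
  - exact: measurable_funM mu_ mg.
  - exists [set x]; split; [by []|exact: lebesgue_measure_set1|].
    move=> t /= nt; apply: contrapT => tx; apply: nt => _.
    apply: cvgM; last exact: cvg_cst.
    have d0 : t - x != 0 by rewrite subr_eq0; apply/eqP.
    have := gumbel_cvg n0 d0; rewrite /u.
    by under eq_fun do rewrite mulrBr.
  - exact: integrable_norm.
  - move=> n t _; rewrite normrM ler_piMl//.
    have e0 := expR_gt0 (- expR ((n0 + n.+1)%:R * t + - ((n0 + n.+1)%:R * x))).
    have e1 : expR (- expR ((n0 + n.+1)%:R * t + - ((n0 + n.+1)%:R * x))) <= 1.
      by rewrite expR_le1 oppr_le0 expR_ge0.
    rewrite ler_norml; apply/andP; split; lra.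
have u0 : \int[mu]_(t in `[0, 1]) (u t * g t) = 0.
  rewrite -(cvg_lim (@Rhausdorff R) c1); apply: (cvg_lim (@Rhausdorff R)).
  rewrite (_ : (fun n => _) = (fun=> 0)); first exact: cvg_cst.
  apply/funext => n; apply: (gumbel_orthogonal gi moments); first by rewrite addnS.
  exact: leq_addr.
have -> : (`]x, 1]%classic : set R) = `[0, 1]%classic `&` [set t : R | x < t]%classic.
  apply/seteqP; split => t /=; rewrite !in_itv /=.
    by move=> /andP[xt ->]; rewrite andbT xt; split => //; apply: ltW; exact: le_lt_trans xt.
  by move=> [/andP[_ ->] ->].
rewrite Rintegral_mkcondr; apply: (@etrans _ _ (- \int[mu]_(t in `[0, 1]) (u t * g t))); last first.
  by rewrite u0 oppr0.
rewrite -[RHS]mulN1r -RintegralZl//.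
  apply: eq_Rintegral => t _; rewrite patchE /u subr_gt0.
  have -> : (t \in [set y : R | x < y]) = (x < t) by apply/idP/idP; rewrite inE.
  by case: ifP => _; rewrite ?mulN1r ?mul0r ?mulr0 ?opprK ?oppr0.
have : mu.-integrable `[0, 1] (EFin \o (fun t => u t * g t)).
  apply: (@le_integrable _ _ _ mu _ (@measurable_itv01 R) _ (EFin \o g)) => //.
    by apply/measurable_EFinP; exact: measurable_funM mu_ mg.
  move=> t _ /=; rewrite lee_fin normrM ler_piMl// /u.
  by case: ifP => _; rewrite ?normrN ?normr1 ?normr0.
by [].
Qed.

(** As all tail integrals vanish, the primitive of g is constant, and g is almost
everywhere its derivative. *)
Lemma moments_eq0_ae : {ae mu, forall x, 0 < x < 1 -> g x = 0}.
Proof.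
pose f := g \_ (`[0, 1] : set R).
have fi y : mu.-integrable `[0, y] (EFin \o f).
  apply: (@integrableS _ _ _ mu setT) => //.
  by rewrite /f -restrict_EFin; apply: (integrable_mkcond _ _).1.
have fl := integrable_locally (@measurable_itv01 R) gi.
have fg t : 0 <= t <= 1 -> f t = g t.
  by move=> t01; rewrite /f patchE mem_set//= in_itv.
have F0 y : 0 <= y <= 1 -> \int[mu]_(t in `[0, y]) f t = \int[mu]_(t in `[0, 1]) g t.
  move=> y01; have /andP[y0 y1] := y01.
  have E z : z <= 1 -> \int[mu]_(t in `[0, z]) f t = \int[mu]_(t in `[0, z]) g t.
    move=> z1; apply: eq_Rintegral => t; rewrite inE /= in_itv /= => /andP[t0 tz].
    by rewrite fg// t0 (le_trans tz).
  have := Rintegral_itvB (x := y) gi; rewrite !bnd_simp => /(_ y0 y1).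
  by rewrite tail_integral_eq0// E// => /eqP; rewrite subr_eq0 => /eqP ->.
have := FTC1 (a := BLeft 0) fi fl; apply: filterS; first exact: (ae_filter_ringOfSetsType mu).
move=> x hx x01.
have /andP[x0 x1] := x01.
move: hx; rewrite lte_fin => /(_ x0)[_].
rewrite fg ?ltW// => <-; rewrite derive1E.
rewrite (@near_eq_derive _ _ _ _ (cst (\int[mu]_(t in `[0, 1]) g t))) ?derive_cst//.
have xo : x \in `]0, 1[ by rewrite in_itv.
near=> y; apply: F0.
have : y \in `]0, 1[ by near: y; exact: near_in_itvoo.
by rewrite in_itv => /andP[? ?]; rewrite !ltW.
Unshelve. all: by end_near. Qed.

End MomentUniqueness.

(** * The imaginary axis of the rho-plane *)

Section DampedIntegrals.
Variables (R : realType) (a : R).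
Local Notation C := R[i].
Local Notation mu := (@lebesgue_measure R).
Variable q : R -> C.
Hypothesis iq : cintegrable `]0, 1[ q.
Implicit Types (z w : C) (t x s : R).

Let sub01 : `[0, 1] `<=` (`[-4, 4] : set R) := @itv01_sub R.

Lemma damped_integral_cvg0 (u : nat -> R -> C) (psi : R -> R) :
  (forall n, ccontinuous (u n)) -> continuous psi ->
  (forall t, active a t -> 0 < psi t) ->
  (forall n t, active a t -> normc (u n t) <= expR (- (n%:R * psi t))) ->
  forall e, 0 < e -> \forall n \near \oo,
    normc (cintegral `[0, 1] (fun t => u n t * cut a q t)) <= e.
Proof.
move=> cu cpsi psi0 upsi e e0.
have ic := cintegrable_cut01 a iq.
have iN : mu.-integrable `[0, 1] (EFin \o (fun t => normc (cut a q t))).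
  exact: cintegrable_normc.
pose F n t := expR (- (n%:R * psi t)) * normc (cut a q t).
have iF n : mu.-integrable `[0, 1] (EFin \o F n).
  apply: Rintegrable01_mul => // t.
  apply: (@continuous_comp _ _ _ (fun t => - (n%:R * psi t)) expR); last exact: continuous_expR.
  by apply: cvgN; apply: cvgM; [exact: cvg_cst|exact: cpsi].
have cF : (\int[mu]_(t in `[0, 1]) F n t) @[n --> \oo] --> (0 : R).
  have i0 : \int[mu]_(t in `[0, 1]) (0 : R) = 0 by rewrite Rintegral_cst ?mul0r.
  rewrite -[X in _ --> X]i0.
  apply: (@Rdominated_cvg _ _ F (fun=> 0) (fun t => normc (cut a q t))) => //.
  - apply: aeW => t _; rewrite /F /cut; case: ifPn => [|_]; last first.
      by under eq_fun do rewrite normc0 mulr0; exact: cvg_cst.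
    rewrite inE => /psi0 p0; rewrite -[X in _ --> X](mul0r (normc (q t))).
    apply: cvgM; last exact: cvg_cst.
    apply/cvgrPdist_le => d d0; near=> n.
    have n0 : 0 < n%:R :> R by rewrite ltr0n; near: n; exact: nbhs_infty_gt.
    rewrite sub0r normrN ger0_norm ?expR_ge0//.
    apply: le_trans (expRN_le_inv (mulr_gt0 n0 p0)) _.
    rewrite -[d]invrK lef_pV2 ?posrE ?invr_gt0 ?mulr_gt0// -ler_pdivrMr//.
    by near: n; exact: nbhs_infty_ger.
  - move=> n t _; rewrite /F ger0_norm ?mulr_ge0 ?expR_ge0 ?normc_ge0// /cut.
    case: ifPn => [|_]; last by rewrite normc0 mulr0.
    rewrite inE => /psi0 p0; rewrite ler_piMl ?normc_ge0// expR_le1 oppr_le0.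
    by rewrite mulr_ge0// ltW.
near=> n; apply: le_trans (normc_cintegral (@measurable_itv01 R) _ (iF n) _) _.
- exact: cintegrableMc.
- move=> t _; rewrite normcM /F /cut; case: ifPn => [|_]; last by rewrite normc0 !mulr0.
  by rewrite inE => at_; rewrite ler_wpM2r ?normc_ge0// upsi.
rewrite -ler_pdivlMl//; near: n.
have e2 : 0 < 2^-1 * e by rewrite mulr_gt0.
move/cvgrPdist_le: cF => /(_ _ e2); apply: filterS => n.
by rewrite sub0r normrN; exact: le_trans (ler_norm _).
Unshelve. all: by end_near. Qed.

End DampedIntegrals.

Section ImaginaryAxis.
Variables (R : realType) (a : R).
Hypothesis a12 : 1 <= a < 2.
Local Notation C := R[i].
Local Notation mu := (@lebesgue_measure R).
Variable q : R -> C.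
Hypothesis iq : cintegrable `]0, 1[ q.
Variable h : C.
Implicit Types (z w : C) (t x s y : R).

Let sub01 : `[0, 1] `<=` (`[-4, 4] : set R) := @itv01_sub R.

Definition imag (y : R) : C := 'i%C * y%:C.

Lemma normc_imag y : normc (imag y) = `|y|.
Proof. by rewrite normcM normci mul1r normc_real. Qed.

Lemma Im_imag y : complex.Im (imag y) = y.
Proof. by rewrite /imag Im_mul /=; ring. Qed.

Lemma imag_eq0 y : (imag y == 0) = (y == 0).
Proof. by rewrite -normc_eq0 normc_imag normr_eq0. Qed.

Lemma expi_imag y s : expi (imag y) s = (expR (- (y * s)))%:C.
Proof.
rewrite /expi /imag (_ : 'i%C * ('i%C * y%:C) * s%:C = (- (y * s))%:C); last first.
  by rewrite mulrA mulcii mulN1r mulNr -rmorphM -rmorphN.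
by rewrite /cexp /= sin0 cos0 mulr1.
Qed.

Lemma active_le t : active a t -> [/\ a - 1 <= t, 0 < t & t < 1].
Proof. by rewrite /active /= !in_itv /= => -[/andP[? _] /andP[? ?]]. Qed.

Lemma shift_edge_fourier z s :
  expi z s * edge_fourier a q z = cintegral `[0, 1] (fun t => expi z (2 * t + (s - a)) * cut a q t).
Proof.
rewrite -cintegralZ//; last first.
  apply: cintegrableMc => //; first exact: cintegrable_cut01.
  exact: ccontinuous_kernel.
apply: eq_cintegral => t _; rewrite mulrA -expiD; congr (expi z _ * _); ring.
Qed.

Let expN_small (K e : R) : 0 < e -> \forall n \near \oo, K * expR (- n%:R) <= e.
Proof.
move=> e0; near=> n; have n0 : 0 < n%:R :> R by rewrite ltr0n; near: n; exact: nbhs_infty_gt.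
have [K0|K0] := leP K 0.
  by apply: le_trans (ltW e0); rewrite mulr_le0_ge0// expR_ge0.
apply: (@le_trans _ _ (K * n%:R^-1)); first by rewrite ler_wpM2l ?expRN_le_inv// ltW.
rewrite ler_pdivrMr// mulrC -ler_pdivrMr//.
by near: n; exact: nbhs_infty_ger.
Unshelve. all: by end_near. Qed.

(** After division by e^n the exponentials of edge_plus at rho = i n are
e^{- n (3 - a)} and e^{- n (2 t - a + 1)}, and 2 t - a + 1 > 0 on the active
part of the edge. *)
Lemma edge_plus_upper_decay (e : R) : 0 < e -> \forall n \near \oo,
  normc (edge_plus a q h (imag n%:R)) <= expR n%:R * e.
Proof.
move=> e0; have /andP[a1 a2] := a12.
pose B := (1 + normc h) / 2; have B0 : 0 < B by rewrite divr_gt0// ltr_wpDr// normc_ge0.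
pose u (n : nat) t := expi (imag n%:R) (2 * t + (1 - a)).
have eB : 0 < e / (2 * B) by rewrite divr_gt0// mulr_gt0.
have d1 : \forall n \near \oo, normc (cintegral `[0, 1] (fun t => u n t * cut a q t)) <= e / (2 * B).
  apply: (damped_integral_cvg0 iq (psi := fun t => 2 * t + (1 - a))) => //.
  - by move=> n; exact: ccontinuous_expi.
  - by move=> t; apply: cvgD; [apply: cvgM; [exact: cvg_cst|exact: cvg_id]|exact: cvg_cst].
  - by move=> t /active_le[t1 t2 t3]; lra.
  - by move=> n t _; rewrite /u normc_expi Im_imag.
near=> n; have n1 : 1 <= n%:R :> R by rewrite ler1n; near: n; exact: nbhs_infty_gt.
have D1 : normc (cintegral `[0, 1] (fun t => u n t * cut a q t)) <= e / (2 * B) by near: n.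
have D2 : normc (edge_mass a q) * expR (- n%:R) <= e / (2 * B).
  by near: n; exact: expN_small.
set z := imag n%:R; have hz : normc ('i%C * h / z) <= normc h.
  rewrite normcf normcM normci mul1r normc_imag ger0_norm//.
  by rewrite ler_piMr ?normc_ge0// invf_le1//; lra.
have n2 : normc (2%:R : C) = 2 by rewrite normc_nat.
have c1 : normc ((1 - 'i%C * h / z) / 2%:R) <= B.
  rewrite normcf n2 ler_pM2r// (le_trans (le_normcB _ _))//.
  by rewrite (normc_nat R 1) lerD2l.
have c2 : normc ((1 + 'i%C * h / z) / 2%:R) <= B.
  rewrite normcf n2 ler_pM2r// (le_trans (le_normcD _ _))//.
  by rewrite (normc_nat R 1) lerD2l.
have F1 : normc (edge_fourier a q z) <= expR n%:R * (e / (2 * B)).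
  rewrite (_ : edge_fourier a q z = expi z (- 1) * (expi z 1 * edge_fourier a q z)); last first.
    by rewrite expiN mulrA mulVf ?mul1r// expi_neq0.
  rewrite normcM normc_expi Im_imag mulrN mulr1 opprK ler_wpM2l ?expR_ge0//.
  by rewrite shift_edge_fourier.
have A1 : normc (expi z (2 - a) * edge_mass a q) <= expR n%:R * (e / (2 * B)).
  rewrite normcM normc_expi Im_imag.
  apply: (@le_trans _ _ (normc (edge_mass a q))).
    rewrite ler_piMl ?normc_ge0// expR_le1 oppr_le0 mulr_ge0//; lra.
  rewrite -ler_pdivrMl ?expR_gt0// -expRN mulrC; exact: D2.
rewrite /edge_plus; apply: le_trans (le_normcD _ _) _.
have -> : expR n%:R * e = B * (expR n%:R * (e / (2 * B))) + B * (expR n%:R * (e / (2 * B))).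
  by field; rewrite gt_eqF.
by apply: lerD; rewrite normcM ler_pM ?normc_ge0.
Unshelve. all: by end_near. Qed.

End ImaginaryAxis.

Section VanishingPotential.
Variables (R : realType) (a : R).
Hypothesis a12 : 1 <= a < 2.
Local Notation C := R[i].
Local Notation mu := (@lebesgue_measure R).
Variable q : R -> C.
Hypothesis iq : cintegrable `]0, 1[ q.
Variable h : C.
Implicit Types (z w : C) (t x s y : R).

Lemma edge_plus_multiple_eq0 (c : C) (w : C -> C) :
  (forall z, z != 0 -> edge_plus a q h z = c * w z) ->
  (\forall n \near \oo, expR n%:R / 8 <= normc (w (imag n%:R))) -> c = 0.
Proof.
move=> E wge; apply: contrapT => /eqP; rewrite -normc_gt0 => c0.
have e0 : 0 < normc c / 16 by rewrite divr_gt0.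
near \oo%classic => n.
have n0 : imag (n%:R : R) != 0.
  by rewrite imag_eq0 pnatr_eq0 -lt0n; near: n; exact: nbhs_infty_gt.
have h1 : expR n%:R / 8 <= normc (w (imag n%:R)) by near: n.
have h2 : normc (edge_plus a q h (imag n%:R)) <= expR n%:R * (normc c / 16).
  by near: n; exact: edge_plus_upper_decay.
move: h2; rewrite E// normcM => h2.
have h3 := ler_wpM2l (ltW c0) h1.
have : 0 < expR n%:R * normc c by rewrite mulr_gt0// expR_gt0.
by move: h2 h3; lra.
Unshelve. all: by end_near. Qed.

Hypothesis E0 : forall z, z != 0 -> edge_plus a q h z = 0.

(** On the negative imaginary axis the total mass is the dominant term. *)
Lemma edge_plus_eq0_lower n : 4 * normc h <= n%:R -> (0 < n)%N ->
  normc (edge_mass a q) <= 3 * normc (cintegral `[0, 1]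
    (fun t => expi (imag (- (n%:R / 2))) (2 * t - 2) * cut a q t)).
Proof.
move=> hn n0; set z := imag _; have nR : 0 < n%:R :> R by rewrite ltr0n.
have z0 : z != 0 by rewrite imag_eq0 oppr_eq0; lra.
have nz : normc ('i%C * h / z) <= 2^-1.
  rewrite normcf normcM normci mul1r normc_imag normrN gtr0_norm ?divr_gt0//.
  by rewrite ler_pdivrMr ?divr_gt0//; lra.
set w := 'i%C * h / z in nz.
have key : (1 - w) * edge_mass a q + (1 + w) * (expi z (a - 2) * edge_fourier a q z) = 0.
  have := E0 z0; rewrite /edge_plus -/w => E.
  have -> : (1 - w) * edge_mass a q + (1 + w) * (expi z (a - 2) * edge_fourier a q z) =
    2%:R * expi z (a - 2) * ((1 - w) / 2%:R * (expi z (2 - a) * edge_mass a q) +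
      (1 + w) / 2%:R * edge_fourier a q z).
    have ee : expi z (a - 2) * expi z (2 - a) = 1.
      by rewrite -expiD (_ : a - 2 + (2 - a) = 0) ?/expi ?mulr0 ?cexp0//; ring.
    rewrite (_ : 2%:R * _ * _ = (1 - w) * ((expi z (a - 2) * expi z (2 - a)) * edge_mass a q) +
      (1 + w) * (expi z (a - 2) * edge_fourier a q z)); last by field.
    by rewrite ee mul1r.
  by rewrite E mulr0.
move: key; rewrite shift_edge_fourier//.
have -> : (fun t => expi z (2 * t + (a - 2 - a)) * cut a q t) =
    (fun t => expi z (2 * t - 2) * cut a q t).
  by apply/funext => t; congr (expi z _ * _); ring.
set G := cintegral _ _ => /eqP; rewrite addr_eq0 => /eqP key.
have w1 : 2^-1 <= normc (1 - w).
  by apply: le_trans (le_normc_subr _ _); rewrite (normc_nat R 1); lra.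
have w2 : normc (1 + w) <= 3 / 2.
  by apply: le_trans (le_normcD _ _) _; rewrite (normc_nat R 1); lra.
have k2 : normc (1 - w) * normc (edge_mass a q) = normc (1 + w) * normc G.
  by rewrite -!normcM key normcN.
have := ler_wpM2r (normc_ge0 (edge_mass a q)) w1.
have := ler_wpM2r (normc_ge0 G) w2.
by rewrite k2; lra.
Qed.

(** Relative to the mass term, the integrand of the other term of edge_plus
carries e^{- n (1 - t)}, and t < 1 on the active part of the edge. *)
Lemma edge_mass_eq0 : edge_mass a q = 0.
Proof.
apply: contrapT => /eqP; rewrite -normc_gt0 => m0.
have e0 : 0 < normc (edge_mass a q) / 6 by rewrite divr_gt0.
pose u (n : nat) t := expi (imag (- (n%:R / 2))) (2 * t - 2).
have d1 : \forall n \near \oo,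
    normc (cintegral `[0, 1] (fun t => u n t * cut a q t)) <= normc (edge_mass a q) / 6.
  apply: (damped_integral_cvg0 iq (psi := fun t => 1 - t)) => //.
  - by move=> n; exact: ccontinuous_expi.
  - by move=> t; apply: cvgB; [exact: cvg_cst|exact: cvg_id].
  - by move=> t /active_le[t1 t2 t3]; lra.
  - move=> n t _; rewrite /u normc_expi Im_imag.
    by rewrite (_ : - (- (n%:R / 2) * (2 * t - 2)) = - (n%:R * (1 - t))) //; field.
near \oo%classic => n.
have n0 : (0 < n)%N by near: n; exact: nbhs_infty_gt.
have hn : 4 * normc h <= n%:R by near: n; exact: nbhs_infty_ger.
have D1 : normc (cintegral `[0, 1] (fun t => u n t * cut a q t)) <= normc (edge_mass a q) / 6.
  by near: n.
have k := edge_plus_eq0_lower hn n0.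
by move: (le_trans k (ler_wpM2l (ler0n R 3) D1)) m0; lra.
Unshelve. all: by end_near. Qed.

Lemma exponential_moments_eq0 : exists n0, forall n, (n0 <= n)%N ->
  cintegral `[0, 1] (fun t => (expR (n%:R * t))%:C * cut a q t) = 0.
Proof.
have [n0 _ hn0] := nbhs_infty_gtr (normc h * 2 : R).
(* With rho = - i n / 2 the kernel of edge_fourier is a multiple of e^{n t}. *)
exists n0.+1 => n n0n; have nh : normc h * 2 < n%:R by apply: hn0; exact: ltnW.
have h0 := normc_ge0 h; have nR : 0 < n%:R :> R by lra.
set z := imag (- (n%:R / 2) : R).
have z0 : z != 0 by rewrite imag_eq0 oppr_eq0; lra.
have w0 : 1 + 'i%C * h / z != 0.
  rewrite -normc_gt0; apply: lt_le_trans (le_normc_addr _ _).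
  rewrite (normc_nat R 1) subr_gt0 normcf normcM normci mul1r normc_imag normrN gtr0_norm ?divr_gt0//.
  by rewrite ltr_pdivrMr ?divr_gt0//; lra.
have : edge_fourier a q z = 0.
  have := E0 z0; rewrite /edge_plus edge_mass_eq0 !mulr0 add0r => /eqP.
  rewrite !mulf_eq0 (negbTE w0) invr_eq0 => /orP[|/eqP//].
  by rewrite /= pnatr_eq0.
move=> F0; have := shift_edge_fourier a iq z a; rewrite F0 mulr0 => e.
rewrite [RHS]e; apply: eq_cintegral => t _; rewrite /z expi_imag.
by congr ((expR _)%:C * _); field.
Qed.

Lemma potential_eq0_ae : {ae mu, forall x, 0 < x < 1 -> cut a q x = 0}.
Proof.
have [n0 mom] := exponential_moments_eq0.
have [iRe iIm] := cintegrable_cut01 a iq.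
have real_moment (x : R) (w : C) : complex.Re (x%:C * w) = x * complex.Re w /\
    complex.Im (x%:C * w) = x * complex.Im w.
  by rewrite Re_mul Im_mul /= !mul0r subr0 addr0.
have zRe := moments_eq0_ae (n0 := n0) iRe.
have zIm := moments_eq0_ae (n0 := n0) iIm.
have {}zRe : {ae mu, forall x, 0 < x < 1 -> complex.Re (cut a q x) = 0}.
  apply: zRe => n /mom /(congr1 (@complex.Re R)); rewrite /cintegral /= => E; rewrite -[RHS]E.
  by apply: eq_Rintegral => t _; rewrite (real_moment _ _).1.
have {}zIm : {ae mu, forall x, 0 < x < 1 -> complex.Im (cut a q x) = 0}.
  apply: zIm => n /mom /(congr1 (@complex.Im R)); rewrite /cintegral /= => E; rewrite -[RHS]E.
  by apply: eq_Rintegral => t _; rewrite (real_moment _ _).2.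
apply: filterS2 zRe zIm; first exact: (ae_filter_ringOfSetsType mu).
by move=> x hRe hIm x01; apply: complex_eqP; [exact: hRe|exact: hIm].
Qed.

End VanishingPotential.

(** * Uniqueness of the potentials *)

Section Uniqueness.
Variables (R : realType) (m : nat) (a : R).
Hypothesis a12 : 1 <= a < 2.
Variables (H : 'I_m.-1 -> R[i]) (q qt : 'I_m.-1 -> R -> R[i]).
Hypotheses (injH : injective H) (Lq : forall j, L2_01 (q j)) (Lqt : forall j, L2_01 (qt j)).
Local Notation mu := (@lebesgue_measure R).

Lemma v_false_imag_ge j :
  \forall n \near \oo, expR n%:R / 8 <= normc (v H false j (imag n%:R ^+ 2)).
Proof.
near=> n; have n1 : 1 <= n%:R :> R by rewrite ler1n; near: n; exact: nbhs_infty_gt.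
have E : `|complex.Im (imag (n%:R : R))| = n%:R by rewrite Im_imag ger0_norm//; lra.
have im1 : 1 <= `|complex.Im (imag (n%:R : R))| by rewrite E.
have tp : tame_point true (imag (n%:R : R)).
  by split; [apply: normc_ccos_ge; right | apply: normc_csin_ge; right].
rewrite -[in expR _]E; apply: v_false_ge; first by right.
  by rewrite normc_imag ger0_norm//; near: n; exact: nbhs_infty_ger.
by rewrite normc_imag ger0_norm//; lra.
Unshelve. all: by end_near. Qed.

Lemma difference_eq0_ae (lam : bool -> nat -> R[i]) j :
  (forall nu, is_spectrum a q H nu (lam nu)) ->
  (forall nu, is_spectrum a qt H nu (lam nu)) ->
  {ae mu, forall x, 0 < x < 1 -> cut a (difference q qt j) x = 0}.
Proof.
move=> sq sqt; have ip := difference_integrable Lq Lqt j.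
have D nu z : Delta a qt H nu (z ^+ 2) = Delta a q H nu (z ^+ 2).
  exact: (Delta_agree a12 injH Lq Lqt (sq nu) (sqt nu)).
have e0 := edge_form_false_eq0 a12 injH Lq Lqt j (D false).
have [c e1] := edge_form_true_multiple a12 injH Lq Lqt j (D true).
have plus z : z != 0 ->
    edge_plus a (difference q qt j) (H j) z = c * v H false j (z ^+ 2).
  by move=> z0; rewrite edge_plusE// e0 mulr0 addr0 e1.
have c0 := edge_plus_multiple_eq0 a12 ip plus (v_false_imag_ge j).
apply: (potential_eq0_ae ip (h := H j)) => z z0.
by rewrite plus// c0 mul0r.
Qed.

End Uniqueness.

Theorem theorem1 (R : realType) (m : nat) (a : R) (H : 'I_m.-1 -> R[i])
    (q qt : 'I_m.-1 -> R -> R[i]) (lam : bool -> nat -> R[i])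
    (m_ge2 : (2 <= m)%N)
    (a_range : 1 <= a < 2)
    (H_distinct : injective H)
    (q_L2 : forall j, L2_01 (q j))
    (qt_L2 : forall j, L2_01 (qt j))
    (q_zero : forall j,
       {ae (@lebesgue_measure R), forall x, 0 < x < a - 1 -> q j x = 0})
    (qt_zero : forall j,
       {ae (@lebesgue_measure R), forall x, 0 < x < a - 1 -> qt j x = 0})
    (spec_q : forall nu, is_spectrum a q H nu (lam nu))
    (spec_qt : forall nu, is_spectrum a qt H nu (lam nu)) :
  forall j,
    {ae (@lebesgue_measure R), forall x, 0 < x < 1 -> q j x = qt j x}.
Proof.
move=> j; have := difference_eq0_ae a_range H_distinct q_L2 qt_L2 j spec_q spec_qt.
have := q_zero j; have := qt_zero j.
apply: filterS3; first exact: (ae_filter_ringOfSetsType (@lebesgue_measure R)).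
move=> x qt0 q0 d0 x01; have /andP[x0 x1] := x01.
have [xa|xa] := ltP x (a - 1); first by rewrite q0 ?qt0// x0.
have := d0 x01; rewrite /cut mem_set; last first.
  by split; rewrite /= in_itv /= ?xa ?x0 ?ltW.
by move/eqP; rewrite subr_eq0 => /eqP.
Qed.
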